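(* Consider the problem $$\text{(GEP)}\qquad \min_{x\in\mathbb{R}^n} f(x)\quad\text{s.t.}\quad 0\in F(x)+b(x)^T N_P(g(x)),$$ where $P\subseteq\mathbb{R}^l$ is a convex polyhedral set and $f:\mathbb{R}^n\to\mathbb{R}$, $F:\mathbb{R}^n\to\mathbb{R}^m$, $g:\mathbb{R}^n\to\mathbb{R}^l$, $b:\mathbb{R}^n\to\mathbb{R}^{l\times m}$ are twice continuously differentiable. Let $\bar x$ be a feasible point of (GEP) and assume that $$\nabla g(\bar x)^Td^*=0,\ d^*\in \big(N_P(g(\bar x))\big)^+\ \Rightarrow\ d^*=0,\qquad\qquad b(\bar x)^Td^*=0,\ d^*\in \big(N_P(g(\bar x))\big)^+\ \Rightarrow\ d^*=0.$$ Then there exists a unique $\eta^*\in N_P(g(\bar x))$ such that $0=F(\bar x)+b(\bar x)^T\eta^*$. Consider directions $d\in\mathbb{R}^n$ which, together with some $e^*\in\mathbb{R}^l$, satisfy $$\nabla f(\bar x)d\le 0,\qquad 0=\nabla F(\bar x)d+(\nabla b(\bar x)d)^T\eta^*+b(\bar x)^Te^*,\qquad (\nabla g(\bar x)d,e^* )\in T_{\mathrm{gph}\,N_P}(g(\bar x),\eta^* ).\qquad (\ast)$$ (i) Let $\bar x$ be a local optimal solution of (GEP), and let $d$ (with $e^*$) satisfy $(\ast)$. Suppose that for all $(\lambda,\tau^* )\in\mathbb{R}^m\times\mathbb{R}^l$ $$\left.\begin{array}{l}\nabla F(\bar x)^T\lambda+\nabla(b^T\eta^* )(\bar x)^T\lambda-\nabla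 g(\bar x)^T\tau^*=0,\\ (\tau^*,b(\bar x)\lambda)\in N_{\mathrm{gph}\,N_P}\big((g(\bar x),\eta^* );(\nabla g(\bar x)d,e^* )\big)\end{array}\right\}\ \Longrightarrow\ \lambda=0.$$ Then there exist multipliers $\lambda\in\mathbb{R}^m$, $\tau^*\in\mathbb{R}^l$ with $(\tau^*,b(\bar x)\lambda)\in N_{\mathrm{gph}\,N_P}\big((g(\bar x),\eta^* );(\nabla g(\bar x)d,e^* )\big)$ such that the first-order condition $$\nabla f(\bar x)-\nabla F(\bar x)^T\lambda-\nabla(b^T\eta^* )(\bar x)^T\lambda+\nabla g(\bar x)^T\tau^*=0$$ (with $\nabla f(\bar x)$ understood as a column vector) and the second-order condition $$\nabla^2 f(\bar x)(d,d)-\big\langle\lambda,\nabla^2F(\bar x)(d,d)+\nabla^2b(\bar x)(d,d)^T\eta^*+2(\nabla b(\bar x)d)^Te^*\big\rangle+\langle\tau^*,\nabla^2g(\bar x)(d,d)\rangle\ge 0$$ hold. (ii) Suppose that for every nonzero $d$ satisfying $(\ast)$ (with $e^*$) there is $(\alpha,\lambda,\tau^* )\in\mathbb{R}\times\mathbb{R}^m\times\mathbb{R}^l$, not all equal to zero, satisfying $\alpha\ge0$, $$\alpha\nabla f(\bar x)-\nabla F(\bar x)^T\lambda-\nabla(b^T\eta^* )(\bar x)^T\lambda+\nabla g(\bar x)^T\tau^*=0,\qquad (\tau^*,b(\bar x)\lambda)\in\widehat N_{T_{\mathrm{gph}\,N_P}(g(\bar x),\eta^* )}(\nabla g(\bar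 x)d,e^* ),$$ and $$\alpha\nabla^2 f(\bar x)(d,d)-\big\langle\lambda,\nabla^2F(\bar x)(d,d)+\nabla^2b(\bar x)(d,d)^T\eta^*+2(\nabla b(\bar x)d)^Te^*\big\rangle+\langle\tau^*,\nabla^2g(\bar x)(d,d)\rangle> 0.$$ Then $\bar x$ is an essential local minimizer of second order for (GEP).
   Context: $N_P$ is the normal cone mapping of convex analysis of $P$ (empty outside $P$), and $\mathrm{gph}\,N_P=\{(p,p^* )\mid p^*\in N_P(p)\}$. For a set $C$, $C^+:=\mathrm{span}(C-C)$. For a closed set $C$ and $z\in C$: tangent cone $T_C(z)=\{u\mid\exists t_k\downarrow0,u_k\to u: z+t_ku_k\in C\}$; regular (Fréchet) normal cone $\widehat N_C(z)=\{v\mid\langle v,z'-z\rangle\le o(\|z'-z\|)\ \forall z'\in C\}$ (empty if $z\notin C$); directional limiting normal cone $N_C(z;u)=\{v\mid\exists t_k\downarrow0,u_k\to u,v_k\to v: v_k\in\widehat N_C(z+t_ku_k)\}$. Derivatives: $\nabla\psi(x)$ is the Jacobian; $\nabla^2\psi(x)(d,d)$ is the vector with components $d^T\nabla^2\psi_i(x)d$. For the matrix-valued $b$: $\nabla b(x)d\in\mathbb{R}^{l\times m}$ is the directional derivative of $b$ at $x$ along $d$, $\nabla^2b(x)(d,d)\in\mathbb{R}^{l\times m}$ is the entrywise second derivative, and $\nabla(b^T\eta^* )(x)\in\mathbb{R}^{m\times n}$ is the Jacobian of $x\mapsto b(x)^T\eta^*$ with $\eta^*$ fixed. Essential local minimizer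 of second order: for a problem $\min f(x)$ s.t. $\varphi(x)\in\Omega$, a point $\bar x$ is an essential local minimizer of second order if there exist $\beta,\delta>0$ with $\max\{f(x)-f(\bar x),\mathrm{dist}(\varphi(x),\Omega)\}\ge\beta\|x-\bar x\|^2$ for all $x$ in the ball of radius $\delta$ around $\bar x$. (GEP) is regarded as a problem of this form with $\varphi(x):=(x,-F(x))$ and $\Omega:=\{(x,b(x)^T\eta)\mid (g(x),\eta)\in\mathrm{gph}\,N_P\}$. *)

(* Defs.v *)
From HB Require Import structures.
From mathcomp Require Import all_boot all_order all_algebra.
From mathcomp Require Import all_classical all_reals all_analysis.
Set Implicit Arguments.
Unset Strict Implicit.
Unset Printing Implicit Defensive.
Import Order.TTheory GRing.Theory Num.Theory.
Import numFieldNormedType.Exports.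
Local Open Scope classical_set_scope.
Local Open Scope ring_scope.

(* Vectors of R^k are columns 'cV[R]_k, and a pair (u, v) of R^p x R^q is the
   stacked vector col_mx u v of R^(p + q). *)

Section Euclidean.
Context {R : realType}.

Definition dot k (u v : 'cV[R]_k) : R := (u^T *m v) 0 0.

(* The norm `|u| provided by the library on matrices is the sup norm (it
   induces the same topology). *)
Definition enorm k (u : 'cV[R]_k) : R := Num.sqrt (dot u u).

(* Meaningful for nonempty C only: inf set0 = 0. *)
Definition enorm_dist k (y : 'cV[R]_k) (C : set 'cV[R]_k) : R :=
  inf [set enorm (y - z) | z in C].

(* <<X>>%VS is the linear span of a finite sequence X of elements of C - C. *)
Definition span_diff k (C : set 'cV[R]_k) : set 'cV[R]_k :=
  [set v | exists X : seq 'cV[R]_k,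
     (forall w, w \in X -> exists2 a, C a & exists2 c, C c & w = a - c) /\
     v \in <<X>>%VS].

End Euclidean.

Section Calculus.
Context {R : realType}.

(* In finite dimension, the derivative x |-> 'd f x is continuous iff it is
   continuous along each vector v. *)
Definition C1 (V W : normedModType R) (f : V -> W) : Prop :=
  (forall x, differentiable f x) /\ (forall v, continuous ('D_v f)).

Definition C2 (V W : normedModType R) (f : V -> W) : Prop :=
  (forall x, differentiable f x) /\ (forall v, C1 ('D_v f)).

Definition grad n (f : 'cV[R]_n -> R) (x : 'cV[R]_n) : 'cV[R]_n :=
  \col_j 'D_(delta_mx j 0) f x.

(* The library's jacobian is for maps between row vectors, and is the
   transpose of the usual matrix. *)
Definition jac n m (F : 'cV[R]_n -> 'cV[R]_m) (x : 'cV[R]_n) : 'M[R]_(m, n) :=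
  \matrix_(i, j) ('D_(delta_mx j 0) F x) i 0.

Definition hess n (f : 'cV[R]_n -> R) (x : 'cV[R]_n) : 'M[R]_n :=
  \matrix_(i, j) 'D_(delta_mx i 0) ('D_(delta_mx j 0) f) x.

Definition hessq n (f : 'cV[R]_n -> R) (x d : 'cV[R]_n) : R :=
  (d^T *m hess f x *m d) 0 0.

Definition hessq_mx n p q (B : 'cV[R]_n -> 'M[R]_(p, q)) (x d : 'cV[R]_n) :
    'M[R]_(p, q) :=
  \matrix_(i, j) hessq (fun y => B y i j) x d.

End Calculus.

Section VariationalAnalysis.
Context {R : realType}.

Definition polyhedral l (P : set 'cV[R]_l) : Prop :=
  exists k (A : 'M[R]_(k, l)) (c : 'cV[R]_k),
    P = [set y | forall i, (A *m y) i 0 <= c i 0].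

Definition ncone l (P : set 'cV[R]_l) (p : 'cV[R]_l) : set 'cV[R]_l :=
  [set ps | P p /\ forall q, P q -> dot ps (q - p) <= 0].

Definition gph_ncone l (P : set 'cV[R]_l) : set 'cV[R]_(l + l) :=
  [set z | ncone P (usubmx z) (dsubmx z)].

Definition tcone k (C : set 'cV[R]_k) (z : 'cV[R]_k) : set 'cV[R]_k :=
  [set u | exists (t_ : nat -> R) (u_ : nat -> 'cV[R]_k),
     [/\ forall i, 0 < t_ i, t_ @ \oo --> (0 : R), u_ @ \oo --> u &
         forall i, C (z + t_ i *: u_ i)]].

Definition regular_ncone k (C : set 'cV[R]_k) (z : 'cV[R]_k) : set 'cV[R]_k :=
  [set v | C z /\ forall e : R, 0 < e ->
     \forall z' \near z, C z' -> dot v (z' - z) <= e * enorm (z' - z)].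

Definition dir_ncone k (C : set 'cV[R]_k) (z u : 'cV[R]_k) : set 'cV[R]_k :=
  [set v | exists (t_ : nat -> R) (u_ v_ : nat -> 'cV[R]_k),
     [/\ forall i, 0 < t_ i, t_ @ \oo --> (0 : R), u_ @ \oo --> u,
         v_ @ \oo --> v & forall i, regular_ncone C (z + t_ i *: u_ i) (v_ i)]].

(* For the problem: minimize f x subject to phi x \in Omega. *)
Definition essential_local_min2 n k (f : 'cV[R]_n -> R)
    (phi : 'cV[R]_n -> 'cV[R]_k) (Omega : set 'cV[R]_k) (xbar : 'cV[R]_n) : Prop :=
  exists beta delta : R, [/\ 0 < beta, 0 < delta &
    forall x, enorm (x - xbar) <= delta ->
      beta * enorm (x - xbar) ^+ 2 <=
        Num.max (f x - f xbar) (enorm_dist (phi x) Omega)].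

End VariationalAnalysis.

Section GEP.
Context {R : realType} {n m l : nat}.
Context (P : set 'cV[R]_l) (f : 'cV[R]_n -> R) (F : 'cV[R]_n -> 'cV[R]_m).
Context (g : 'cV[R]_n -> 'cV[R]_l) (b : 'cV[R]_n -> 'M[R]_(l, m)).

Definition gep_multiplier (x : 'cV[R]_n) (eta : 'cV[R]_l) : Prop :=
  ncone P (g x) eta /\ 0 = F x + (b x)^T *m eta.

Definition gep_feasible (x : 'cV[R]_n) : Prop :=
  exists eta, gep_multiplier x eta.

Definition gep_local_min (x : 'cV[R]_n) : Prop :=
  gep_feasible x /\ \forall y \near x, gep_feasible y -> f x <= f y.

Definition gep_phi (x : 'cV[R]_n) : 'cV[R]_(n + m) := col_mx x (- F x).

Definition gep_Omega : set 'cV[R]_(n + m) :=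
  [set z | exists x eta, gph_ncone P (col_mx (g x) eta) /\
                         z = col_mx x ((b x)^T *m eta)].

Definition gep_critical (x : 'cV[R]_n) (eta : 'cV[R]_l)
    (d : 'cV[R]_n) (e : 'cV[R]_l) : Prop :=
  [/\ dot (grad f x) d <= 0,
      0 = jac F x *m d + ('D_d b x)^T *m eta + (b x)^T *m e &
      tcone (gph_ncone P) (col_mx (g x) eta) (col_mx (jac g x *m d) e)].

(* gep_first_order and gep_second_order come from the Lagrangian
     alpha * f - <lam, F + b^T eta> + <tau, g>;
   the second one also contains the cross term between the first-order changes
   of b and of eta, along d and e respectively. *)
Definition gep_first_order (x : 'cV[R]_n) (eta : 'cV[R]_l)
    (alpha : R) (lam : 'cV[R]_m) (tau : 'cV[R]_l) : 'cV[R]_n :=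
  alpha *: grad f x - (jac F x)^T *m lam
    - (jac (fun y => (b y)^T *m eta) x)^T *m lam + (jac g x)^T *m tau.

Definition gep_second_order (x : 'cV[R]_n) (eta : 'cV[R]_l)
    (d : 'cV[R]_n) (e : 'cV[R]_l)
    (alpha : R) (lam : 'cV[R]_m) (tau : 'cV[R]_l) : R :=
  alpha * hessq f x d
    - dot lam (hessq_mx F x d + (hessq_mx b x d)^T *m eta
               + 2 *: (('D_d b x)^T *m e))
    + dot tau (hessq_mx g x d).

End GEP.

(* Main.v *)
Require Import Defs.
From HB Require Import structures.
From mathcomp Require Import all_boot all_order all_algebra.
From mathcomp Require Import all_classical all_reals all_analysis.
From mathcomp Require Import ring lra.
Import Order.TTheory GRing.Theory Num.Theory.
Import numFieldNormedType.Exports.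
Local Open Scope classical_set_scope.
Local Open Scope ring_scope.

(* Regard the generalized equation as the constraint G(x, eta) \in D, where
   G(x, eta) = (F(x) + b(x)^T eta, (g(x), eta)) and D = {0} x gph N_P. By
   Fourier-Motzkin elimination D is a finite union of polyhedra, so near each
   of its points it is the translate of its tangent cone, only finitely many
   cones arise in this way, and the normal cone to D in a critical direction w
   is the finite union of the regular normal cones to the tangent cone S at w
   of the tangent cone of D.

   Necessity: the qualification condition bounds |M^T y| from below on unit
   normals y of S, where M is the derivative of G. Minimizing
   |G - s| + eps |. - start| over s in S then shows that a second-order curve
   can be corrected to a feasible one at a cost proportional to its residual,
   so that c.v + qf(h) + Gamma |M v + q(h) - s| >= 0 for all v and all s in S.
   The multiplier is the limit of those of the quadratic penalizations of the
   problem of minimizing c.v subject to M v + q(h) \in S.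

   Sufficiency: points violating quadratic growth have multipliers eta' that
   approach eta at a linear rate, because b^T is injective on differences of
   normals. Rescaling yields a critical direction in the limit, and expanding
   the Lagrangian to second order along it contradicts strict positivity. *)

(** The cone S is a finite union of cones and in general not convex, so linear programming duality
    yields no multiplier. The exact penalty bound with weight Gamma takes its place: it keeps the
    quadratic penalizations bounded below, while the lower bound kap of |M^T y| on unit normals
    keeps their multipliers bounded. Limits of normals are normals because only finitely many cones
    occur. A multiplier is written y = (-lam, tau, sigma), with one block each for the equation, for
    g and for eta. Stationarity in eta forces sigma = b lam, so no third multiplier shows in the
    statement. The qualification condition of (i) only yields lam = 0; then sigma = 0 and nabla g^T
    tau = 0. The first hypothesis now gives tau = 0, since tau lies in the span of N_P - N_P: graph
    points can be moved both ways along directions orthogonal to the active constraint normals. In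
    the sufficiency part differences are divided by the distance in x alone, not in (x, eta); this
    is what makes the limiting d nonzero. *)

Set Implicit Arguments.
Unset Strict Implicit.
Unset Printing Implicit Defensive.

(** * Inner product, Euclidean norm, and limits of matrices *)

Section EuclideanNorm.
Context {R : realType}.

Lemma dotE k (u v : 'cV[R]_k) : dot u v = \sum_i u i 0 * v i 0.
Proof. by rewrite /dot mxE; apply: eq_bigr => i _; rewrite mxE. Qed.

Lemma dotC k (u v : 'cV[R]_k) : dot u v = dot v u.
Proof. by rewrite !dotE; apply: eq_bigr => i _; rewrite mulrC. Qed.

Lemma dotDr k (u v w : 'cV[R]_k) : dot u (v + w) = dot u v + dot u w.
Proof. by rewrite /dot mulmxDr mxE. Qed.

Lemma dotZr k a (u v : 'cV[R]_k) : dot u (a *: v) = a * dot u v.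
Proof. by rewrite /dot -scalemxAr mxE. Qed.

Lemma dotNr k (u v : 'cV[R]_k) : dot u (- v) = - dot u v.
Proof. by rewrite -scaleN1r dotZr mulN1r. Qed.

Lemma dotBr k (u v w : 'cV[R]_k) : dot u (v - w) = dot u v - dot u w.
Proof. by rewrite dotDr dotNr. Qed.

Lemma dot0r k (u : 'cV[R]_k) : dot u 0 = 0.
Proof. by rewrite /dot mulmx0 mxE. Qed.

Lemma dotDl k (u v w : 'cV[R]_k) : dot (v + w) u = dot v u + dot w u.
Proof. by rewrite dotC dotDr !(dotC _ u). Qed.

Lemma dotZl k a (u v : 'cV[R]_k) : dot (a *: v) u = a * dot v u.
Proof. by rewrite dotC dotZr (dotC _ u). Qed.

Lemma dotNl k (u v : 'cV[R]_k) : dot (- v) u = - dot v u.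
Proof. by rewrite dotC dotNr (dotC _ u). Qed.

Lemma dotBl k (u v w : 'cV[R]_k) : dot (v - w) u = dot v u - dot w u.
Proof. by rewrite dotDl dotNl. Qed.

Lemma dot0l k (u : 'cV[R]_k) : dot 0 u = 0.
Proof. by rewrite dotC dot0r. Qed.

Lemma dot_mulmxr p q (A : 'M[R]_(p, q)) u v :
  dot u (A *m v) = dot (A^T *m u) v.
Proof. by rewrite /dot trmx_mul trmxK mulmxA. Qed.

Lemma dot_col_mx p q (a c : 'cV[R]_p) (b d : 'cV[R]_q) :
  dot (col_mx a b) (col_mx c d) = dot a c + dot b d.
Proof. by rewrite /dot tr_col_mx mul_row_col mxE. Qed.

Lemma dot_ge0 k (u : 'cV[R]_k) : 0 <= dot u u.
Proof. by rewrite dotE sumr_ge0 // => i _; rewrite -expr2 sqr_ge0. Qed.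

Lemma dot_eq0 k (u : 'cV[R]_k) : dot u u = 0 -> u = 0.
Proof.
rewrite dotE => /psumr_eq0P u0; apply/colP => i; rewrite mxE.
apply/eqP; rewrite -sqrf_eq0 expr2; apply/eqP; apply: u0 => // j _.
by rewrite -expr2 sqr_ge0.
Qed.

Lemma enorm_ge0 k (u : 'cV[R]_k) : 0 <= enorm u.
Proof. exact: sqrtr_ge0. Qed.

Lemma enorm_sqr k (u : 'cV[R]_k) : enorm u ^+ 2 = dot u u.
Proof. by rewrite sqr_sqrtr // dot_ge0. Qed.

Lemma enorm0 k : enorm (0 : 'cV[R]_k) = 0.
Proof. by rewrite /enorm dot0r sqrtr0. Qed.

Lemma enorm_eq0 k (u : 'cV[R]_k) : enorm u = 0 -> u = 0.
Proof. by move=> u0; apply: dot_eq0; rewrite -enorm_sqr u0 expr0n. Qed.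

Lemma enorm_gt0 k (u : 'cV[R]_k) : u != 0 -> 0 < enorm u.
Proof.
move=> u0; rewrite lt_neqAle enorm_ge0 andbT eq_sym.
by apply: contra u0 => /eqP/enorm_eq0 ->.
Qed.

Lemma enormZ k a (u : 'cV[R]_k) : enorm (a *: u) = `|a| * enorm u.
Proof.
by rewrite /enorm dotZl dotZr mulrA -expr2 sqrtrM ?sqr_ge0 // sqrtr_sqr.
Qed.

Lemma enormN k (u : 'cV[R]_k) : enorm (- u) = enorm u.
Proof. by rewrite /enorm dotNl dotNr opprK. Qed.

Lemma enormB k (u v : 'cV[R]_k) : enorm (u - v) = enorm (v - u).
Proof. by rewrite -enormN opprB. Qed.

Lemma dot_le k (u v : 'cV[R]_k) : dot u v <= enorm u * enorm v.
Proof.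
have [->|u0] := eqVneq u 0; first by rewrite dot0l enorm0 mul0r.
have [->|v0] := eqVneq v 0; first by rewrite dot0r enorm0 mulr0.
have pu := enorm_gt0 u0; have pv := enorm_gt0 v0.
have := dot_ge0 (enorm v *: u - enorm u *: v).
rewrite !(dotBl, dotBr, dotZl, dotZr) -!enorm_sqr (dotC v u).
set a := enorm u in pu *; set c := enorm v in pv *; set x := dot u v => h.
have : 0 <= (2 * (a * c)) * (a * c - x) by nra.
by rewrite pmulr_rge0 ?subr_ge0 // !mulr_gt0.
Qed.

Lemma dot_geN k (u v : 'cV[R]_k) : - (enorm u * enorm v) <= dot u v.
Proof. by rewrite lerNl -dotNr -[enorm v]enormN dot_le. Qed.

Lemma enormD k (u v : 'cV[R]_k) : enorm (u + v) <= enorm u + enorm v.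
Proof.
rewrite -(@ler_pXn2r _ 2) ?nnegrE ?addr_ge0 ?enorm_ge0 //.
rewrite enorm_sqr !(dotDl, dotDr) (dotC v u) sqrrD -!enorm_sqr.
have := dot_le u v; lra.
Qed.

Lemma enorm_triB k (u v : 'cV[R]_k) : enorm (u - v) <= enorm u + enorm v.
Proof. by rewrite -[enorm v]enormN enormD. Qed.

Lemma enorm_coord k (u : 'cV[R]_k) i : `|u i 0| <= enorm u.
Proof.
rewrite -sqrtr_sqr ler_wsqrtr // dotE (bigD1 i) //= expr2 lerDl.
by rewrite sumr_ge0 // => j _; rewrite -expr2 sqr_ge0.
Qed.

Lemma mx_norm_le p q (A : 'M[R]_(p, q)) (e : R) :
  0 <= e -> (forall i j, `|A i j| <= e) -> `|A| <= e.
Proof.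
by move=> e0 Ae; rewrite /Num.Def.normr/= mx_normrE bigmax_le // => -[i j] _ /=.
Qed.

Lemma mx_norm_coord p q (A : 'M[R]_(p, q)) i j : `|A i j| <= `|A|.
Proof.
by rewrite [leRHS]/Num.Def.normr/= mx_normrE; exact: (le_bigmax _ _ (i, j)).
Qed.

Lemma norm_le_enorm k (u : 'cV[R]_k) : `|u| <= enorm u.
Proof.
by apply: mx_norm_le (enorm_ge0 u) _ => i j; rewrite (ord1 j) enorm_coord.
Qed.

(** The factor [k] is cruder than its square root, but any constant will do: k <= k^2 for natural
    k. *)
Lemma enorm_le_norm k (u : 'cV[R]_k) : enorm u <= k%:R * `|u|.
Proof.
have k0 : 0 <= k%:R * `|u| :> R by rewrite mulr_ge0 // ler0n.
rewrite -(@ler_pXn2r _ 2) ?nnegrE ?enorm_ge0 // enorm_sqr dotE.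
apply: (@le_trans _ _ (\sum_(i < k) `|u| ^+ 2)).
  apply: ler_sum => i _; rewrite -expr2 -real_normK ?num_real //.
  by rewrite ler_pXn2r ?nnegrE //; exact: mx_norm_coord.
rewrite sumr_const card_ord exprMn -[leLHS]mulr_natl ler_wpM2r ?sqr_ge0 //.
by rewrite -natrX ler_nat -mulnn; case: (k) => // k'; rewrite leq_pmulr.
Qed.

Lemma cvg_mx (T : Type) (F : set_system T) {FF : Filter F} p q
    (f : T -> 'M[R]_(p, q)) (A : 'M[R]_(p, q)) :
  (forall i j, f x i j @[x --> F] --> A i j) -> f x @[x --> F] --> A.
Proof.
move=> fA; apply/cvgrPdist_le => e e0; near=> x.
apply: mx_norm_le (ltW e0) _ => i j.
rewrite !mxE; move: i j; near: x.
apply: filter_forall => i; apply: filter_forall => j.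
exact: ((cvgrPdist_le _ _).1 (fA i j)).
Unshelve. all: by end_near. Qed.

Lemma cvg_mx_coord (T : Type) (F : set_system T) {FF : Filter F} p q
    (f : T -> 'M[R]_(p, q)) (A : 'M[R]_(p, q)) i j :
  f x @[x --> F] --> A -> f x i j @[x --> F] --> A i j.
Proof.
move=> fA; apply: (@cvg_comp _ _ _ f (fun M : 'M[R]_(p, q) => M i j)) fA _.
exact: coord_continuous.
Qed.

Lemma cvg_sumr (T J : Type) (F : set_system T) {FF : Filter F}
    (V : normedModType R) (r : seq J) (f : J -> T -> V) (l : J -> V) :
  (forall j, f j x @[x --> F] --> l j) ->
  \sum_(j <- r) f j x @[x --> F] --> \sum_(j <- r) l j.
Proof.
move=> fl; elim: r => [|j r IH].
  by rewrite big_nil; under eq_cvg do rewrite big_nil; exact: cvg_cst.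
by rewrite big_cons; under eq_cvg do rewrite big_cons; apply: cvgD.
Qed.

Lemma cvg_mulmx (T : Type) (F : set_system T) {FF : Filter F} p q r
    (f : T -> 'M[R]_(p, q)) (g : T -> 'M[R]_(q, r)) (A : 'M[R]_(p, q))
    (B : 'M[R]_(q, r)) :
  f x @[x --> F] --> A -> g x @[x --> F] --> B ->
  f x *m g x @[x --> F] --> A *m B.
Proof.
move=> fA gB; apply: cvg_mx => i j; rewrite mxE.
under eq_cvg do rewrite mxE.
by apply: cvg_sumr => k; apply: cvgM; exact: cvg_mx_coord.
Qed.

Lemma cvg_trmx (T : Type) (F : set_system T) {FF : Filter F} p q
    (f : T -> 'M[R]_(p, q)) (A : 'M[R]_(p, q)) :
  f x @[x --> F] --> A -> (f x)^T @[x --> F] --> A^T.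
Proof.
move=> fA; apply: cvg_mx => i j; rewrite mxE.
by under eq_cvg do rewrite mxE; exact: cvg_mx_coord.
Qed.

Lemma cvg_col_mx (T : Type) (F : set_system T) {FF : Filter F} p q r
    (f : T -> 'M[R]_(p, r)) (g : T -> 'M[R]_(q, r)) (A : 'M[R]_(p, r))
    (B : 'M[R]_(q, r)) :
  f x @[x --> F] --> A -> g x @[x --> F] --> B ->
  col_mx (f x) (g x) @[x --> F] --> col_mx A B.
Proof.
move=> fA gB; apply: cvg_mx => i j.
case: (splitP i) => [i' ii'|i' ii'].
  have -> : i = lshift q i' by exact: val_inj.
  by rewrite col_mxEu; under eq_cvg do rewrite col_mxEu; exact: cvg_mx_coord.
have -> : i = rshift p i' by exact: val_inj.
by rewrite col_mxEd; under eq_cvg do rewrite col_mxEd; exact: cvg_mx_coord.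
Qed.

Lemma cvg_dot (T : Type) (F : set_system T) {FF : Filter F} k
    (f g : T -> 'cV[R]_k) (u v : 'cV[R]_k) :
  f x @[x --> F] --> u -> g x @[x --> F] --> v ->
  dot (f x) (g x) @[x --> F] --> dot u v.
Proof.
by move=> fu gv; apply: cvg_mx_coord; apply: cvg_mulmx => //; exact: cvg_trmx.
Qed.

Lemma cvg_enorm (T : Type) (F : set_system T) {FF : Filter F} k
    (f : T -> 'cV[R]_k) (u : 'cV[R]_k) :
  f x @[x --> F] --> u -> enorm (f x) @[x --> F] --> enorm u.
Proof.
move=> fu; apply: (@cvg_comp _ _ _ (fun x => dot (f x) (f x)) Num.sqrt).
  exact: (cvg_dot fu fu).
exact: sqrt_continuous.
Qed.

Lemma enorm_subr_continuous k (z : 'cV[R]_k) :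
  continuous (fun v : 'cV[R]_k => enorm (v - z)).
Proof.
move=> x; apply: (@cvg_enorm _ (nbhs x)).
by apply: (@cvgB _ _ _ (nbhs x)); [exact: cvg_id|exact: cvg_cst].
Qed.

Lemma near_enorm_lt k (z : 'cV[R]_k) (e : R) :
  0 < e -> \forall v \near z, enorm (v - z) < e.
Proof.
move=> e0; apply: (@cvgr_lt _ _ (nbhs z) _ _ _ (@enorm_subr_continuous _ z z)).
by rewrite subrr enorm0.
Qed.

Lemma near_enorm k (z : 'cV[R]_k) (P : set 'cV[R]_k) :
  (\forall v \near z, P v) ->
  exists2 e : R, 0 < e & forall v, enorm (v - z) < e -> P v.
Proof.
move=> /nbhs_normP[e /= e0 Pe]; exists e => // v vz; apply: Pe.
by rewrite /ball_/= distrC (le_lt_trans (norm_le_enorm _)).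
Qed.

Lemma cvg_enorm0 (T : Type) (F : set_system T) {FF : Filter F} k
    (f : T -> 'cV[R]_k) (u : 'cV[R]_k) :
  enorm (f x - u) @[x --> F] --> (0 : R) -> f x @[x --> F] --> u.
Proof.
move=> /cvgrPdist_lt fu; apply/cvgrPdist_lt => e e0.
near=> x; rewrite distrC (le_lt_trans (norm_le_enorm _)) //.
rewrite -[ltLHS](ger0_norm (enorm_ge0 _)) -normrN -[- _]sub0r.
by near: x; exact: fu.
Unshelve. all: by end_near. Qed.

Lemma cvg_enormB (T : Type) (F : set_system T) {FF : Filter F} k
    (f : T -> 'cV[R]_k) (u : 'cV[R]_k) :
  f x @[x --> F] --> u -> enorm (f x - u) @[x --> F] --> (0 : R).
Proof.
move=> fu; rewrite -(enorm0 k) -(subrr u); apply: cvg_enorm.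
by apply: cvgB => //; exact: cvg_cst.
Qed.

(** Heine-Borel for row vectors, carried over to columns by transposition. *)
Lemma cV_compact k (A : set 'cV[R]_k) (B : R) :
  closed A -> (forall u, A u -> enorm u <= B) -> compact A.
Proof.
move=> clA AB.
have -> : A = trmx @` [set v : 'rV[R]_k | A v^T].
  apply/seteqP; split => [u Au|_ [v Av <-] //].
  by exists u^T; rewrite /= trmxK.
have ctr p q : continuous (@trmx R p q).
  by move=> u; apply: (@cvg_trmx _ (nbhs u)); exact: cvg_id.
apply: continuous_compact; first exact/continuous_subspaceT/ctr.
apply: bounded_closed_compact.
  exists B; split=> [|y By v /= Av]; first exact: num_real.
  apply: mx_norm_le => [|i j].
    by apply: le_trans (ltW By); apply: le_trans (AB _ Av); exact: enorm_ge0.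
  rewrite (ord1 i); have := enorm_coord v^T j; rewrite mxE => /le_trans; apply.
  by apply: le_trans (ltW By); exact: AB.
by apply: preimage_closed => // v _; exact: ctr.
Qed.

Lemma closed_enorm_ball k (u : 'cV[R]_k) (B : R) :
  closed [set v | enorm (v - u) <= B].
Proof.
apply: (preimage_closed _ (@closed_le _ B)) => v _.
exact: enorm_subr_continuous.
Qed.

Lemma closed_dot_le k (a : 'cV[R]_k) (c : R) : closed [set v | dot a v <= c].
Proof.
apply: (preimage_closed _ (@closed_le _ c)) => v _.
by apply: (@cvg_dot _ (nbhs v)); [exact: cvg_cst|exact: cvg_id].
Qed.

(** The cluster point is described through indices beyond any [N], the form from which [choice]
    extracts a convergent subsequence. *)
Lemma bounded_cluster k (u_ : nat -> 'cV[R]_k) (B : R) :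
  (forall i, enorm (u_ i) <= B) ->
  exists u, forall (e : R) N, 0 < e -> exists2 i, (N <= i)%N & enorm (u_ i - u) < e.
Proof.
move=> uB; have cB := @closed_enorm_ball k 0 B.
have cpB : compact [set v : 'cV[R]_k | enorm (v - 0) <= B].
  by apply: (cV_compact (B := B) cB) => u /=; rewrite subr0.
have uA : (u_ @ \oo) [set v : 'cV[R]_k | enorm (v - 0) <= B].
  by exists 0%N => // i _; rewrite /= subr0; exact: uB.
have [u [_ clu]] := cpB _ _ uA.
exists u => e N e0.
have [||v [/= [i Ni <-] iu]] := clu [set u_ i | i in [set i | (N <= i)%N]]
    [set v | enorm (v - u) < e].
- by exists N => // i /= Ni; exists i.
- exact: near_enorm_lt.
by exists i.
Qed.

End EuclideanNorm.

(** * Tangent and normal cones of finite unions of polyhedra *)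

Section PolyhedralUnions.
Context {R : realType} {k : nat}.

(* A finite union of polyhedra is a list of lists of half-spaces
   (a, c) = {v | <a, v> <= c}. *)
Notation polyU := (seq (seq ('cV[R]_k * R))).

Definition inP (X : seq ('cV[R]_k * R)) (v : 'cV[R]_k) : bool :=
  all (fun h => dot h.1 v <= h.2) X.

Definition inU (D : polyU) (v : 'cV[R]_k) : bool := has (inP^~ v) D.

(** The right-hand sides are reset to 0, so that for [z] in the polyhedron this describes its
    tangent cone at [z]. *)
Definition active (X : seq ('cV[R]_k * R)) (z : 'cV[R]_k) :
    seq ('cV[R]_k * R) :=
  [seq (h.1, 0) | h <- X & dot h.1 z == h.2].

(* Describes the tangent cone of D at z, hence also D itself near z. *)
Definition Tloc (D : polyU) (z : 'cV[R]_k) : polyU :=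
  [seq active X z | X <- D & inP X z].

Fixpoint sublists {T : Type} (s : seq T) : seq (seq T) :=
  if s is x :: s' then sublists s' ++ map (cons x) (sublists s') else [:: [::]].

Lemma filter_sublists {T : eqType} (s : seq T) p :
  [seq x <- s | p x] \in sublists s.
Proof.
elim: s => //= x s IH; rewrite mem_cat; case: (p x); last by rewrite IH.
by rewrite map_f ?orbT.
Qed.

(** A finite list that contains [Tloc D z] for every [z]: each polyhedron is either dropped or
    replaced by a homogenized sublist of its constraints. *)
Fixpoint patterns (D : polyU) : seq polyU :=
  if D is X :: D' then
    patterns D' ++
    [seq Y :: E | Y <- [seq [seq (h.1, 0) | h <- Z] | Z <- sublists X],
                  E <- patterns D']
  else [:: [::]].

Lemma Tloc_patterns D z : Tloc D z \in patterns D.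
Proof.
rewrite /Tloc; elim: D => [|X D IH] /=; first by rewrite inE.
rewrite mem_cat; case: (inP X z) => /=; last by rewrite IH.
apply/orP; right; apply/allpairsP; exists (active X z, Tloc D z); split=> //=.
by apply/mapP; exists [seq h <- X | dot h.1 z == h.2]; rewrite ?filter_sublists.
Qed.

(** A constraint that is strict or violated at [z] stays so under small moves; an active one reduces
    to the sign of [dot a v]. *)
Lemma inP_near X z :
  \forall v \near (0 : 'cV[R]_k), inP X (z + v) = inP X z && inP (active X z) v.
Proof.
elim: X => [|[a c] X IH]; first by apply: (@nearW _ (nbhs (0 : 'cV[R]_k))) => v.
have a1 : 0 < enorm a + 1 by rewrite ltr_wpDl // enorm_ge0.
(* Half-spaces inactive at [z] keep their status within this radius. The summand 1 covers a = 0, and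
   the value 1 in the active case is arbitrary. *)
pose r := if dot a z == c then 1 else `|dot a z - c| / (enorm a + 1).
have r0 : 0 < r.
  by rewrite /r; case: eqP => // /eqP azc; rewrite divr_gt0 // normr_gt0 subr_eq0.
near=> v.
have IHv : inP X (z + v) = inP X z && inP (active X z) v by near: v.
have av : `|dot a z - c| > 0 -> `|dot a v| < `|dot a z - c|.
  rewrite normr_gt0 subr_eq0 => azc.
  have : enorm (v - 0) < r by near: v; exact: near_enorm_lt.
  rewrite subr0 /r (negbTE azc) ltr_pdivlMr // => vlt; apply: le_lt_trans vlt.
  rewrite ler_norml; have := dot_le a v; have := dot_geN a v.
  have := enorm_ge0 v; lra.
rewrite /= IHv /active /= dotDr.
case: (ltgtP (dot a z) c) => azc /=.
- have -> // : dot a z + dot a v <= c.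
  have azc0 : `|dot a z - c| > 0 by rewrite normr_gt0 subr_eq0 lt_eqF.
  have := av azc0; rewrite ltr_norml (@ltr0_norm _ (dot a z - c)) ?subr_lt0 //; lra.
- have -> // : (dot a z + dot a v <= c) = false.
  have azc0 : `|dot a z - c| > 0 by rewrite normr_gt0 subr_eq0 gt_eqF.
  apply/negbTE; rewrite -ltNge.
  have := av azc0; rewrite ltr_norml (@gtr0_norm _ (dot a z - c)) ?subr_gt0 //; lra.
- have -> : (dot a z + dot a v <= c) = (dot a v <= 0) by rewrite azc gerDl.
  by rewrite andbCA.
Unshelve. all: by end_near. Qed.

Lemma inU_near D z :
  \forall v \near (0 : 'cV[R]_k), inU D (z + v) = inU (Tloc D z) v.
Proof.
elim: D => [|X D IH]; first by apply: (@nearW _ (nbhs (0 : 'cV[R]_k))) => v.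
near=> v.
have IHv : inU D (z + v) = inU (Tloc D z) v by near: v.
have Xv : inP X (z + v) = inP X z && inP (active X z) v.
  by near: v; exact: inP_near.
rewrite [LHS]/= -/(inU D _) IHv Xv /Tloc /=.
by case: (inP X z).
Unshelve. all: by end_near. Qed.

Lemma inU_local D z :
  exists2 r : R, 0 < r &
    forall v, enorm v < r -> inU D (z + v) = inU (Tloc D z) v.
Proof.
have [r r0 Dr] := near_enorm (inU_near D z).
by exists r => // v vr; apply: Dr; rewrite subr0.
Qed.

Definition conic (D : polyU) : bool := all (all (fun h => h.2 == 0)) D.

Lemma conic_Tloc D z : conic (Tloc D z).
Proof.
apply/allP => _ /mapP[X _ ->]; apply/allP => _ /mapP[h _ ->] /=.
by rewrite eqxx.
Qed.

Lemma conic_inUZ D t v : conic D -> 0 < t -> inU D (t *: v) = inU D v.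
Proof.
move=> /allP cD t0; apply: eq_in_has => X /cD/allP cX.
apply: eq_in_all => h /cX /eqP ->.
by rewrite dotZr pmulr_rle0.
Qed.

Lemma inU_Tloc0 D z : inU D z -> inU (Tloc D z) 0.
Proof.
move=> /hasP[X XD zX]; apply/hasP; exists (active X z).
  by apply/mapP; exists X => //; rewrite mem_filter zX.
by apply/allP => _ /mapP[h _ ->] /=; rewrite dot0r.
Qed.

Lemma inU_closed D : closed [set v | inU D v].
Proof.
have cP X : closed [set v | inP X v].
  elim: X => [|h X IH].
    by rewrite (_ : [set v | _] = setT); [exact: closedT|apply/seteqP; split].
  rewrite (_ : [set v | _] = [set v | dot h.1 v <= h.2] `&` [set v | inP X v]).
    by apply: closedI => //; exact: closed_dot_le.
  by apply/seteqP; split => v /= /andP.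
elim: D => [|X D IH].
  by rewrite (_ : [set v | _] = set0); [exact: closed0|apply/seteqP; split].
rewrite (_ : [set v | _] = [set v | inP X v] `|` [set v | inU D v]).
  exact: closedU.
by apply/seteqP; split => v /= /orP.
Qed.

Definition polar (D : polyU) (y : 'cV[R]_k) : Prop :=
  forall v, inU D v -> dot y v <= 0.

Lemma polarZ D t y : 0 <= t -> polar D y -> polar D (t *: y).
Proof. by move=> t0 yD v /yD yv; rewrite dotZl mulr_ge0_le0. Qed.

Lemma polar_closed D : closed [set y | polar D y].
Proof.
rewrite (_ : [set y | _] = \bigcap_(v in [set v | inU D v]) [set y | dot v y <= 0]).
  by apply: closed_bigI => v _; exact: closed_dot_le.
by apply/seteqP; split => y /= yD v /yD; rewrite dotC.
Qed.

(** Near [z] the set is the translate of a closed cone. Closedness gives one inclusion; the constant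
    sequence [u] with small steps gives the other. *)
Lemma tconeE D z : inU D z -> tcone [set v | inU D v] z = [set v | inU (Tloc D z) v].
Proof.
move=> zD; have [r r0 Dr] := inU_local D z.
apply/seteqP; split => [u [t_ [u_ [t0 t_0 uu DD]]]|u uT] /=.
  apply: (closed_cvg _ (@inU_closed (Tloc D z)) _ _ uu) => /=.
  have tu0 : enorm (t_ i *: u_ i) @[i --> \oo] --> (0 : R).
    rewrite -(enorm0 k) -(scale0r u); apply: cvg_enorm; exact: cvgZ.
  near=> i; rewrite -(conic_inUZ _ (conic_Tloc _ _) (t0 i)) -Dr //; first exact: DD.
  by near: i; exact: (cvgr_lt _ tu0).
(* Scaled so that every step [t_ i *: u], including the first, is shorter than [r]. *)
pose t_ i : R := r / (enorm u + 1) * @harmonic R i.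
have c0 : 0 < r / (enorm u + 1) by rewrite divr_gt0 // ltr_wpDl // enorm_ge0.
have t0 i : 0 < t_ i by rewrite mulr_gt0 // harmonic_gt0.
exists t_, (fun=> u); split => //.
- by rewrite -[X in _ --> X](mulr0 (r / (enorm u + 1))); apply: cvgMl_tmp; exact: cvg_harmonic.
- exact: cvg_cst.
move=> i /=; rewrite Dr ?conic_inUZ ?conic_Tloc //.
rewrite enormZ gtr0_norm // /t_.
have h1 : @harmonic R i <= 1 by rewrite /harmonic /= invf_le1 // ler1n.
have q1 : enorm u / (enorm u + 1) < 1.
  by rewrite ltr_pdivrMr ?mul1r ?ltrDl // ltr_wpDl // enorm_ge0.
rewrite (_ : _ * enorm u = r * (enorm u / (enorm u + 1) * @harmonic R i)); last first.
  by move: (_^-1) (@harmonic R i) => q h; ring.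
rewrite gtr_pMr // (le_lt_trans _ q1) // ler_piMr //.
by rewrite divr_ge0 ?addr_ge0 ?enorm_ge0.
Unshelve. all: by end_near. Qed.

(* For a conic D, the limiting normal cone to D at 0. *)
Definition normals (D : polyU) (y : 'cV[R]_k) : Prop :=
  exists2 s, inU D s & polar (Tloc D s) y.

(** The cone [Tloc D s] takes only finitely many values, all in [patterns D], so the normals form a
    finite union of closed polars. Patterns that no [s] realizes contribute the empty set. *)
Lemma normals_closed D : closed [set y | normals D y].
Proof.
pose A E := [set y : 'cV[R]_k | (exists2 s, inU D s & Tloc D s = E) /\ polar E y].
have clA E : closed (A E).
  have [h|h] := pselect (exists2 s, inU D s & Tloc D s = E).
    rewrite (_ : A E = [set y | polar E y]); first exact: polar_closed.
    by apply/seteqP; split => [y [_ ?]|y ?].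
  rewrite (_ : A E = set0); first exact: closed0.
  by apply/seteqP; split => [y [/h]|].
rewrite (_ : [set y | _] = \bigcup_(E in [set` patterns D]) A E).
  by apply: closed_bigcup => [|E _]; [exact: finite_seq|exact: clA].
apply/seteqP; split => [y [s sD sy]|y [E _ [[s sD <-] sy]]]; last by exists s.
exists (Tloc D s) => /=; first exact: Tloc_patterns.
by split => //; exists s.
Qed.

Lemma normalsZ D t y : 0 <= t -> normals D y -> normals D (t *: y).
Proof. by move=> t0 [s sD sy]; exists s => //; exact: polarZ. Qed.

(** Near [z] the set is a translated cone. By homogeneity the o(|.|) inequality at a small multiple
    of [v] becomes [dot y v <= e] for every e > 0. *)
Lemma regular_nconeE D z y :
  regular_ncone [set v | inU D v] z y <-> inU D z /\ polar (Tloc D z) y.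
Proof.
have [r r0 Dr] := inU_local D z; split => [[zD Dy]|[zD Dy]]; split => //.
  move=> v vT; have [->|v0] := eqVneq v 0; first by rewrite dot0r.
  have nv := enorm_gt0 v0.
  apply/ler_addgt0Pl => e e0; rewrite addr0.
  have [d d0 Dd] := near_enorm (Dy (e / enorm v) (divr_gt0 e0 nv)).
  pose t := Num.min r d / 2 / enorm v.
  have t0 : 0 < t by rewrite !divr_gt0 // lt_min r0 d0.
  have tv : enorm (t *: v) = Num.min r d / 2.
    by rewrite enormZ gtr0_norm // divfK // gt_eqF.
  have m2 : Num.min r d / 2 < Num.min r d.
    by rewrite ltr_pdivrMr // ltr_pMr ?ltr1n // lt_min r0 d0.
  have := Dd (z + t *: v); rewrite addrAC subrr add0r tv.
  move: m2; rewrite lt_min => /andP[mr md] /(_ md) /=.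
  rewrite Dr ?tv // conic_inUZ ?conic_Tloc // => /(_ vT).
  by rewrite dotZr -tv enormZ gtr0_norm // mulrCA ler_pM2l // divfK // gt_eqF.
move=> e e0; near=> v; move=> /= vD.
have vz : enorm (v - z) < r by near: v; exact: near_enorm_lt.
apply: (@le_trans _ _ 0); last by rewrite mulr_ge0 ?enorm_ge0 // ltW.
by apply: Dy; rewrite -Dr // addrCA subrr addr0.
Unshelve. all: by end_near. Qed.

(** The points z + t (w + th s) with small t and th lie in [D], and around each of them [D] is a
    translate of [Tloc S s]. Hence [y] itself is a regular normal there, and the constant sequence
    [y] is a witness for the directional normal cone. *)
Lemma normals_dir_ncone D z w y :
  inU D z -> inU (Tloc D z) w -> normals (Tloc (Tloc D z) w) y ->
  dir_ncone [set v | inU D v] z w y.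
Proof.
move=> zD wT [s sS sy]; set T := Tloc D z in wT sS sy *; set S := Tloc T w in sS sy.
have [r1 r10 Dr] := inU_local D z; have [r2 r20 Tr] := inU_local T w.
have S0 : conic S by exact: conic_Tloc.
have T0 : conic T by exact: conic_Tloc.
have [r3 r30 Sr] := inU_local S s.
pose th i : R := r2 / (2 * (enorm s + 1)) * @harmonic R i.
pose t_ i : R := r1 / (2 * (enorm w + r2)) * @harmonic R i.
have s1 : 0 < 2 * (enorm s + 1) by rewrite mulr_gt0 // ltr_wpDl // enorm_ge0.
have w1 : 0 < 2 * (enorm w + r2) by rewrite mulr_gt0 // ltr_wpDl // enorm_ge0.
have th0 i : 0 < th i by rewrite mulr_gt0 ?harmonic_gt0 // divr_gt0.
have t0 i : 0 < t_ i by rewrite mulr_gt0 ?harmonic_gt0 // divr_gt0.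
have h1 i : @harmonic R i <= 1 by rewrite /harmonic /= invf_le1 // ler1n.
have th_lt i : enorm (th i *: s) < r2 / 2.
  rewrite enormZ gtr0_norm // (@le_lt_trans _ _ (r2 / (2 * (enorm s + 1)) * enorm s)) //.
    by rewrite ler_wpM2r ?enorm_ge0 // ler_piMr // divr_ge0 // ltW.
  rewrite mulrAC ltr_pdivrMr //; have := enorm_ge0 s; nra.
have t_lt i v : enorm v < r2 -> enorm (t_ i *: (w + v)) < r1 / 2.
  move=> vr; rewrite enormZ gtr0_norm //.
  rewrite (@le_lt_trans _ _ (r1 / (2 * (enorm w + r2)) * enorm (w + v))) //.
    by rewrite ler_wpM2r ?enorm_ge0 // ler_piMr // divr_ge0 // ltW.
  rewrite mulrAC ltr_pdivrMr //; have := enormD w v; have := enorm_ge0 w; nra.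
have cvg0 c : c * @harmonic R i @[i --> \oo] --> (0 : R).
  by rewrite -[X in _ --> X](mulr0 c); apply: cvgMl_tmp; exact: cvg_harmonic.
exists t_, (fun i => w + th i *: s), (fun=> y); split => //.
- exact: cvg0.
- rewrite -[X in _ --> X]addr0 -(scale0r s); apply: cvgD; first exact: cvg_cst.
  by apply: cvgZr_tmp; exact: cvg0.
- exact: cvg_cst.
move=> i; have sT : inU T (w + th i *: s).
  by rewrite Tr ?conic_inUZ // (lt_trans (th_lt i)) // ltr_pdivrMr // ltr_pMr // ltr1n.
have ths2 : enorm (th i *: s) < r2.
  by rewrite (lt_trans (th_lt i)) // ltr_pdivrMr // ltr_pMr // ltr1n.
have zsD : inU D (z + t_ i *: (w + th i *: s)).
  rewrite Dr ?conic_inUZ //.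
  by rewrite (lt_trans (t_lt i _ ths2)) // ltr_pdivrMr // ltr_pMr // ltr1n.
have tth : 0 < t_ i * th i by exact: mulr_gt0.
split => // e e0; near=> v => /= vD.
(* The three bounds serve the three identifications in turn: [D] with [T] at [z], then [T] with [S]
   at [w] after division by [t_ i], then [S] with [Tloc S s] at [s] after division by
   [t_ i * th i]. *)
have l1 : enorm (v - (z + t_ i *: (w + th i *: s))) < r1 / 2.
  by near: v; apply: near_enorm_lt; rewrite divr_gt0.
have l2 : enorm (v - (z + t_ i *: (w + th i *: s)))
    < t_ i * (r2 / 2).
  by near: v; apply: near_enorm_lt; rewrite (mulr_gt0 (t0 i)) // divr_gt0.
have l3 : enorm (v - (z + t_ i *: (w + th i *: s)))
    < t_ i * th i * r3.
  by near: v; apply: near_enorm_lt; rewrite (mulr_gt0 tth).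
set v' := v - _ in l1 l2 l3 *.
apply: (@le_trans _ _ 0); last by rewrite mulr_ge0 ?enorm_ge0 // ltW.
suff : inU (Tloc S s) ((t_ i * th i)^-1 *: v').
  by rewrite conic_inUZ ?conic_Tloc ?invr_gt0 // => /sy.
have e1 : (t_ i)^-1 *: v' = th i *: ((t_ i * th i)^-1 *: v').
  move: (t_ i) (th i) (th0 i) => a c c0.
  by rewrite scalerA invfM mulrCA divff ?mulr1 // gt_eqF.
rewrite -Sr; last first.
  rewrite enormZ gtr0_norm ?invr_gt0 // mulrC ltr_pdivrMr //.
  by rewrite mulrC.
rewrite -(conic_inUZ _ S0 (th0 i)) scalerDr -e1 -Tr; last first.
  rewrite (le_lt_trans (enormD _ _)) // [ltRHS](splitr r2) ltrD // enormZ.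
  by rewrite gtr0_norm ?invr_gt0 // mulrC ltr_pdivrMr // mulrC.
rewrite -(conic_inUZ _ T0 (t0 i)) addrA scalerDr scalerA divff ?gt_eqF // scale1r -Dr.
  by rewrite addrA /v' addrC subrK.
by rewrite (le_lt_trans (enormD _ _)) // [ltRHS](splitr r1) ltrD // t_lt.
Unshelve. all: by end_near. Qed.

End PolyhedralUnions.

(** * Quantified qualification condition and correction to feasible points *)

Section Openness.
Context {R : realType} {N k : nat}.
Implicit Types (S : seq (seq ('cV[R]_k * R))) (M : 'M[R]_(k, N)).

Lemma mulmx_bound p q (A : 'M[R]_(p, q)) :
  exists2 C : R, 0 <= C & forall v : 'cV[R]_q, enorm (A *m v) <= C * enorm v.
Proof.
pose C0 := \sum_i \sum_j `|A i j|.
have C00 : 0 <= C0 by apply: sumr_ge0 => i _; exact: sumr_ge0.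
exists (p%:R * C0) => [|v]; first by rewrite mulr_ge0 ?ler0n.
apply: (le_trans (enorm_le_norm _)); rewrite -mulrA ler_wpM2l ?ler0n //.
apply: mx_norm_le => [|i j]; first by rewrite mulr_ge0 ?enorm_ge0.
rewrite (ord1 j) mxE (le_trans (ler_norm_sum _ _ _)) //.
apply: (@le_trans _ _ (\sum_j `|A i j| * enorm v)).
  by apply: ler_sum => j' _; rewrite normrM ler_wpM2l // enorm_coord.
rewrite -mulr_suml ler_wpM2r ?enorm_ge0 // /C0 [leRHS](bigD1 i) //= lerDl.
by apply: sumr_ge0 => i' _; exact: sumr_ge0.
Qed.

Lemma mulmx_continuous p q (A : 'M[R]_(p, q)) :
  continuous (fun v : 'cV[R]_q => A *m v).
Proof.
by move=> v; apply: (@cvg_mulmx _ _ (nbhs v)); [exact: cvg_cst|exact: cvg_id].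
Qed.

(** [kap] is the minimum of |M^T y| over the compact set of unit normals, and homogeneity does the
    rest. If there is no unit normal, 0 is the only normal and any [kap] works. *)
Lemma normals_quantified S M :
  (forall y, normals S y -> M^T *m y = 0 -> y = 0) ->
  exists2 kap : R, 0 < kap &
    forall y, normals S y -> kap * enorm y <= enorm (M^T *m y).
Proof.
move=> CQ; pose A := [set y | normals S y] `&` [set y | enorm (y - 0) = 1].
have [A0|A0] := pselect (A !=set0); last first.
  exists 1 => // y Sy; have [->|y0] := eqVneq y 0.
    by rewrite mulmx0 !enorm0 mulr0.
  case: A0; exists ((enorm y)^-1 *: y); split.
    by apply: normalsZ => //; rewrite invr_ge0 enorm_ge0.
  rewrite /= subr0 enormZ ger0_norm ?invr_ge0 ?enorm_ge0 // mulVf // gt_eqF //.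
  exact: enorm_gt0.
have cA : compact A.
  apply: (@cV_compact _ _ _ 1) => [|y [_ /=]]; last by rewrite subr0 => ->.
  apply: closedI; first exact: normals_closed.
  apply: (preimage_closed _ (@closed_eq _ 1)) => v _.
  exact: enorm_subr_continuous.
have cf : {within A, continuous (fun y : 'cV[R]_k => enorm (M^T *m y))}.
  apply: continuous_subspaceT => y; apply: (@cvg_enorm _ _ (nbhs y)).
  exact: mulmx_continuous.
have [y0 /set_mem[Sy0 /=]] := compact_EVT_min A0 cA cf.
rewrite subr0 => y01 min0; exists (enorm (M^T *m y0)).
  apply: enorm_gt0; apply/eqP => /(CQ _ Sy0) y00.
  by move: y01; rewrite y00 enorm0 => /esym/eqP; rewrite oner_eq0.
move=> y Sy; have [->|yn0] := eqVneq y 0.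
  by rewrite mulmx0 !enorm0 mulr0.
have ny := enorm_gt0 yn0.
have /min0 : (enorm y)^-1 *: y \in A.
  apply/mem_set; split; first by apply: normalsZ => //; rewrite invr_ge0 ltW.
  by rewrite /= subr0 enormZ gtr0_norm ?invr_gt0 // mulVf // gt_eqF.
by rewrite -scalemxAr enormZ gtr0_norm ?invr_gt0 // mulrC ler_pdivlMr.
Qed.

(** Comparing [s] with s + h v gives 2 <a, v> <= h |v|^2 for a = x - s, every tangent [v] and all
    small h > 0. *)
Lemma nearest_normals S (x s : 'cV[R]_k) (e : R) :
  0 < e -> inU S s ->
  (forall s', inU S s' -> enorm (s' - s) < e -> enorm (x - s) <= enorm (x - s')) ->
  polar (Tloc S s) (x - s).
Proof.
move=> e0 sS near_s v vT; have [r r0 Sr] := inU_local S s.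
set a := x - s.
have key h : 0 < h -> h * enorm v < r -> h * enorm v < e ->
    2 * dot a v <= h * enorm v ^+ 2.
  move=> h0 hr he.
  have nhv : enorm (h *: v) = h * enorm v by rewrite enormZ gtr0_norm.
  have : enorm a <= enorm (a - h *: v).
    rewrite /a -addrA -opprD; apply: near_s.
      by rewrite Sr ?nhv // conic_inUZ ?conic_Tloc.
    by rewrite addrAC subrr add0r nhv.
  clearbody a; rewrite -(@ler_pXn2r _ 2) ?nnegrE ?enorm_ge0 // !enorm_sqr.
  rewrite !(dotBl, dotBr, dotZl, dotZr) (dotC v a) => h1.
  by rewrite -(ler_pM2l h0); lra.
rewrite leNgt; apply/negP => av0.
have v0 : v != 0 by apply: contraTneq av0 => ->; rewrite dot0r ltxx.
have nv := enorm_gt0 v0.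
(* Makes h |v|^2 smaller than <a, v>, against 2 <a, v> <= h |v|^2. *)
pose h := Num.min (Num.min r e) (dot a v / enorm v) / (2 * enorm v).
have m0 : 0 < Num.min (Num.min r e) (dot a v / enorm v).
  by rewrite !lt_min r0 e0 divr_gt0.
have h0 : 0 < h by rewrite divr_gt0 // mulr_gt0.
have hv : h * enorm v = Num.min (Num.min r e) (dot a v / enorm v) / 2.
  by rewrite /h invfM mulrA divfK // gt_eqF.
have hlt : h * enorm v < Num.min (Num.min r e) (dot a v / enorm v).
  by rewrite hv ltr_pdivrMr // ltr_pMr // ltr1n.
move: hlt; rewrite !lt_min => /andP[/andP[hr he] hd].
have := key h h0 hr he; rewrite expr2 mulrA.
move: hd; rewrite ltr_pdivlMr //; lra.
Qed.

(** Ekeland's argument, with Weierstrass supplying the minimizer. Were the residual a = H z - s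
    nonzero, it would be a normal of [S] by minimality in [s], while minimality in [z] would give
    |M^T a| <= (2 kap / 3) |a|: one third comes from the penalty weight, one from the linearization
    error. This contradicts the bound with [kap]. *)
Lemma openness S M (H : 'cV[R]_N -> 'cV[R]_k) (kap rho : R) z0 s0 :
  0 < kap ->
  (forall y, normals S y -> kap * enorm y <= enorm (M^T *m y)) ->
  continuous H ->
  (forall z z', enorm z <= rho -> enorm z' <= rho ->
     enorm (H z - H z' - M *m (z - z')) <= kap / 3 * enorm (z - z')) ->
  inU S s0 -> enorm z0 + 3 / kap * enorm (H z0 - s0) < rho ->
  exists z, [/\ enorm (z - z0) <= 3 / kap * enorm (H z0 - s0),
                enorm z < rho & inU S (H z)].
Proof.
move=> kap0 kapS cH lipH s0S z0rho; set r := enorm (H z0 - s0) in z0rho *.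
have r0 : 0 <= r by exact: enorm_ge0.
have k3 : 0 < kap / 3 by rewrite divr_gt0.
have k3V : 3 / kap = (kap / 3)^-1 by rewrite invf_div.
have rho0 : enorm z0 <= rho.
  apply: ltW; apply: le_lt_trans z0rho; rewrite lerDl mulr_ge0 //.
  by rewrite k3V invr_ge0 ltW.
have cB n (B : R) : compact [set u : 'cV[R]_n | enorm (u - 0) <= B].
  apply: (@cV_compact _ _ _ B); first exact: closed_enorm_ball.
  by move=> u /=; rewrite subr0.
have [B HB] : exists B : R, forall z, enorm z <= rho -> enorm (H z) <= B.
  have cf : {within [set u : 'cV[R]_N | enorm (u - 0) <= rho],
      continuous (fun z => enorm (H z))}.
    apply: continuous_subspaceT => z; apply: (@cvg_enorm _ _ (nbhs z)).
    exact: cH.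
  have [|c _ cmax] := compact_EVT_max _ (cB N rho) cf.
    by exists z0; rewrite /= subr0.
  by exists (enorm (H c)) => z zr; apply: cmax; rewrite inE /= subr0.
(* The minimizing [s] satisfies |s| <= B + r, so the extra 1 leaves a unit ball of competitors
   around it. *)
pose A := [set u : 'cV[R]_N | enorm (u - 0) <= rho] `*`
  ([set u : 'cV[R]_k | enorm (u - 0) <= B + r + 1] `&` [set s | inU S s]).
have cA : compact A.
  apply: compact_setX; first exact: cB.
  by apply: compact_closedI; [exact: cB|exact: inU_closed].
pose Psi (p : 'cV[R]_N * 'cV[R]_k) :=
  enorm (H p.1 - p.2) + kap / 3 * enorm (p.1 - z0).
have cPsi : {within A, continuous Psi}.
  apply: continuous_subspaceT => p; apply: (@cvgD _ _ _ (nbhs p)).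
    apply: (@cvg_enorm _ _ (nbhs p)); apply: (@cvgB _ _ _ (nbhs p)).
      apply: (@cvg_comp _ _ _ fst H _ (nbhs p.1)); [exact: cvg_fst|exact: cH].
    exact: cvg_snd.
  apply: (@cvgMl_tmp _ _ (nbhs p)); apply: (@cvg_enorm _ _ (nbhs p)).
  by apply: (@cvgB _ _ _ (nbhs p)); [exact: cvg_fst|exact: cvg_cst].
have A0 : A (z0, s0).
  split; [by rewrite /= subr0|split => //=].
  rewrite subr0 -[s0](subKr (H z0)) (le_trans (enorm_triB _ _)) //.
  rewrite -/r; have := HB _ rho0; lra.
have [|[z s] /set_mem[/= zr [sB sS]] Pmin] := compact_EVT_min _ cA cPsi.
  by exists (z0, s0).
rewrite !subr0 in zr sB.
have Pz : Psi (z, s) <= r.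
  by have := Pmin _ (mem_set A0); rewrite [leRHS]/Psi /= subrr enorm0 mulr0 addr0.
have zz0 : enorm (z - z0) <= 3 / kap * r.
  rewrite k3V mulrC ler_pdivlMr // mulrC; apply: le_trans Pz.
  by rewrite /Psi /= lerDr enorm_ge0.
have Hzs : enorm (H z - s) <= r.
  apply: le_trans Pz; rewrite /Psi /= lerDl mulr_ge0 ?enorm_ge0 //; exact: ltW.
have zrho : enorm z < rho.
  by apply: le_lt_trans z0rho; have := enormD (z - z0) z0; rewrite subrK; lra.
exists z; split => //.
have [/subr0_eq -> //|a0] := eqVneq (H z - s) 0.
set a := H z - s in a0 Hzs.
have na := enorm_gt0 a0.
(* For fixed [z] the penalty is constant, so [s] is a nearest point of [S] to [H z]. *)
have aS : normals S a.
  exists s => //; apply: (@nearest_normals _ _ _ 1) => // s' s'S s's.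
  have s'B : enorm s' <= B + r + 1.
    rewrite -[s'](subrK s) (le_trans (enormD _ _)) //.
    have : enorm s <= B + r.
      rewrite -[s](subKr (H z)) (le_trans (enorm_triB _ _)) // lerD //.
      exact: HB.
    lra.
  have : A (z, s') by split; [rewrite /= subr0|split => //=; rewrite subr0].
  by move=> /mem_set/Pmin; rewrite /Psi /= lerD2r.
(* Minimality in [z] for fixed [s], with [H] replaced by its linearization. *)
have grad v h : 0 < h -> enorm (z + h *: v) <= rho ->
    enorm a - 2 * (kap / 3) * (h * enorm v) <= enorm (a + h *: (M *m v)).
  move=> h0 zhr; have nhv : enorm (h *: v) = h * enorm v by rewrite enormZ gtr0_norm.
  have : A (z + h *: v, s) by split; [rewrite /= subr0|split => //=; rewrite subr0].
  move=> /mem_set/Pmin; rewrite /Psi /= -/a => h1.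
  have h2 := lipH _ _ zhr zr; rewrite (addrAC z) subrr add0r nhv in h2.
  have h3 : enorm (z + h *: v - z0) <= enorm (z - z0) + h * enorm v.
    by rewrite addrAC -nhv enormD.
  have h4 : enorm (H (z + h *: v) - s) <= enorm (a + h *: (M *m v)) + kap / 3 * (h * enorm v).
    apply: le_trans (_ : _ <= enorm (a + h *: (M *m v)) +
      enorm (H (z + h *: v) - H z - M *m (h *: v))) _; last by rewrite lerD2l.
    rewrite (le_trans _ (enormD _ _)) // -scalemxAr /a.
    by rewrite le_eqVlt; apply/orP; left; apply/eqP; congr enorm;
      apply/matrixP => i j; rewrite !mxE; ring.
  nra.
clearbody a; have dotM v : - (2 * (kap / 3)) * enorm a * enorm v <= dot a (M *m v).
  have [->|v0] := eqVneq v 0; first by rewrite mulmx0 dot0r enorm0 mulr0.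
  have nv := enorm_gt0 v0; set q := enorm (M *m v) ^+ 2.
  have q0 : 0 <= q by exact: sqr_ge0.
  rewrite leNgt; apply/negP; set c := - _ * _ * _ => hlt.
  (* The first entry keeps z + h v in the ball; the second makes the term h^2 |M v|^2 too small to
     offset a violation of the claimed slope. *)
  pose h := Num.min ((rho - enorm z) / enorm v) ((c - dot a (M *m v)) / (q + 1)).
  have q1 : 0 < q + 1 by rewrite ltr_wpDl.
  have h0 : 0 < h by rewrite lt_min !divr_gt0 // subr_gt0.
  have : enorm (z + h *: v) <= rho.
    rewrite (le_trans (enormD _ _)) // enormZ gtr0_norm //.
    have : h <= (rho - enorm z) / enorm v by rewrite ge_min lexx.
    rewrite ler_pdivlMr //; lra.
  move=> /(grad v h h0) hg.
  have hq : h * (q + 1) <= c - dot a (M *m v).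
    have : h <= (c - dot a (M *m v)) / (q + 1) by rewrite ge_min lexx orbT.
    by rewrite ler_pdivlMr.
  have sq : enorm (a + h *: (M *m v)) ^+ 2 =
      enorm a ^+ 2 + 2 * h * dot a (M *m v) + h ^+ 2 * q.
    rewrite /q !enorm_sqr !(dotDl, dotDr, dotZl, dotZr) (dotC _ a); ring.
  have nb := enorm_ge0 (a + h *: (M *m v)).
  set X := enorm (a + h *: (M *m v)) in hg sq nb.
  set d := dot a (M *m v) in hlt hq sq.
  have e1 : enorm a ^+ 2 - 2 * enorm a * (2 * (kap / 3) * (h * enorm v)) <= X ^+ 2.
    have e0 : 0 <= 2 * (kap / 3) * (h * enorm v) by rewrite !mulr_ge0 // ltW.
    have [l|l] := leP (enorm a) (2 * (kap / 3) * (h * enorm v)).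
      have := sqr_ge0 X; have : enorm a * enorm a <= enorm a * (2 * (kap / 3) * (h * enorm v)).
        by rewrite ler_pM2l.
      rewrite expr2; nra.
    have : (enorm a - 2 * (kap / 3) * (h * enorm v)) ^+ 2 <= X ^+ 2.
      by rewrite ler_pXn2r ?nnegrE // subr_ge0 ltW.
    rewrite sqrrB; have := sqr_ge0 (2 * (kap / 3) * (h * enorm v)); lra.
  have e2 : 2 * c <= 2 * d + h * q.
    rewrite -(ler_pM2l h0); move: e1; rewrite sq /c; lra.
  nra.
(* The steepest descent direction v = - M^T a gives the contradiction. *)
have := dotM (- (M^T *m a)); rewrite mulmxN dotNr dot_mulmxr -enorm_sqr enormN expr2.
have := kapS a aS; set X := enorm (M^T *m a) => h1 h2; exfalso.
have X0 : 0 < X by apply: lt_le_trans h1; rewrite mulr_gt0.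
have : X <= 2 * (kap / 3) * enorm a by rewrite -(ler_pM2r X0); lra.
nra.
Qed.

End Openness.

(** * Exact penalty bound from second-order feasible curves *)

Section SecondOrder.
Context {R : realType} {N k : nat}.

Definition strictly_differentiable (G : 'cV[R]_N -> 'cV[R]_k) (u : 'cV[R]_N)
    (M : 'M[R]_(k, N)) : Prop :=
  forall e : R, 0 < e -> exists2 d : R, 0 < d & forall x x',
    enorm (x - u) <= d -> enorm (x' - u) <= d ->
    enorm (G x - G x' - M *m (x - x')) <= e * enorm (x - x').

(* phi (u + t h) = phi u + t L h + t^2 / 2 q h + o(t^2), along all sequences
   of pairs (t, h) with t -> 0+ and h convergent. *)
Definition expands2 (W : normedModType R) (phi : 'cV[R]_N -> W) (u : 'cV[R]_N)
    (L q : 'cV[R]_N -> W) : Prop :=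
  forall (t_ : nat -> R) (h_ : nat -> 'cV[R]_N) h,
    (forall i, 0 < t_ i) -> t_ @ \oo --> (0 : R) -> h_ @ \oo --> h ->
    (t_ i ^+ 2)^-1 *: (phi (u + t_ i *: h_ i) - phi u - t_ i *: L (h_ i))
      @[i --> \oo] --> 2^-1 *: q h.

(** Since [S] is a cone, it contains (1 + h) s and (1 - h) s, so both [s] and - s are tangent to [S]
    at [s]. *)
Lemma normals_orth (S : seq (seq ('cV[R]_k * R))) s y :
  conic S -> inU S s -> polar (Tloc S s) y -> dot y s = 0.
Proof.
move=> cS sS yS; have [r r0 Sr] := inU_local S s.
have s1 : 0 < enorm s + 1 by rewrite ltr_wpDl // enorm_ge0.
pose h := Num.min (1 / 2) (r / (enorm s + 1)).
have h0 : 0 < h by rewrite lt_min !divr_gt0.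
have h1 : h < 1 by rewrite gt_min; apply/orP; left; lra.
have hs : enorm (h *: s) < r.
  rewrite enormZ gtr0_norm //.
  have : h <= r / (enorm s + 1) by rewrite ge_min lexx orbT.
  rewrite ler_pdivlMr //; nra.
have ps : inU (Tloc S s) s.
  rewrite -(conic_inUZ _ (conic_Tloc _ _) h0) -Sr //.
  by rewrite -[X in X + _]scale1r -scalerDl conic_inUZ // addr_gt0.
have ns : inU (Tloc S s) (- s).
  rewrite -(conic_inUZ _ (conic_Tloc _ _) h0) -Sr ?scalerN ?enormN //.
  by rewrite -[X in X - _]scale1r -scalerBl conic_inUZ // subr_gt0.
have := yS _ ps; have := yS _ ns; rewrite dotNr; lra.
Qed.

Section Necessary.
Variables (D : seq (seq ('cV[R]_k * R))) (f : 'cV[R]_N -> R).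
Variables (G : 'cV[R]_N -> 'cV[R]_k) (u h : 'cV[R]_N) (M : 'M[R]_(k, N)).
Variables (c : 'cV[R]_N) (qf : 'cV[R]_N -> R) (q : 'cV[R]_N -> 'cV[R]_k).
Hypotheses (Gc : continuous G) (Gs : strictly_differentiable G u M).
Hypotheses (G2 : expands2 G u (mulmx M) q) (f2 : expands2 f u (dot c) qf).
Hypotheses (ch : dot c h <= 0).
Hypothesis minu : \forall x \near u, inU D (G x) -> f u <= f x.

Let S := Tloc (Tloc D (G u)) (M *m h).

(** The curve u + t h + (t^2 / 2) v misses feasibility by about (t^2 / 2) |M v + q h - s|.
    [openness] repairs it at 3 / kap times that cost, [f] along the repaired curve is at least
    [f u], and division by t^2 / 2 gives the bound in the limit. *)
Lemma feasible_lower_bound (kap : R) v s :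
  0 < kap -> (forall y, normals S y -> kap * enorm y <= enorm (M^T *m y)) ->
  inU S s ->
  0 <= dot c v + qf h + 3 / kap * enorm c * enorm (M *m v + q h - s).
Proof.
move=> kap0 kapS sS; pose w := M *m h.
have k3 : 0 < 3 / kap by rewrite divr_gt0.
have [d d0 Gd] := Gs (divr_gt0 kap0 (ltr0n R 3)).
have [d' d'0 Md] := near_enorm minu.
have [r1 r10 Dr] := inU_local D (G u).
have [r2 r20 Tr] := inU_local (Tloc D (G u)) w.
have [C C0 MC] := mulmx_bound M.
pose t_ := @harmonic R.
have t0 i : 0 < t_ i by exact: harmonic_gt0.
have t_0 : t_ @ \oo --> (0 : R) by exact: cvg_harmonic.
have tn0 i : t_ i != 0 by rewrite gt_eqF.
have kC : 0 < kap / 3 + C + 1 by rewrite ltr_wpDl // addr_ge0 // ltW // divr_gt0.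
(* With |H i 0| < r2 / 2, this radius keeps [H i z] shorter than [r2], inside the region where [T]
   is a translate of [S]. *)
pose rho := r2 / (2 * (kap / 3 + C + 1)).
have rho0 : 0 < rho by rewrite divr_gt0 // mulr_gt0.
have rhoE : 2 * ((kap / 3 + C + 1) * rho) = r2.
  by rewrite /rho mulrA mulrC divfK // gt_eqF // mulr_gt0.
(* Difference quotient of [G] minus its limit [w]. It inherits the strict derivative [M], uniformly
   in [i], and its values should land in [S]. *)
pose H i z := (t_ i)^-1 *: (G (u + t_ i *: (h + z)) - G u) - w.
have Hexp i z : H i z = t_ i *: ((t_ i ^+ 2)^-1 *:
    (G (u + t_ i *: (h + z)) - G u - t_ i *: (M *m (h + z)))) + M *m z.
  rewrite scalerA expr2 invfM mulrA divff // mul1r scalerBr scalerA mulVf //.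
  by rewrite scale1r mulmxDr opprD addrA subrK.
have Hcvg z_ : (z_ @ \oo --> (0 : 'cV[R]_N)) ->
    (t_ i ^+ 2)^-1 *: (G (u + t_ i *: (h + z_ i)) - G u
       - t_ i *: (M *m (h + z_ i))) @[i --> \oo] --> 2^-1 *: q h.
  move=> z0; apply: G2 => //; rewrite -[X in _ --> X]addr0.
  by apply: cvgD => //; exact: cvg_cst.
have H00 : enorm (H i 0) @[i --> \oo] --> (0 : R).
  rewrite -(enorm0 k) -(scale0r (2^-1 *: q h)); apply: cvg_enorm.
  under eq_cvg do rewrite Hexp mulmx0 addr0.
  by apply: cvgZ => //; apply: (Hcvg (fun=> 0)); exact: cvg_cst.
(* With this starting point, u + t (h + z0) = u + t h + (t^2 / 2) v. *)
pose z0 i := (t_ i / 2) *: v.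
have z00 : z0 @ \oo --> (0 : 'cV[R]_N).
  rewrite -(scale0r v); apply: cvgZr_tmp; rewrite -(mul0r 2^-1).
  by apply: cvgMr_tmp.
pose e_ i := enorm ((t_ i ^+ 2)^-1 *: (G (u + t_ i *: (h + z0 i)) - G u
       - t_ i *: (M *m (h + z0 i))) + 2^-1 *: (M *m v - s)).
have e_cvg : e_ @ \oo --> 2^-1 * enorm (M *m v + q h - s).
  have -> : 2^-1 * enorm (M *m v + q h - s) =
      enorm (2^-1 *: q h + 2^-1 *: (M *m v - s)).
    by rewrite -scalerDr addrCA addrA enormZ ger0_norm.
  by apply: cvg_enorm; apply: cvgD; [exact: Hcvg|exact: cvg_cst].
have HrE i : enorm (H i (z0 i) - (t_ i / 2) *: s) = t_ i * e_ i.
  rewrite Hexp /e_ -(gtr0_norm (t0 i)) -enormZ gtr0_norm //; congr enorm.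
  by rewrite [in RHS]scalerDr -addrA; congr (_ + _); rewrite scalerA -scalemxAr -scalerBr.
have te0 : t_ i * e_ i @[i --> \oo] --> (0 : R).
  by rewrite -(mul0r (2^-1 * enorm (M *m v + q h - s))); exact: cvgM.
have bnd0 : enorm (z0 i) + 3 / kap * (t_ i * e_ i) @[i --> \oo] --> (0 : R).
  rewrite -[X in _ --> X]addr0; apply: cvgD.
    by rewrite -(enorm0 N); apply: cvg_enorm.
  by rewrite -(mulr0 (3 / kap)); apply: cvgMl_tmp.
have tb0 (b : R) : t_ i * b @[i --> \oo] --> (0 : R).
  by rewrite -(mul0r b); apply: cvgMr_tmp.
have [z_ Hz] : exists z_ : nat -> 'cV[R]_N, \forall i \near \oo,
    [/\ enorm (z_ i - z0 i) <= 3 / kap * (t_ i * e_ i),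
        f u <= f (u + t_ i *: (h + z_ i)) & True].
  suff [n _ nH] : \forall i \near \oo, exists z,
      [/\ enorm (z - z0 i) <= 3 / kap * (t_ i * e_ i),
          f u <= f (u + t_ i *: (h + z)) & True].
    have /choice[z_ z_P] : forall i, exists z, (n <= i)%N ->
        [/\ enorm (z - z0 i) <= 3 / kap * (t_ i * e_ i),
          f u <= f (u + t_ i *: (h + z)) & True].
      move=> i; have [ni|ni] := leqP n i; last by exists 0.
      by have [z Hz] := nH i ni; exists z.
    by exists z_; exists n => // i; exact: z_P.
  near=> i.
  have l1 : t_ i * (enorm h + rho) < d by near: i; exact: (cvgr_lt _ (tb0 _)).
  have l2 : t_ i * (enorm h + rho) < d' by near: i; exact: (cvgr_lt _ (tb0 _)).
  have l3 : t_ i * (enorm w + r2) < r1 by near: i; exact: (cvgr_lt _ (tb0 _)).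
  have l4 : enorm (H i 0) < r2 / 2.
    by near: i; apply: (cvgr_lt _ H00); rewrite divr_gt0.
  have l5 : enorm (z0 i) + 3 / kap * (t_ i * e_ i) < rho.
    by near: i; exact: (cvgr_lt _ bnd0).
  have hz z (b : R) : enorm z <= rho -> t_ i * (enorm h + rho) < b ->
      enorm (u + t_ i *: (h + z) - u) < b.
    move=> zr; apply: le_lt_trans; rewrite addrAC subrr add0r enormZ gtr0_norm //.
    by rewrite ler_pM2l // (le_trans (enormD _ _)) // lerD2l.
  have lipH z z' : enorm z <= rho -> enorm z' <= rho ->
     enorm (H i z - H i z' - M *m (z - z')) <= kap / 3 * enorm (z - z').
    move=> zr zr'.
    have := Gd _ _ (ltW (hz z d zr l1)) (ltW (hz z' d zr' l1)).
    have -> : u + t_ i *: (h + z) - (u + t_ i *: (h + z')) = t_ i *: (z - z').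
      by apply/matrixP => a b; rewrite !mxE; ring.
    rewrite enormZ gtr0_norm // => Gz; rewrite -(ler_pM2l (t0 i)).
    rewrite mulrCA (le_trans _ Gz) // -[X in X * _](gtr0_norm (t0 i)) -enormZ.
    rewrite le_eqVlt; apply/orP; left; apply/eqP; congr enorm.
    rewrite /H -scalemxAr !scalerBr !scalerA divff // !scale1r.
    by apply/matrixP => a b; rewrite !mxE; ring.
  have cH : continuous (H i).
    move=> z; apply: (@cvgB _ _ _ (nbhs z)); last exact: cvg_cst.
    apply: (@cvgZl_tmp _ _ _ (nbhs z)); apply: (@cvgB _ _ _ (nbhs z)); last exact: cvg_cst.
    apply: (@cvg_comp _ _ _ (fun z => u + t_ i *: (h + z)) G _
      (nbhs (u + t_ i *: (h + z)))); last exact: Gc.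
    apply: (@cvgD _ _ _ (nbhs z)); first exact: cvg_cst.
    apply: (@cvgZl_tmp _ _ _ (nbhs z)); apply: (@cvgD _ _ _ (nbhs z)); first exact: cvg_cst.
    exact: cvg_id.
  have sS' : inU S ((t_ i / 2) *: s) by rewrite conic_inUZ ?conic_Tloc // divr_gt0.
  have [|z [zz0 zr zS]] := openness kap0 kapS cH lipH sS' (z0 := z0 i).
    by rewrite HrE.
  exists z; split => //; first by rewrite -HrE.
  apply: Md; first exact: hz (ltW zr) l2.
  have Hlt : enorm (H i z) < r2.
    have := lipH z 0 (ltW zr); rewrite enorm0 => /(_ (ltW rho0)); rewrite subr0 => Hl.
    have := enormD (H i z - H i 0 - M *m z) (H i 0 + M *m z).
    have -> : H i z - H i 0 - M *m z + (H i 0 + M *m z) = H i z.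
      by move: (H i z) (H i 0) => a b; rewrite addrACA addNr addr0 subrK.
    move=> H1.
    have := enormD (H i 0) (M *m z); have := MC z.
    have : (kap / 3 + C + 1) * enorm z <= (kap / 3 + C + 1) * rho.
      by rewrite ler_pM2l // ltW.
    have := enorm_ge0 z; lra.
  (* From [H i z] in [S] back to [D]: w + H i z lies in [T], hence so does its multiple by [t_ i],
     which is short enough to be added to [G u]. *)
  have GE : G (u + t_ i *: (h + z)) = G u + t_ i *: (w + H i z).
    by rewrite /H (addrC w) subrK scalerA divff // scale1r (addrC (G u)) subrK.
  rewrite GE Dr.
    by rewrite conic_inUZ ?conic_Tloc // Tr.
  apply: le_lt_trans l3; rewrite enormZ gtr0_norm // ler_pM2l //.
  by rewrite (le_trans (enormD _ _)) // lerD2l ltW.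
have z_0 : z_ @ \oo --> (0 : 'cV[R]_N).
  apply: cvg_enorm0.
  apply: (@squeeze_cvgr _ _ _ _ (fun=> 0)
    (fun i => enorm (z0 i) + 3 / kap * (t_ i * e_ i))) => //.
    near=> i; rewrite subr0 enorm_ge0 /=.
    have [zz0 _ _] : [/\ enorm (z_ i - z0 i) <= 3 / kap * (t_ i * e_ i),
        f u <= f (u + t_ i *: (h + z_ i)) & True] by near: i.
    by have := enormD (z_ i - z0 i) (z0 i); rewrite subrK; lra.
  exact: cvg_cst.
have fX : (t_ i ^+ 2)^-1 *: (f (u + t_ i *: (h + z_ i)) - f u
    - t_ i *: dot c (h + z_ i)) @[i --> \oo] --> 2^-1 *: qf h.
  apply: f2 => //; rewrite -[X in _ --> X]addr0.
  by apply: cvgD => //; exact: cvg_cst.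
have lim2 : - (2^-1 * dot c v + 3 / kap * enorm c * e_ i) @[i --> \oo] -->
    - (2^-1 * dot c v + 3 / kap * enorm c * (2^-1 * enorm (M *m v + q h - s))).
  by apply: cvgN; apply: cvgD; [exact: cvg_cst|exact: cvgMl_tmp].
have : - (2^-1 * dot c v + 3 / kap * enorm c * (2^-1 * enorm (M *m v + q h - s)))
    <= 2^-1 *: qf h.
  apply: (ler_cvg_to lim2 fX); near=> i.
  have [zz0 fui _] : [/\ enorm (z_ i - z0 i) <= 3 / kap * (t_ i * e_ i),
        f u <= f (u + t_ i *: (h + z_ i)) & True] by near: i.
  rewrite -[leRHS]/(_ * (_ - _ * _)).
  rewrite [leRHS]mulrC ler_pdivlMr ?exprn_gt0 // dotDr.
  have t0i := t0 i.
  have cz : dot c (z_ i) <= t_ i / 2 * dot c v + enorm c * (3 / kap * (t_ i * e_ i)).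
    rewrite -[z_ i](subrK (z0 i)) dotDr dotZr addrC lerD2l.
    by rewrite (le_trans (dot_le _ _)) // ler_wpM2l ?enorm_ge0.
  (* Criticality of [h]: this term would blow up after division by t^2, but its sign lets it be
     dropped. *)
  have tch : t_ i * dot c h <= 0 by rewrite mulr_ge0_le0 // ltW.
  have := ler_wpM2l (ltW t0i) cz; lra.
rewrite -[leRHS]/(_ * _); lra.
Unshelve. all: by end_near. Qed.

End Necessary.
End SecondOrder.

(** * Multipliers from quadratic penalization *)

Section Multipliers.
Context {R : realType} {N k : nat}.

Lemma linear_le_quadratic (b Q : R) :
  0 <= Q -> (forall h, 0 < h -> h * b <= h ^+ 2 * Q) -> b <= 0.
Proof.
move=> Q0 hb; rewrite leNgt; apply/negP => b0.
have Q1 : 0 < 2 * (Q + 1) by rewrite mulr_gt0 // ltr_wpDl.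
have h0 : 0 < b / (2 * (Q + 1)) by rewrite divr_gt0.
have := hb _ h0; rewrite expr2 -mulrA ler_pM2l // mulrAC ler_pdivlMr //; nra.
Qed.

Lemma coercive_min (A : set ('cV[R]_N * 'cV[R]_k)) (Psi : 'cV[R]_N * 'cV[R]_k -> R)
    (B : R) p0 :
  closed A -> A p0 -> continuous Psi ->
  (forall p, A p -> Psi p <= Psi p0 -> enorm p.1 <= B /\ enorm p.2 <= B) ->
  exists2 p, A p & forall p', A p' -> Psi p <= Psi p'.
Proof.
move=> clA Ap0 cPsi PB.
have cB n : compact [set u : 'cV[R]_n | enorm (u - 0) <= B].
  apply: (@cV_compact _ _ _ B); first exact: closed_enorm_ball.
  by move=> u /=; rewrite subr0.
pose K := ([set u : 'cV[R]_N | enorm (u - 0) <= B] `*`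
  [set u : 'cV[R]_k | enorm (u - 0) <= B]) `&` A.
have cK : compact K by apply: compact_closedI => //; exact: compact_setX.
have inK p : A p -> Psi p <= Psi p0 -> K p.
  by move=> Ap /(PB _ Ap)[B1 B2]; do !split => //=; rewrite subr0.
have [|p /set_mem[_ Ap] pmin] := compact_EVT_min _ cK (continuous_subspaceT cPsi).
  by exists p0; exact: inK.
exists p => // p' Ap'; have [le|lt] := leP (Psi p') (Psi p0).
  by apply: pmin; apply/mem_set; exact: inK.
by apply: le_trans (ltW lt); apply: pmin; apply/mem_set; exact: inK.
Qed.

(** For each K the minimizer of <c, v> + |v|^2 / (2 K) + (K / 2) |M v + m0 - s|^2 over [s] in [S]
    yields the normal y = K (M v + m0 - s), an approximate multiplier. These multipliers are bounded
    through [kap], and their limit is exact because [normals S] is closed. *)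
Lemma lagrange_multiplier (S : seq (seq ('cV[R]_k * R))) (M : 'M[R]_(k, N))
    (c : 'cV[R]_N) (m0 : 'cV[R]_k) (alpha Gam kap : R) :
  conic S -> inU S 0 -> 0 < kap ->
  (forall y, normals S y -> kap * enorm y <= enorm (M^T *m y)) ->
  0 <= Gam ->
  (forall v s, inU S s -> 0 <= dot c v + alpha + Gam * enorm (M *m v + m0 - s)) ->
  exists y, [/\ normals S y, c + M^T *m y = 0 & 0 <= alpha + dot y m0].
Proof.
move=> cS S0 kap0 kapS Gam0 lb.
(* Openness for an affine map, whose linearization error is 0, started at 0 with target 0 in [S]. *)
have [u0 u0S] : exists u0, inU S (M *m u0 + m0).
  have [||||z [_ _ zS]] := @openness _ _ _ S M (fun z => M *m z + m0) kap
      (3 / kap * enorm m0 + 1) 0 0 kap0 kapS.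
  - move=> z; apply: (@cvgD _ _ _ (nbhs z)); last exact: cvg_cst.
    exact: mulmx_continuous.
  - move=> z z' _ _.
    rewrite (_ : _ - _ = 0) ?enorm0 ?mulr_ge0 ?enorm_ge0 ?divr_ge0 ?(ltW kap0) //.
    by rewrite mulmxBr opprD addrACA subrr addr0 subrr.
  - exact: S0.
  - by rewrite mulmx0 add0r subr0 enorm0 add0r ltrDl.
  by exists z.
have [C C0 MC] := mulmx_bound M.
(* Bounds the penalized values: Gam r is absorbed by r^2 / 4 + Gam^2, where r is the constraint
   residual. *)
pose V := dot c u0 + enorm u0 ^+ 2 / 2 + alpha + Gam ^+ 2.
have V0 : 0 <= V.
  have := lb u0 _ u0S; rewrite subrr enorm0 mulr0 addr0.
  have := sqr_ge0 (enorm u0); have := sqr_ge0 Gam; rewrite /V; lra.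
have penalty (K : R) : 1 <= K -> exists (v : 'cV[R]_N) (y : 'cV[R]_k),
    [/\ normals S y, c + K^-1 *: v + M^T *m y = 0,
        (enorm v / K) ^+ 2 <= 2 * V / K &
        0 <= alpha + dot y m0 + Gam * (enorm y / K)].
  move=> K1; have K0 : 0 < K by apply: lt_le_trans K1.
  have KV0 : 0 < K^-1 by rewrite invr_gt0.
  have KV1 : K^-1 <= 1 by rewrite invf_le1.
  have KK : K * K^-1 = 1 by rewrite divff // gt_eqF.
  (* The term |v|^2 / (2 K) makes the objective coercive and disappears as K grows. *)
  pose Th (p : 'cV[R]_N * 'cV[R]_k) := dot c p.1 + enorm p.1 ^+ 2 * (K^-1 / 2) +
    K / 2 * enorm (M *m p.1 + m0 - p.2) ^+ 2.
  have Thlb p : inU S p.2 -> Th p <= Th (u0, M *m u0 + m0) ->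
      enorm p.1 ^+ 2 * (K^-1 / 2) + enorm (M *m p.1 + m0 - p.2) ^+ 2 / 4 <= V.
    move=> /(lb p.1); rewrite /Th /= subrr enorm0 expr0n mulr0 addr0 /V.
    set r := enorm (_ - _) => h1 h2.
    have r0 : 0 <= r by exact: enorm_ge0.
    have h3 : r ^+ 2 / 2 <= K / 2 * r ^+ 2.
      rewrite mulrC ler_wpM2r ?sqr_ge0 //; lra.
    have h4 := sqr_ge0 (r / 2 - Gam).
    have h5 : enorm u0 ^+ 2 * (K^-1 / 2) <= enorm u0 ^+ 2 / 2.
      rewrite ler_wpM2l ?sqr_ge0 //; lra.
    have h6 : (r / 2 - Gam) ^+ 2 = r ^+ 2 / 4 - Gam * r + Gam ^+ 2 by field.
    lra.
  have sq_le (x y : R) : 0 <= y -> x ^+ 2 <= y -> x <= y + 1 by nra.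
  have [[v s] sS pmin] : exists2 p, inU S p.2 & forall p', inU S p'.2 -> Th p <= Th p'.
    pose B1 := 2 * K * V + 1.
    pose B2 := C * B1 + enorm m0 + (4 * V + 1).
    have B10 : 0 <= B1 by rewrite addr_ge0 // !mulr_ge0 // ltW.
    apply: (@coercive_min [set p | inU S p.2] Th (Num.max B1 B2) (u0, M *m u0 + m0)) => //.
    - apply: (preimage_closed _ (@inU_closed _ _ S)) => p _; exact: cvg_snd.
    - move=> p; have c1 : p'.1 @[p' --> p] --> p.1 by exact: cvg_fst.
      have c2 : p'.2 @[p' --> p] --> p.2 by exact: cvg_snd.
      apply: (@cvgD _ _ _ (nbhs p)); [apply: (@cvgD _ _ _ (nbhs p))|].
      + by apply: (@cvg_dot _ _ (nbhs p)); [exact: cvg_cst|exact: c1].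
      + apply: (@cvgMr_tmp _ _ (nbhs p)); rewrite expr2; under eq_cvg do rewrite expr2.
        by apply: (@cvgM _ _ (nbhs p)); apply: (@cvg_enorm _ _ (nbhs p)).
      + apply: (@cvgMl_tmp _ _ (nbhs p)); rewrite expr2; under eq_cvg do rewrite expr2.
        have c3 : enorm (M *m p'.1 + m0 - p'.2) @[p' --> p] --> enorm (M *m p.1 + m0 - p.2).
          apply: (@cvg_enorm _ _ (nbhs p)); apply: (@cvgB _ _ _ (nbhs p)); last exact: c2.
          apply: (@cvgD _ _ _ (nbhs p)); last exact: cvg_cst.
          by apply: (@cvg_mulmx _ _ (nbhs p)); [exact: cvg_cst|exact: c1].
        by apply: (@cvgM _ _ (nbhs p)).
    move=> p pS /(Thlb _ pS); set r := enorm (_ - _) => h.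
    have r0 : 0 <= r by exact: enorm_ge0.
    have n1 := sqr_ge0 (enorm p.1); have n2 := sqr_ge0 r.
    have p1 : enorm p.1 <= B1.
      apply: sq_le; first by rewrite !mulr_ge0 // ltW.
      have : enorm p.1 ^+ 2 * (K^-1 / 2) <= V by lra.
      rewrite mulrA ler_pdivrMr // -ler_pdivlMr // invrK; lra.
    have r4 : r <= 4 * V + 1 by apply: sq_le; [lra|nra].
    have p2 : enorm p.2 <= B2.
      have := enorm_triB (M *m p.1 + m0) (M *m p.1 + m0 - p.2); rewrite subKr -/r.
      have := enormD (M *m p.1) m0; have := MC p.1.
      have : C * enorm p.1 <= C * B1 by rewrite ler_wpM2l.
      rewrite /B2; lra.
    by rewrite !le_max p1 p2 orbT.
  rewrite /= in sS.
  have /(Thlb (v, s) sS) : Th (v, s) <= Th (u0, M *m u0 + m0) by exact: pmin.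
  rewrite [X in enorm X ^+ 2 * _]/= [X in _ + enorm X ^+ 2 / _]/=.
  set a := M *m v + m0 - s => hV.
  have K2 : 0 < K / 2 by rewrite divr_gt0.
  have aS : polar (Tloc S s) a.
    apply: (@nearest_normals _ _ S _ _ 1) => // s' s'S _.
    have := pmin (v, s') s'S; rewrite /Th /= lerD2l ler_pM2l //.
    by rewrite ler_pXn2r ?nnegrE ?enorm_ge0.
  have yS : polar (Tloc S s) (K *: a) by apply: polarZ => //; exact: ltW.
  have ys : dot (K *: a) s = 0 by exact: (normals_orth cS sS yS).
  exists v, (K *: a).
  have st : c + K^-1 *: v + M^T *m (K *: a) = 0.
    (* [g] is the gradient of [Th] in [v]; a step - h g shows that its square is <= 0. *)
    set g := LHS; apply: dot_eq0; apply: le_anti; rewrite dot_ge0 andbT.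
    apply: (@linear_le_quadratic _ (enorm g ^+ 2 * (K^-1 / 2) + K / 2 * enorm (M *m g) ^+ 2)).
      by rewrite addr_ge0 // mulr_ge0 ?sqr_ge0 ?divr_ge0 // ltW.
    move=> h h0; have := pmin (v - h *: g, s) sS; rewrite /Th /=.
    have -> : M *m (v - h *: g) + m0 - s = a - h *: (M *m g).
      by rewrite /a mulmxBr -scalemxAr; apply/matrixP => i j; rewrite !mxE; ring.
    have gg : dot g g = dot c g + K^-1 * dot v g + K * dot a (M *m g).
      by rewrite {1}/g; clearbody a; rewrite !dotDl dotZl -dot_mulmxr dotZl.
    rewrite -/a; move: gg; clearbody a g.
    rewrite !enorm_sqr !(dotBl, dotBr, dotZl, dotZr) (dotC g v) (dotC (M *m g) a).
    set d1 := dot g g; set d2 := dot v g; set d3 := dot a _; set d4 := dot (M *m g) _.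
    move: (dot v v) (dot a a) (dot c v) (dot c g) => d5 d6 d7 d8 -> hmin.
    lra.
  split => //.
  - by exists s.
  - have -> : (enorm v / K) ^+ 2 = enorm v ^+ 2 * (K^-1 / 2) * (2 * K^-1).
      by move: (enorm v) (K^-1) => x y; field.
    have -> : 2 * V / K = V * (2 * K^-1) by rewrite (mulrC 2) mulrA.
    rewrite ler_wpM2r //; first by rewrite mulr_ge0 // ltW.
    have := sqr_ge0 (enorm a); lra.
  - have := lb v s sS; rewrite -/a enormZ gtr0_norm // mulrAC divff ?gt_eqF // mul1r.
    (* Write m0 = a + s - M v: the [s] term vanishes by [normals_orth], and the [M v] term is
       rewritten by stationarity. *)
    have -> : dot (K *: a) m0 = K * enorm a ^+ 2 + dot c v + K^-1 * enorm v ^+ 2.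
      have -> : m0 = a + s - M *m v by rewrite /a subrK addrC addKr.
      rewrite dotBr dotDr ys addr0 dotZl -enorm_sqr -addrA; congr (_ + _).
      rewrite dot_mulmxr; have -> : M^T *m (K *: a) = - (c + K^-1 *: v).
        by apply/eqP; rewrite -addr_eq0 addrC st.
      by rewrite dotNl opprK dotDl dotZl -enorm_sqr.
    have : 0 <= K * enorm a ^+ 2 by rewrite mulr_ge0 ?sqr_ge0 // ltW.
    have : 0 <= K^-1 * enorm v ^+ 2 by rewrite mulr_ge0 ?sqr_ge0 // ltW.
    lra.
(* From kap |y| <= |M^T y| <= |c| + 1. *)
pose B := (enorm c + 1) / kap.
have approx e : 0 < e -> e <= 1 -> exists y, [/\ normals S y, enorm y <= B,
    enorm (c + M^T *m y) <= e & - e <= alpha + dot y m0].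
  (* Large enough for both 2 V / K <= e^2 and Gam B / K <= e. *)
  move=> e0 e1; pose K := 1 + 2 * V / e ^+ 2 + Gam * B / e.
  have c0 := enorm_ge0 c.
  have B0 : 0 <= B by rewrite divr_ge0 ?(ltW kap0) // addr_ge0.
  have K1 : 1 <= K.
    rewrite /K -addrA lerDl; apply: addr_ge0; apply: divr_ge0; rewrite ?sqr_ge0 //.
    - by rewrite mulr_ge0.
    - by rewrite (mulr_ge0 Gam0 B0).
    - exact: ltW.
  have K0 : 0 < K by apply: lt_le_trans K1.
  have [v [y [yS st vK yK]]] := penalty K K1.
  have ve : enorm v / K <= e.
    rewrite -(@ler_pXn2r _ 2) ?nnegrE ?divr_ge0 ?enorm_ge0 ?(ltW K0) ?(ltW e0) //.
    apply: le_trans vK _; rewrite ler_pdivrMr // -ler_pdivrMl ?exprn_gt0 // mulrC.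
    have : 0 <= Gam * B / e by apply: divr_ge0 (mulr_ge0 Gam0 B0) (ltW e0).
    rewrite /K; lra.
  have cy : c + M^T *m y = - (K^-1 *: v).
    by apply/eqP; rewrite -addr_eq0 addrAC st.
  have ny : enorm (c + M^T *m y) <= e.
    by rewrite cy enormN enormZ gtr0_norm ?invr_gt0 // mulrC.
  have yB : enorm y <= B.
    rewrite ler_pdivlMr // mulrC (le_trans (kapS _ yS)) //.
    have := enorm_triB (c + M^T *m y) c; rewrite addrAC subrr add0r; lra.
  exists y; split => //.
  have : Gam * (enorm y / K) <= e; last by lra.
  rewrite mulrA ler_pdivrMr // (@le_trans _ _ (Gam * B)) ?ler_wpM2l //.
  rewrite -ler_pdivrMl // mulrC.
  have : 0 <= 2 * V / e ^+ 2.
    by apply: divr_ge0; rewrite ?sqr_ge0 // mulr_ge0.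
  rewrite /K; lra.
(* Instead of extracting a subsequence, the total defect [phi] is minimized over the compact set
   [Y]; approximate multipliers show that its minimum is 0. *)
pose Y := [set y | enorm (y - 0) <= B] `&` [set y | normals S y].
pose phi (y : 'cV[R]_k) := enorm (c + M^T *m y) + Num.max 0 (- (alpha + dot y m0)).
have cY : compact Y.
  apply: (@cV_compact _ _ _ B) => [|y [/=]]; last by rewrite subr0.
  by apply: closedI; [exact: closed_enorm_ball|exact: normals_closed].
have cphi : continuous phi.
  move=> y; apply: (@cvgD _ _ _ (nbhs y)).
    apply: (@cvg_enorm _ _ (nbhs y)); apply: (@cvgD _ _ _ (nbhs y)); first exact: cvg_cst.
    exact: mulmx_continuous.
  apply: (@continuous_max _ _ (cst 0) (fun y : 'cV[R]_k => - (alpha + dot y m0)) y).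
    exact: cst_continuous.
  apply: (@cvgN _ _ _ (nbhs y)); apply: (@cvgD _ _ _ (nbhs y)); first exact: cvg_cst.
  by apply: (@cvg_dot _ _ (nbhs y)); [exact: cvg_id|exact: cvg_cst].
have [|y /set_mem[/= yB yS] ymin] := compact_EVT_min _ cY (continuous_subspaceT cphi).
  have [y [yS yB _ _]] := approx 1 ltr01 (lexx 1).
  by exists y; split => //=; rewrite subr0.
have phi0 : phi y <= 0.
  apply/ler_addgt0Pl => e e0; rewrite addr0.
  pose d := Num.min (e / 2) 1.
  have d0 : 0 < d by rewrite lt_min divr_gt0 // ltr01.
  have d1 : d <= 1 by rewrite ge_min lexx orbT.
  have de : d <= e / 2 by rewrite ge_min lexx.
  have [y' [y'S y'B h1 h2]] := approx d d0 d1.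
  have : y' \in Y by apply/mem_set; split => //=; rewrite subr0.
  move=> /ymin /le_trans; apply; rewrite /phi.
  have : Num.max 0 (- (alpha + dot y' m0)) <= d by rewrite ge_max ltW //=; lra.
  lra.
have n0 := enorm_ge0 (c + M^T *m y).
have m00 : 0 <= Num.max 0 (- (alpha + dot y m0)) by rewrite le_max lexx.
exists y; split => //.
  by apply: enorm_eq0; apply: le_anti; rewrite n0 andbT; rewrite /phi in phi0; lra.
have : - (alpha + dot y m0) <= Num.max 0 (- (alpha + dot y m0)) by rewrite le_max lexx orbT.
rewrite /phi in phi0; lra.
Qed.

Theorem second_order_necessary (D : seq (seq ('cV[R]_k * R)))
    (f : 'cV[R]_N -> R) (G : 'cV[R]_N -> 'cV[R]_k) (u h : 'cV[R]_N)
    (M : 'M[R]_(k, N)) (c : 'cV[R]_N) qf q :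
  continuous G -> strictly_differentiable G u M ->
  expands2 G u (mulmx M) q -> expands2 f u (dot c) qf ->
  inU (Tloc D (G u)) (M *m h) -> dot c h <= 0 ->
  (\forall x \near u, inU D (G x) -> f u <= f x) ->
  let S := Tloc (Tloc D (G u)) (M *m h) in
  (forall y, normals S y -> M^T *m y = 0 -> y = 0) ->
  exists y, [/\ normals S y, c + M^T *m y = 0 & 0 <= qf h + dot y (q h)].
Proof.
move=> Gc Gs G2 f2 hT ch minu S CQ.
have [kap kap0 kapS] := normals_quantified CQ.
apply: (@lagrange_multiplier _ _ _ _ _ (3 / kap * enorm c) kap) => //.
- exact: conic_Tloc.
- exact: inU_Tloc0.
- by rewrite mulr_ge0 ?enorm_ge0 // divr_ge0 // ltW.
move=> v s sS; exact: (feasible_lower_bound Gc Gs G2 f2 ch minu v kap0 kapS sS).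
Qed.

End Multipliers.

(** * Second-order limit along almost feasible sequences *)

Section Sufficient.
Context {R : realType} {N k : nat}.

(** The quotients (z_i - G u) / t_i tend to M h and eventually lie in the tangent cone, which makes
    [h] critical. A multiplier cancels the first-order terms and, being normal at M h, satisfies <y,
    z_i - G u> <= 0; after division by t^2 only the second-order terms survive. *)
Theorem second_order_limit (D : seq (seq ('cV[R]_k * R)))
    (f : 'cV[R]_N -> R) (G : 'cV[R]_N -> 'cV[R]_k) (u h : 'cV[R]_N)
    (M : 'M[R]_(k, N)) (c : 'cV[R]_N) qf q
    (t_ r_ : nat -> R) (h_ : nat -> 'cV[R]_N) (z_ : nat -> 'cV[R]_k) :
  expands2 G u (mulmx M) q -> expands2 f u (dot c) qf ->
  (forall i, 0 < t_ i) -> t_ @ \oo --> (0 : R) -> h_ @ \oo --> h ->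
  (forall i, inU D (z_ i)) ->
  (t_ i ^+ 2)^-1 *: (G (u + t_ i *: h_ i) - z_ i) @[i --> \oo] --> (0 : 'cV[R]_k) ->
  (forall i, f (u + t_ i *: h_ i) - f u <= t_ i ^+ 2 * r_ i) ->
  r_ @ \oo --> (0 : R) ->
  [/\ inU (Tloc D (G u)) (M *m h), dot c h <= 0 &
    forall alpha y, 0 <= alpha -> alpha *: c + M^T *m y = 0 ->
      polar (Tloc (Tloc D (G u)) (M *m h)) y ->
      alpha * qf h + dot y (q h) <= 0].
Proof.
move=> G2 f2 t0 t_0 hh zD Gz fr r0.
have GX := G2 _ _ _ t0 t_0 hh; have fX := f2 _ _ _ t0 t_0 hh.
have tn0 i : t_ i != 0 by rewrite gt_eqF.
have [r1 r10 Dr] := inU_local D (G u).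
have [r2 r20 Tr] := inU_local (Tloc D (G u)) (M *m h).
set T := Tloc D (G u) in Dr Tr *; set w := M *m h in Tr *.
pose X i := (t_ i)^-1 *: (z_ i - G u).
have Mh : M *m h_ i @[i --> \oo] --> w.
  by apply: cvg_mulmx => //; exact: cvg_cst.
have Xw : X @ \oo --> w.
  have -> : X = fun i => t_ i *: ((t_ i ^+ 2)^-1 *:
        (G (u + t_ i *: h_ i) - G u - t_ i *: (M *m h_ i))
      - (t_ i ^+ 2)^-1 *: (G (u + t_ i *: h_ i) - z_ i)) + M *m h_ i.
    apply/funext => i; rewrite /X -scalerBr scalerA expr2 invfM mulrA divff // mul1r.
    rewrite (_ : G (u + t_ i *: h_ i) - G u - t_ i *: (M *m h_ i)
        - (G (u + t_ i *: h_ i) - z_ i) = z_ i - G u - t_ i *: (M *m h_ i)); last first.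
      by apply/matrixP => a b; rewrite !mxE; ring.
    by rewrite [in RHS]scalerBr [in X in _ - X + _]scalerA mulVf // scale1r subrK.
  rewrite -[X in _ --> X]add0r -(scale0r (2^-1 *: q h - 0)).
  by apply: cvgD => //; apply: cvgZ => //; exact: cvgB.
have zE i : z_ i = G u + t_ i *: X i.
  by rewrite /X scalerA divff // scale1r addrC subrK.
have tX0 : enorm (t_ i *: X i) @[i --> \oo] --> (0 : R).
  by rewrite -(enorm0 k) -(scale0r w); apply: cvg_enorm; exact: cvgZ.
have XT : \forall i \near \oo, inU T (X i).
  near=> i; rewrite -(conic_inUZ _ (conic_Tloc _ _) (t0 i)) -Dr -?zE //.
  by near: i; exact: (cvgr_lt _ tX0).
have wT : inU T w by exact: (closed_cvg _ (@inU_closed _ _ T) XT _ Xw).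
split => //.
  have cX : t_ i *: ((t_ i ^+ 2)^-1 *: (f (u + t_ i *: h_ i) - f u - t_ i *: dot c (h_ i)))
      + dot c (h_ i) @[i --> \oo] --> dot c h.
    rewrite -[X in _ --> X]add0r -(scale0r (2^-1 *: qf h)).
    by apply: cvgD; [exact: cvgZ|apply: cvg_dot => //; exact: cvg_cst].
  have tr0 : t_ i * r_ i @[i --> \oo] --> (0 : R) by rewrite -(mulr0 0); exact: cvgM.
  apply: (ler_cvg_to cX tr0); near=> i.
  rewrite scalerA expr2 invfM mulrA divff // mul1r -[X in X + _]/(_ * (_ - _ * _)).
  have ti := t0 i; rewrite mulrBr mulKf // subrK mulrC ler_pdivrMr //.
  by rewrite mulrAC -expr2.
move=> alpha y alpha0 st yS.
(* Turns normality at [w], an inequality for X i - w, into one for [X i] itself. *)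
have yw : dot y w = 0 by exact: (normals_orth (conic_Tloc _ _) wT yS).
have lhs : alpha * ((t_ i ^+ 2)^-1 *: (f (u + t_ i *: h_ i) - f u - t_ i *: dot c (h_ i)))
    + dot y ((t_ i ^+ 2)^-1 *: (G (u + t_ i *: h_ i) - G u - t_ i *: (M *m h_ i)))
   @[i --> \oo] --> alpha * (2^-1 *: qf h) + dot y (2^-1 *: q h).
  by apply: cvgD; [exact: cvgMl_tmp|apply: cvg_dot => //; exact: cvg_cst].
have rhs : alpha * r_ i + dot y ((t_ i ^+ 2)^-1 *: (G (u + t_ i *: h_ i) - z_ i))
    @[i --> \oo] --> alpha * 0 + dot y 0.
  by apply: cvgD; [exact: cvgMl_tmp|apply: cvg_dot => //; exact: cvg_cst].
have : alpha * (2^-1 *: qf h) + dot y (2^-1 *: q h) <= alpha * 0 + dot y 0.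
  apply: (ler_cvg_to lhs rhs); near=> i.
  have Xwr : enorm (X i - w) < r2.
    by near: i; exact: (cvgr_lt _ (cvg_enormB Xw)).
  have XiT : inU T (X i) by near: i.
  have yX : dot y (X i) <= 0.
    have : inU (Tloc T w) (X i - w) by rewrite -Tr // addrC subrK.
    by move=> /yS; rewrite dotBr yw subr0.
  have t2 : 0 < t_ i ^+ 2 by rewrite exprn_gt0.
  have yz : dot y (z_ i - G u) <= 0.
    by rewrite zE addrAC subrr add0r dotZr pmulr_rle0.
  have -> : dot y ((t_ i ^+ 2)^-1 *: (G (u + t_ i *: h_ i) - G u - t_ i *: (M *m h_ i))) =
     dot y ((t_ i ^+ 2)^-1 *: (G (u + t_ i *: h_ i) - z_ i)) +
     (t_ i ^+ 2)^-1 * (dot y (z_ i - G u) - t_ i * dot y (M *m h_ i)).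
    rewrite -[X in _ * (_ - X)]dotZr -dotBr -dotZr -dotDr -scalerDr; congr (dot y (_ *: _)).
    by apply/matrixP => a b; rewrite !mxE; ring.
  have yM : alpha * dot c (h_ i) + dot y (M *m h_ i) = 0.
    by rewrite dot_mulmxr -dotZl -dotDl st dot0l.
  rewrite addrCA [leRHS]addrC lerD2l -[X in alpha * X]/(_ * (_ - _ * _)).
  rewrite mulrCA -mulrDr mulrC ler_pdivrMr // mulrAC.
  have : alpha * (f (u + t_ i *: h_ i) - f u) <= alpha * (t_ i ^+ 2 * r_ i).
    exact: ler_wpM2l.
  have : t_ i * (alpha * dot c (h_ i) + dot y (M *m h_ i)) = 0 by rewrite yM mulr0.
  lra.
rewrite mulr0 dot0r dotZr -[X in alpha * X]/(_ * _); lra.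
Unshelve. all: by end_near. Qed.

End Sufficient.

(** * Fourier-Motzkin elimination and the Farkas lemma *)

Section DoubleDescription.
Context {R : realType} {l : nat}.
Implicit Types (gens : seq 'cV[R]_l) (x v : 'cV[R]_l).

Fixpoint incone gens x : Prop :=
  if gens is a :: gens' then exists2 mu : R, 0 <= mu & incone gens' (x - mu *: a)
  else x = 0.

(* The inequalities defining the cone generated by gens: the scalar mu of
   incone is eliminated by Fourier-Motzkin. *)
Fixpoint dualgens gens : seq 'cV[R]_l :=
  if gens is a :: gens' then
    let D := dualgens gens' in
    [seq b <- D | dot b a <= 0] ++
    [seq dot b a *: b' - dot b' a *: b | b <- [seq b <- D | 0 < dot b a],
                                         b' <- [seq b <- D | dot b a < 0]]
  else [seq delta_mx i 0 | i <- enum 'I_l] ++ [seq - delta_mx i 0 | i <- enum 'I_l].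

Lemma dot_delta i x : dot (delta_mx i 0) x = x i 0.
Proof.
rewrite dotE (bigD1 i) //= mxE !eqxx mul1r big1 ?addr0 // => j ji.
by rewrite mxE (negbTE ji) mul0r.
Qed.

Lemma all_delta x :
  all (fun b => dot b x <= 0) (dualgens [::]) -> x = 0.
Proof.
rewrite /= all_cat => /andP[/allP p1 /allP p2]; apply/colP => i; rewrite mxE.
rewrite -dot_delta; apply: le_anti; apply/andP; split.
  by apply: p1; apply/mapP; exists i; rewrite ?mem_enum.
by rewrite -oppr_le0 -dotNl; apply: p2; apply/mapP; exists i; rewrite ?mem_enum.
Qed.

Lemma dualgensP gens x :
  incone gens x <-> all (fun b => dot b x <= 0) (dualgens gens).
Proof.
elim: gens x => [x|a gens IH x]; split => [|].
- by move=> /= ->; apply/allP => b _; rewrite dot0r.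
- exact: all_delta.
- move=> /= [mu mu0 /IH/allP ax].
  have bx b : b \in dualgens gens -> dot b x <= mu * dot b a.
    by move=> /ax; rewrite dotBr dotZr subr_le0.
  rewrite all_cat; apply/andP; split; apply/allP.
    move=> b; rewrite mem_filter => /andP[ba /bx bxa].
    by apply: le_trans bxa _; rewrite mulr_ge0_le0.
  move=> _ /allpairsP[[b b'] /= [+ + ->]].
  rewrite !mem_filter => /andP[ba /bx bxa] /andP[b'a /bx b'xa].
  rewrite dotBl !dotZl; nra.
- rewrite /= all_cat => /andP[/allP p1 /allP p2].
  pose D := dualgens gens.
  (* The least admissible scalar: the maximum of 0 and all lower bounds. The combined inequalities
     place it below every upper bound. *)
  pose mu := \big[Num.max/0]_(b <- D | 0 < dot b a) (dot b x / dot b a).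
  exists mu; first by rewrite /mu bigmax_idl le_max lexx.
  apply/IH/allP => b bD; rewrite dotBr dotZr subr_le0.
  have [ba|ba|ba] := ltgtP (dot b a) 0.
  + rewrite -ler_ndivlMr // /mu big_seq_cond; apply: bigmax_le.
      by rewrite mulr_le0 // ?invr_le0 ?(ltW ba) // p1 // mem_filter (ltW ba).
    move=> b' /andP[b'D b'a]; rewrite ler_ndivlMr // mulrAC ler_pdivlMr //.
    have : dot (dot b' a *: b - dot b a *: b') x <= 0.
      apply: p2; apply/allpairsP; exists (b', b); split => //=.
        by rewrite mem_filter b'a.
      by rewrite mem_filter ba.
    rewrite dotBl !dotZl; lra.
  + rewrite -ler_pdivrMr //.
    exact: (le_bigmax_seq 0 b (fun b => 0 < dot b a) (fun b => dot b x / dot b a)).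
  + by rewrite ba mulr0 p1 // mem_filter ba lexx.
Qed.

Lemma incone0 gens : incone gens 0.
Proof.
by elim: gens => //= a gens IH; exists 0 => //; rewrite scale0r subr0.
Qed.

Lemma incone_gen gens a : a \in gens -> incone gens a.
Proof.
elim: gens => //= b gens IH; rewrite inE => /predU1P[<-|/IH ab].
  by exists 1 => //; rewrite scale1r subrr; exact: incone0.
by exists 0 => //; rewrite scale0r subr0.
Qed.

(** Farkas. Each [b] in [dualgens gens] is nonpositive on the generators, since these lie in
    [incone gens]; hence [b] is itself a legitimate test vector for [x]. *)
Lemma polar_dualgens gens x :
  (forall v, all (fun a => dot a v <= 0) gens -> dot x v <= 0) <->
  all (fun b => dot b x <= 0) (dualgens gens).
Proof.
split=> [xgens|/dualgensP].
  apply/allP => b bD; rewrite dotC; apply: xgens; apply/allP => a /incone_gen.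
  by move=> /dualgensP/allP/(_ b bD); rewrite dotC.
elim: gens x => [x /= -> v _|a gens IH x /= [mu mu0 xa] v /andP[av gv]].
  by rewrite dot0l.
have := IH _ xa v gv; rewrite dotBl dotZl.
have : mu * dot a v <= 0 by rewrite mulr_ge0_le0.
lra.
Qed.

(** Double orthogonality: the columns of the cokernel of the matrix with rows [gens] are orthogonal
    to all of [gens], hence to [x], which puts x^T in the row space. *)
Lemma span_annihilator (gens : seq 'cV[R]_l) (x : 'cV[R]_l) :
  (forall v, (forall a, a \in gens -> dot a v = 0) -> dot x v = 0) ->
  x \in <<gens>>%VS.
Proof.
move=> xgens; pose A : 'M[R]_(size gens, l) := \matrix_(i, j) gens`_i j 0.
have rowA i v : (A *m v) i 0 = dot gens`_i v.
  by rewrite mxE dotE; apply: eq_bigr => j _; rewrite mxE.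
have /submxP[B xB] : (x^T <= A)%MS.
  rewrite submxE; apply/eqP/matrixP => i j; rewrite (ord1 i) [RHS]mxE.
  have -> : (x^T *m cokermx A) 0 j = dot x (col j (cokermx A)).
    rewrite /dot [LHS]mxE [RHS]mxE; apply: eq_bigr => k _; congr (_ * _).
    by rewrite [RHS]mxE.
  apply: xgens => a /(nthP 0)[n nlt <-].
  by rewrite -(rowA (Ordinal nlt)) colE mulmxA mulmx_coker mul0mx mxE.
have -> : x = \sum_i B 0 i *: gens`_i.
  apply/colP => j; move/matrixP: xB => /(_ 0 j); rewrite !mxE => ->.
  by rewrite summxE; apply: eq_bigr => i _; rewrite !mxE.
apply: memv_suml => i _; apply: memvZ; apply: memv_span; exact: mem_nth.
Qed.

End DoubleDescription.

(** * The graph of the normal cone mapping as a union of polyhedra *)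

Section NormalConeGraph.
Context {R : realType} {l : nat}.

Lemma sublists_sub (T : eqType) (s r : seq T) : r \in sublists s -> {subset r <= s}.
Proof.
elim: s r => [|x s IH] r /=; first by rewrite inE => /eqP ->.
rewrite mem_cat => /orP[/IH rs y /rs ys|/mapP[r' /IH rs ->] y].
  by rewrite inE ys orbT.
by rewrite !inE => /orP[->//|/rs ->]; rewrite orbT.
Qed.

Lemma inU1 (X : seq ('cV[R]_l * R)) v : inU [:: X] v = inP X v.
Proof. by rewrite /inU /= orbF. Qed.

Lemma polyhedral_inP (P : set 'cV[R]_l) :
  polyhedral P -> exists X, P = [set y | inP X y].
Proof.
move=> [k [A [c ->]]].
exists [seq ((row i A)^T, c i 0) | i <- enum 'I_k].
have rowA i y : dot (row i A)^T y = (A *m y) i 0.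
  by rewrite /dot trmxK -row_mul mxE.
apply/seteqP; split => y /= Py.
  by apply/allP => _ /mapP[i _ ->] /=; rewrite rowA.
move=> i; rewrite -rowA.
by move/allP: Py => /(_ ((row i A)^T, c i 0)); apply; apply/mapP; exists i; rewrite ?mem_enum.
Qed.

Variable X : seq ('cV[R]_l * R).

(** The normal cone of a polyhedron is the polar of its tangent cone, which the active constraint
    normals cut out. *)
Lemma ncone_inP p x :
  ncone [set y | inP X y] p x <->
  inP X p /\ forall v, all (fun a => dot a v <= 0) (unzip1 (active X p)) -> dot x v <= 0.
Proof.
have actE v : all (fun a => dot a v <= 0) (unzip1 (active X p)) = inP (active X p) v.
  by rewrite /inP /unzip1 /active !all_map.
split=> [[Xp xp]|[Xp xp]]; split => //.
  move=> v; rewrite actE => vT; have [r r0 Xr] := inU_local [:: X] p.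
  have v1 : 0 < enorm v + 1 by rewrite ltr_wpDl // enorm_ge0.
  have t0 : 0 < r / (enorm v + 1) by rewrite divr_gt0.
  have := xp (p + (r / (enorm v + 1)) *: v).
  rewrite addrAC subrr add0r dotZr pmulr_rle0 //; apply; rewrite /= -inU1 Xr.
    by rewrite conic_inUZ ?conic_Tloc // /Tloc /= Xp inU1.
  by rewrite enormZ gtr0_norm // mulrAC ltr_pdivrMr // ltr_pM2l // ltrDl.
move=> q /= Xq; apply: xp; rewrite actE; apply/allP => _ /mapP[h + ->] /=.
rewrite mem_filter dotBr => /andP[/eqP -> hX]; rewrite subr_le0.
by move/allP: Xq => /(_ h hX).
Qed.

Lemma gph_ncone_polyhedral :
  exists Q, gph_ncone [set y | inP X y] = [set z | inU Q z].
Proof.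
(* For a subset [Y] of the constraints: p lies in P, the constraints of [Y] are active at p (through
   the reversed inequalities), and x lies in the cone generated by their normals. *)
pose piece (Y : seq ('cV[R]_l * R)) : seq ('cV[R]_(l + l) * R) :=
  [seq (col_mx h.1 0, h.2) | h <- X] ++
  ([seq (col_mx (- h.1) 0, - h.2) | h <- Y] ++
   [seq (col_mx 0 b, 0) | b <- dualgens (unzip1 Y)]).
have pieceE Y p x : inP (piece Y) (col_mx p x) =
    [&& inP X p, all (fun h => dot h.1 p >= h.2) Y &
      all (fun b => dot b x <= 0) (dualgens (unzip1 Y))].
  rewrite /inP /piece !all_cat !all_map; congr [&& _, _ & _]; apply: eq_all => h /=.
  - by rewrite dot_col_mx dot0l addr0.
  - by rewrite dot_col_mx dot0l addr0 dotNl lerN2.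
  - by rewrite dot_col_mx dot0l add0r.
have act1 p Y : unzip1 (active Y p) = unzip1 [seq h <- Y | dot h.1 p == h.2].
  by rewrite /active /unzip1 -map_comp.
exists (map piece (sublists X)); apply/seteqP; split => z /=.
  rewrite /gph_ncone /= -{3}[z]vsubmxK => /ncone_inP[Xp xp].
  apply/hasP; exists (piece [seq h <- X | dot h.1 (usubmx z) == h.2]).
    by rewrite map_f // filter_sublists.
  rewrite pieceE Xp /=; apply/andP; split.
    by apply/allP => h; rewrite mem_filter => /andP[/eqP -> _].
  by apply/polar_dualgens => v vX; apply: xp; rewrite act1.
move=> /hasP[_ /mapP[Y YX ->]]; rewrite -{1}[z]vsubmxK pieceE.
move=> /and3P[Xp Yp /polar_dualgens Yx]; apply/ncone_inP; split => // v /allP vX.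
apply: Yx; apply/allP => a /mapP[h hY ->]; apply: vX.
rewrite act1; apply/mapP; exists h => //; rewrite mem_filter (sublists_sub YX) //.
rewrite andbT; apply/eqP/le_anti; rewrite (allP Yp _ hY) andbT.
by move/allP: Xp => /(_ h (sublists_sub YX hY)).
Qed.

End NormalConeGraph.

(** * Product with zero, and the span containing the first normal component *)

Section NormalConeSpan.
Context {R : realType} {l : nat}.

Lemma zero_times_polyhedral m (Q : seq (seq ('cV[R]_l * R))) :
  exists D, forall (a : 'cV[R]_m) z, inU D (col_mx a z) = (a == 0) && inU Q z.
Proof.
(* [dualgens [::]] lists the unit vectors and their negatives, so these inequalities say a = 0. *)
pose eqs : seq ('cV[R]_(m + l) * R) :=
  [seq (col_mx b 0, 0) | b <- dualgens [::]].
exists [seq eqs ++ [seq (col_mx 0 h.1, h.2) | h <- Y] | Y <- Q] => a z.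
have eqsE : inP eqs (col_mx a z) = (a == 0).
  rewrite /inP all_map (eq_all (a2 := fun b => dot b a <= 0)); last first.
    by move=> b /=; rewrite dot_col_mx dot0l addr0.
  by apply/idP/eqP => [/all_delta //|->]; apply/allP => b _; rewrite dot0r.
rewrite /inU has_map [LHS](eq_has (a2 := fun Y => (a == 0) && inP Y z)).
  by case: (a == 0) => //=; elim: Q.
move=> Y /=; rewrite /inP all_cat -/(inP eqs _) eqsE; congr (_ && _).
by rewrite all_map; apply: eq_all => h /=; rewrite dot_col_mx dot0l add0r.
Qed.

(** If [v] is orthogonal to the active normals at [p], graph points near [p] can be shifted by (s v,
    0) for small s of either sign and stay in the graph. So regular normals there have first
    component orthogonal to [v], and so does their limit; [span_annihilator] concludes. *)
Lemma dir_ncone_span (P : set 'cV[R]_l) p x w tau sigma :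
  polyhedral P -> P p ->
  dir_ncone (gph_ncone P) (col_mx p x) w (col_mx tau sigma) ->
  span_diff (ncone P p) tau.
Proof.
move=> /polyhedral_inP[X ->] Xp [t_ [u_ [v_ [t0 t_0 uw vy vN]]]].
have N0 : ncone [set y | inP X y] p 0.
  by apply/ncone_inP; split => // v _; rewrite dot0l.
exists (unzip1 (active X p)); split=> [a aX|].
  exists a; last by exists 0; rewrite ?subr0.
  by apply/ncone_inP; split => // v /allP/(_ a aX).
apply: span_annihilator => v vX.
have tvE i : dot (usubmx (v_ i)) v = dot (v_ i) (col_mx v 0).
  by rewrite -{2}[v_ i]vsubmxK dot_col_mx dot0r addr0.
suff near0 : \forall i \near \oo, dot (v_ i) (col_mx v 0) = 0.
  have c1 : dot (v_ i) (col_mx v 0) @[i --> \oo] --> dot (col_mx tau sigma) (col_mx v 0).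
    by apply: cvg_dot => //; exact: cvg_cst.
  have -> : dot tau v = dot (col_mx tau sigma) (col_mx v 0).
    by rewrite dot_col_mx dot0r addr0.
  exact: (closed_cvg _ (@closed_eq _ 0) near0 _ c1).
have [r r0 Xr] := inU_local [:: X] p.
have tu0 : enorm (t_ i *: u_ i) @[i --> \oo] --> (0 : R).
  by rewrite -(enorm0 (l + l)) -(scale0r w); apply: cvg_enorm; exact: cvgZ.
near=> i; set z := col_mx p x + t_ i *: u_ i.
have zE : usubmx z = p + usubmx (t_ i *: u_ i).
  by rewrite /z -{1}[t_ i *: u_ i]vsubmxK add_col_mx col_mxKu.
set e := usubmx (t_ i *: u_ i) in zE.
have er : enorm e < r.
  have : enorm (t_ i *: u_ i) < r by near: i; exact: (cvgr_lt _ tu0).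
  apply: le_lt_trans; rewrite -(@ler_pXn2r _ 2) ?nnegrE ?enorm_ge0 //.
  by rewrite !enorm_sqr -[t_ i *: u_ i]vsubmxK dot_col_mx lerDl dot_ge0.
have [zP zN] := vN i; rewrite -/z in zP zN.
have Xe : inU (Tloc [:: X] p) e.
  by rewrite -Xr // -zE inU1; case: zP.
have shift (s : R) : enorm (e + s *: v) < r -> inP X (usubmx z + s *: v).
  move=> es; rewrite zE -addrA -inU1 Xr //; move: Xe.
  rewrite /Tloc /= Xp !inU1 => /allP Xe; apply/allP => h hX.
  rewrite dotDr dotZr (vX h.1) ?mulr0 ?addr0; first exact: Xe.
  by apply/mapP; exists h.
have nv : enorm (s *: v) @[s --> (0 : R)] --> (0 : R).
  rewrite -[X in _ --> X](enorm0 l) -(scale0r v).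
  apply: (@cvg_enorm _ _ (nbhs (0 : R))).
  by apply: (@cvgZr_tmp _ _ _ (nbhs (0 : R))); exact: cvg_id.
have small : \forall s \near (0 : R), enorm (e + s *: v) < r.
  near=> s; apply: (le_lt_trans (enormD _ _)).
  suff : enorm (s *: v) < r - enorm e by lra.
  by near: s; apply: (@cvgr_lt _ _ (nbhs (0 : R)) _ _ _ nv); rewrite subr_gt0.
(* Both p + s v and p - s v belong to P, so a normal vector at p is orthogonal to [v]; hence it
   remains normal after the shift. *)
have xv0 : dot (dsubmx z) v = 0.
  have [d /= d0 sd] := small.
  have dd : 0 < d / 2 by rewrite divr_gt0.
  have d2 : d / 2 < d by rewrite ltr_pdivrMr // ltr_pMr // ltr1n.
  have /shift sp : enorm (e + (d / 2) *: v) < r.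
    by apply: sd; rewrite /ball_/= sub0r normrN gtr0_norm.
  have /shift sn : enorm (e + (- (d / 2)) *: v) < r.
    by apply: sd; rewrite /ball_/= sub0r normrN normrN gtr0_norm.
  case: zP => _ zP; have := zP _ sp; have := zP _ sn.
  have addK (y y' : 'cV[R]_l) : y + y' - y = y' by rewrite addrAC subrr add0r.
  rewrite !addK !dotZr.
  nra.
have shiftP (s : R) : enorm (e + s *: v) < r ->
    gph_ncone [set y | inP X y] (z + s *: col_mx v 0).
  move=> /shift sX; rewrite /gph_ncone /= -[z]vsubmxK.
  rewrite scale_col_mx scaler0 add_col_mx addr0 col_mxKu col_mxKd.
  case: zP => _ zP; split => // q /zP; apply: le_trans.
  by rewrite opprD addrA [leLHS]dotBr dotZr xv0 mulr0 subr0.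
(* The boolean is the sign of the shift. *)
have le0 (b : bool) : (-1) ^+ b * dot (v_ i) (col_mx v 0) <= 0.
  apply/ler_addgt0Pl => e' e'0; rewrite addr0.
  set cv := col_mx v _; have nc : 0 < enorm cv + 1 by rewrite ltr_wpDl // enorm_ge0.
  have [d d0 zd] := near_enorm (zN _ (divr_gt0 e'0 nc)).
  have [d' /= d'0 sd] := small.
  pose s := Num.min d' (d / (enorm cv + 1)) / 2.
  have s0 : 0 < s by rewrite divr_gt0 // lt_min d'0 divr_gt0.
  have : s < Num.min d' (d / (enorm cv + 1)).
    by rewrite ltr_pdivrMr // ltr_pMr ?ltr1n // lt_min d'0 divr_gt0.
  rewrite lt_min ltr_pdivlMr // => /andP[sd' scv].
  have nsg : `|(-1) ^+ b * s| = s by rewrite normrMsign gtr0_norm.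
  have ncv : enorm (((-1) ^+ b * s) *: cv) = s * enorm cv by rewrite enormZ nsg.
  have sR : enorm (e + ((-1) ^+ b * s) *: v) < r.
    by apply: sd; rewrite /ball_/= sub0r normrN nsg.
  have := zd (z + ((-1) ^+ b * s) *: cv).
  rewrite addrAC subrr add0r ncv => /(_ _ (shiftP _ sR)).
  rewrite dotZr => /(_ _) h.
  have {h} : (-1) ^+ b * s * dot (v_ i) cv <= e' / (enorm cv + 1) * (s * enorm cv).
    by apply: h; have := enorm_ge0 cv; nra.
  rewrite mulrAC (mulrCA _ s) mulrC ler_pM2l // => /le_trans; apply.
  rewrite mulrAC ler_pdivrMr //; nra.
have := le0 false; have := le0 true; rewrite expr1 expr0; lra.
Unshelve. all: by end_near. Qed.

End NormalConeSpan.

(** * First and second order expansions of scalar functions *)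

Section Taylor.
Context {R : realType} {n : nat}.
Implicit Types (phi : 'cV[R]_n -> R) (u v x : 'cV[R]_n).

Lemma uniform_radius (I : finType) (Q : I -> R -> Prop) :
  (forall i, exists2 d : R, 0 < d & Q i d) ->
  (forall i d d', d' <= d -> Q i d -> Q i d') ->
  exists2 d : R, 0 < d & forall i, Q i d.
Proof.
move=> Qex Qdec.
have QQ : \forall d \near (0 : R)^'+, forall i, Q i d.
  apply: filter_forall => i; have [d d0 Qd] := Qex i.
  near=> d'; apply: (Qdec _ d) => //; near: d'; exact: nbhs_right_le.
have [d [Qd d0]] : exists d, (forall i, Q i d) /\ 0 < d.
  by apply: (@filter_ex _ (0 : R)^'+); apply: filterI QQ _; exact: nbhs_right_gt.
by exists d.
Unshelve. all: by end_near. Qed.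

Lemma derive_ray phi x v (t : R) :
  (forall y, differentiable phi y) ->
  is_derive t 1 (fun s => phi (x + s *: v)) ('D_v phi (x + t *: v)).
Proof.
move=> dphi; have E : (fun s : R => s^-1 *: (((fun s => phi (x + s *: v)) \o shift t)
    (s *: 1) - phi (x + t *: v))) =
    (fun s => s^-1 *: ((phi \o shift (x + t *: v)) (s *: v) - phi (x + t *: v))).
  apply/funext => s /=; congr (_ *: (phi _ - _)).
  by rewrite -[s *: 1]/(s * 1) mulr1 scalerDl addrCA.
by apply: DeriveDef; rewrite /derivable /derive E //; exact: diff_derivable.
Qed.

Lemma is_derive_subr_quadratic (f df : R -> R) (a b t : R) :
  is_derive t 1 f (df t) ->
  is_derive t 1 (fun s => f s - (s * a + s ^+ 2 * (2^-1 * b))) (df t - (a + t * b)).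
Proof.
move=> r1; have i1 := is_deriveZ a (is_derive_id t (1 : R)).
have i2 := is_deriveZ (2^-1 * b) (is_deriveX 2 (is_derive_id t (1 : R))).
have i3 := is_deriveB r1 (is_deriveD i1 i2).
have scE (x y : R) : x *: y = x * y by [].
have -> : (fun s => f s - (s * a + s ^+ 2 * (2^-1 * b))) =
    f - (a \*: id + (2^-1 * b) \*: (id : R -> R) ^+ 2).
  by apply/funext => s; rewrite !fctE /= !scE; ring.
by apply: (is_derive_eq i3); rewrite !scE /= expr1; field.
Qed.

Lemma derive_coord (W : normedModType R) (f : 'cV[R]_n -> W) u v :
  differentiable f u -> 'D_v f u = \sum_j v j 0 *: 'D_(delta_mx j 0) f u.
Proof.
move=> df; rewrite deriveE // {1}[v]matrix_sum_delta.
under eq_bigr do rewrite big_ord1.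
rewrite linear_sum; apply: eq_bigr => j _.
by rewrite linearZ deriveE.
Qed.

Lemma C2_C1 (W : normedModType R) (f : 'cV[R]_n -> W) : C2 f -> C1 f.
Proof.
move=> [df f2]; split => // v x; apply: differentiable_continuous.
by have [+ _] := f2 v; apply.
Qed.

(** Mean value theorem on the segment from x' to x, with the partial derivatives kept within e / (n
    + 1) of those at [u]; the 1 covers n = 0. *)
Lemma C1_strict phi u (e : R) : C1 phi -> 0 < e ->
  exists2 d : R, 0 < d & forall x x',
    enorm (x - u) <= d -> enorm (x' - u) <= d ->
    `|phi x - phi x' - 'D_(x - x') phi u| <= e * enorm (x - x').
Proof.
move=> [dphi cphi] e0; have n1 : 0 < n%:R + 1 :> R by rewrite ltr_wpDl.
have : \forall y \near u, forall j : 'I_n,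
    `|'D_(delta_mx j 0) phi u - 'D_(delta_mx j 0) phi y| <= e / (n%:R + 1).
  apply: (@filter_forall _ _ _ (nbhs u)) => j.
  have /cvgrPdist_le := cphi (delta_mx j 0) u; apply; exact: divr_gt0.
move=> /near_enorm[d d0 ud]; exists (d / 2); first by rewrite divr_gt0.
move=> x x' xd x'd; set v := x - x'.
have ray (t : R) : is_derive t 1 (fun s : R => phi (x' + s *: v)) ('D_v phi (x' + t *: v)).
  exact: derive_ray.
have [|s s01] := MVT ltr01 (fun t _ => ray t).
  apply: continuous_subspaceT => t.
  by apply: differentiable_continuous; apply/derivable1_diffP; case: (ray t).
rewrite scale1r scale0r addr0 subr0 mulr1 /v (addrC x') subrK -/v => ->.
rewrite !derive_coord // -sumrB (le_trans (ler_norm_sum _ _ _)) //.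
move: s01; rewrite in_itv /= => /andP[s0 s1].
have sd : enorm (x' + s *: v - u) < d.
  have -> : x' + s *: v - u = (1 - s) *: (x' - u) + s *: (x - u).
    by rewrite /v; apply/matrixP => i j; rewrite !mxE; ring.
  rewrite (le_lt_trans (enormD _ _)) // !enormZ !ger0_norm ?subr_ge0 ?(ltW s1) ?(ltW s0) //.
  have : (1 - s) * enorm (x' - u) <= (1 - s) * (d / 2).
    by rewrite ler_wpM2l // subr_ge0 ltW.
  have : s * enorm (x - u) <= s * (d / 2) by rewrite ler_wpM2l // ltW.
  lra.
apply: (@le_trans _ _ (\sum_(j < n) enorm v * (e / (n%:R + 1)))).
  apply: ler_sum => j _; rewrite -scalerBr normrZ ler_pM ?enorm_coord //.
  by rewrite distrC; exact: ud.
rewrite sumr_const card_ord -[leLHS]mulr_natl mulrCA [leLHS]mulrC ler_wpM2r ?enorm_ge0 //.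
by rewrite mulrCA ler_piMr ?(ltW e0) // ler_pdivrMr // mul1r lerDl.
Qed.

Lemma hessqE phi u v : C2 phi ->
  hessq phi u v = \sum_j v j 0 * 'D_v ('D_(delta_mx j 0) phi) u.
Proof.
move=> [_ phi2]; rewrite /hessq mxE; apply: eq_bigr => j _.
rewrite mulrC mxE derive_coord; last by case: (phi2 (delta_mx j 0)).
by congr (_ * _); apply: eq_bigr => i _; rewrite !mxE.
Qed.

(** One mean value step suffices once the quadratic is subtracted along the ray: the derivative of
    the difference is controlled by the first-order expansions of the partial derivatives. *)
Lemma C2_taylor phi u (e : R) : C2 phi -> 0 < e ->
  exists2 d : R, 0 < d & forall v, enorm v <= d ->
    `|phi (u + v) - phi u - 'D_v phi u - 2^-1 * hessq phi u v| <= e * enorm v ^+ 2.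
Proof.
move=> C2phi e0; have [dphi phi2] := C2phi.
have n1 : 0 < n%:R + 1 :> R by rewrite ltr_wpDl.
have [d d0 ud] : exists2 d : R, 0 < d & forall (j : 'I_n) y, enorm (y - u) <= d ->
    `|'D_(delta_mx j 0) phi y - 'D_(delta_mx j 0) phi u
      - 'D_(y - u) ('D_(delta_mx j 0) phi) u| <= e / (n%:R + 1) * enorm (y - u).
  apply: uniform_radius => [j|j d d' d'd Hd y /le_trans yd]; last exact/Hd/yd.
  have [d d0 Hd] := C1_strict u (phi2 (delta_mx j 0)) (divr_gt0 e0 n1).
  by exists d => // y yd; apply: Hd; rewrite // subrr enorm0 ltW.
exists d => // v vd.
have ray' a b (t : R) : is_derive t 1
    (fun s : R => phi (u + s *: v) - (s * a + s ^+ 2 * (2^-1 * b)))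
    ('D_v phi (u + t *: v) - (a + t * b)).
  exact: (@is_derive_subr_quadratic (fun s => phi (u + s *: v))
    (fun t => 'D_v phi (u + t *: v)) a b t (derive_ray u v t dphi)).
set a := 'D_v phi u; set b := hessq phi u v; have ray := ray' a b.
have [|s s01] := MVT ltr01 (fun t _ => ray t).
  apply: continuous_subspaceT => t.
  by apply: differentiable_continuous; apply/derivable1_diffP; case: (ray t).
rewrite !scale1r scale0r addr0 subr0 !mulr1 mul0r expr0n mul0r addr0 subr0 expr1n !mul1r.
move: s01; rewrite in_itv /= => /andP[s0 s1] h1.
have -> : phi (u + v) - phi u - a - 2^-1 * b = 'D_v phi (u + s *: v) - (a + s * b) by lra.
rewrite /a /b hessqE // !derive_coord // mulr_sumr -big_split -sumrB /=.
rewrite (le_trans (ler_norm_sum _ _ _)) //.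
have sv : enorm (u + s *: v - u) = s * enorm v.
  by rewrite addrAC subrr add0r enormZ gtr0_norm.
have svd : s * enorm v <= enorm v by rewrite ler_piMl ?enorm_ge0 // ltW.
apply: (@le_trans _ _ (\sum_(j < n) enorm v * (e / (n%:R + 1) * enorm v))).
  apply: ler_sum => j _; have := ud j (u + s *: v).
  rewrite sv => /(_ (le_trans svd vd)) hj.
  have dZ : 'D_(u + s *: v - u) ('D_(delta_mx j 0) phi) u = s * 'D_v ('D_(delta_mx j 0) phi) u.
    rewrite addrAC subrr add0r !deriveE ?linearZ //; by case: (phi2 (delta_mx j 0)).
  rewrite dZ in hj.
  have scE (x y : R) : x *: y = x * y by [].
  rewrite !scE mulrCA -mulrDr -mulrBr normrM ler_pM ?enorm_coord //.
  rewrite opprD addrA (le_trans hj) // ler_wpM2l //; first by rewrite divr_ge0 // ltW.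
rewrite sumr_const card_ord -[leLHS]mulr_natl mulrCA [leLHS]mulrC expr2 mulrA.
rewrite ler_wpM2r ?enorm_ge0 //.
rewrite mulrA [leRHS]mulrC [leLHS]mulrC ler_wpM2l ?enorm_ge0 //.
by rewrite mulrCA ler_piMr ?(ltW e0) // ler_pdivrMr // mul1r lerDl.
Qed.

End Taylor.

(** * Expansions of matrix-valued maps, Jacobians and gradients *)

Section MatrixCalculus.
Context {R : realType} {n : nat}.

Section Matrix.
Context {p q : nat}.
Implicit Types (H : 'cV[R]_n -> 'M[R]_(p, q)).

Lemma differentiable_entry H x i j :
  differentiable H x -> differentiable (fun y => H y i j) x.
Proof.
move=> dH; apply: (@differentiable_comp _ _ _ _ H (fun A : 'M[R]_(p, q) => A i j)) => //.
exact: differentiable_coord.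
Qed.

Lemma derive_entry H x v i j :
  differentiable H x -> 'D_v (fun y => H y i j) x = 'D_v H x i j.
Proof. by move=> dH; rewrite derive_mx ?mxE //; exact: diff_derivable. Qed.

Lemma C2_entry H i j : C2 H -> C2 (fun x => H x i j).
Proof.
move=> [dH H2]; split => [x|v]; first exact: differentiable_entry.
have [d2 c2] := H2 v.
have -> : 'D_v (fun x => H x i j) = fun x => 'D_v H x i j.
  by apply/funext => x; exact: derive_entry.
split => [x|w]; first exact: differentiable_entry.
have -> : 'D_w (fun x => 'D_v H x i j) = fun x => 'D_w ('D_v H) x i j.
  by apply/funext => x; rewrite (@derive_entry ('D_v H)).
by move=> x; apply: (@cvg_mx_coord _ _ (nbhs x)); exact: c2.
Qed.

Lemma mx_strict H u (e : R) : C2 H -> 0 < e ->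
  exists2 d : R, 0 < d & forall x x',
    enorm (x - u) <= d -> enorm (x' - u) <= d ->
    `|H x - H x' - 'D_(x - x') H u| <= e * enorm (x - x').
Proof.
move=> C2H e0; have [dH _] := C2H.
have [d d0 Hd] : exists2 d : R, 0 < d & forall (ij : 'I_p * 'I_q) x x',
    enorm (x - u) <= d -> enorm (x' - u) <= d ->
    `|H x ij.1 ij.2 - H x' ij.1 ij.2 - 'D_(x - x') H u ij.1 ij.2| <= e * enorm (x - x').
  apply: uniform_radius => [[i j]|ij d d' d'd Hd x x' xd x'd].
    have [d d0 Hd] := C1_strict u (C2_C1 (C2_entry i j C2H)) e0.
    by exists d => // x x' xd x'd; rewrite -derive_entry //; exact: Hd.
  by apply: Hd; [exact: le_trans d'd|exact: le_trans d'd].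
exists d => // x x' xd x'd; apply: mx_norm_le; first by rewrite mulr_ge0 ?enorm_ge0 ?ltW.
by move=> i j; rewrite 3!mxE mxE; exact: (Hd (i, j)).
Qed.

Lemma cvg_derive_dir H u (h_ : nat -> 'cV[R]_n) h :
  differentiable H u -> h_ @ \oo --> h ->
  'D_(h_ i) H u @[i --> \oo] --> 'D_h H u.
Proof.
move=> dH hh; rewrite derive_coord //; under eq_cvg do rewrite derive_coord //.
by apply: cvg_sumr => j; apply: cvgZr_tmp; exact: cvg_mx_coord.
Qed.

End Matrix.

Lemma C2_expands2 (phi : 'cV[R]_n -> R) u : C2 phi ->
  expands2 phi u (fun v => 'D_v phi u) (hessq phi u).
Proof.
move=> C2phi t_ h_ h t0 t_0 hh; have dphi : differentiable phi u by case: C2phi.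
have hessZ (t : R) v : hessq phi u (t *: v) = t ^+ 2 * hessq phi u v.
  rewrite /hessq (_ : (t *: v)^T = t *: v^T); last by rewrite linearZ.
  by rewrite -!scalemxAl -scalemxAr scalerA -expr2 mxE.
pose A i := (t_ i ^+ 2)^-1 * (phi (u + t_ i *: h_ i) - phi u - 'D_(t_ i *: h_ i) phi u
   - 2^-1 * hessq phi u (t_ i *: h_ i)).
have A0 : A @ \oo --> (0 : R).
  apply/cvgrPdist_le => e e0.
  (* Eventually |h_i| < |h| + 1, so this square is the loss in passing from |t_i h_i|^2 to t_i^2. *)
  have nh : 0 < (enorm h + 1) ^+ 2 by rewrite exprn_gt0 // ltr_wpDl // enorm_ge0.
  have [d d0 Hd] := C2_taylor u C2phi (divr_gt0 e0 nh).
  have th0 : enorm (t_ i *: h_ i) @[i --> \oo] --> (0 : R).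
    by rewrite -(enorm0 n) -(scale0r h); apply: cvg_enorm; exact: cvgZ.
  near=> i; have t2 : 0 < t_ i ^+ 2 by rewrite exprn_gt0.
  have thd : enorm (t_ i *: h_ i) < d by near: i; exact: (cvgr_lt _ th0).
  have hi : enorm (h_ i) < enorm h + 1.
    near: i; apply: (cvgr_lt _ (cvg_enorm hh)); lra.
  rewrite sub0r normrN normrM gtr0_norm ?invr_gt0 // mulrC ler_pdivrMr //.
  apply: (le_trans (Hd _ (ltW thd))); rewrite mulrAC ler_pdivrMr // -mulrA ler_pM2l //.
  rewrite enormZ gtr0_norm // exprMn ler_pM2l // ler_pXn2r ?nnegrE ?enorm_ge0 ?ltW //.
  by rewrite ltr_wpDl // enorm_ge0.
have -> : (fun i => (t_ i ^+ 2)^-1 *: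
    (phi (u + t_ i *: h_ i) - phi u - t_ i *: 'D_(h_ i) phi u)) = fun i => A i + 2^-1 *: hessq phi u (h_ i).
  apply/funext => i; rewrite /A hessZ.
  have -> : 'D_(t_ i *: h_ i) phi u = t_ i * 'D_(h_ i) phi u.
    by rewrite !deriveE // linearZ.
  have scE (x y : R) : x *: y = x * y by [].
  have ti := t0 i; rewrite !scE; field; exact: lt0r_neq0.
rewrite -[X in _ --> X]add0r; apply: cvgD => //; apply: cvgZl_tmp.
apply: cvg_mx_coord; apply: cvg_mulmx => //; apply: cvg_mulmx; last exact: cvg_cst.
exact: cvg_trmx.
Unshelve. all: by end_near. Qed.

Lemma mx_expands2 p q (H : 'cV[R]_n -> 'M[R]_(p, q)) u : C2 H ->
  expands2 H u (fun v => 'D_v H u) (hessq_mx H u).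
Proof.
move=> C2H t_ h_ h t0 t_0 hh; apply: cvg_mx => i j.
have := C2_expands2 (u := u) (C2_entry i j C2H) t0 t_0 hh.
have -> : (2^-1 *: hessq_mx H u h) i j = 2^-1 *: hessq (fun y => H y i j) u h.
  by rewrite !mxE.
apply: cvg_trans; apply: near_eq_cvg; near=> k.
by rewrite derive_entry ?mxE //; case: C2H.
Unshelve. all: by end_near. Qed.

Lemma mx_expands1 p q (H : 'cV[R]_n -> 'M[R]_(p, q)) u (t_ : nat -> R) h_ h : C2 H ->
  (forall i, 0 < t_ i) -> t_ @ \oo --> (0 : R) -> h_ @ \oo --> h ->
  (t_ i)^-1 *: (H (u + t_ i *: h_ i) - H u) @[i --> \oo] --> 'D_h H u.
Proof.
move=> C2H t0 t_0 hh; have X := mx_expands2 (u := u) C2H t0 t_0 hh.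
have -> : (fun i => (t_ i)^-1 *: (H (u + t_ i *: h_ i) - H u)) = fun i =>
    t_ i *: ((t_ i ^+ 2)^-1 *: (H (u + t_ i *: h_ i) - H u - t_ i *: 'D_(h_ i) H u))
    + 'D_(h_ i) H u.
  apply/funext => i; have ti : t_ i != 0 by rewrite gt_eqF.
  rewrite scalerA expr2 invfM mulrA divff // mul1r [in RHS]scalerBr scalerA mulVf //.
  by rewrite scale1r subrK.
rewrite -[X in _ --> X]add0r -(scale0r (2^-1 *: hessq_mx H u h)).
apply: cvgD; first exact: cvgZ.
by apply: cvg_derive_dir => //; case: C2H.
Qed.

Lemma jac_mulmx m (F : 'cV[R]_n -> 'cV[R]_m) x v :
  differentiable F x -> jac F x *m v = 'D_v F x.
Proof.
move=> dF; apply/colP => i; rewrite derive_coord // summxE mxE.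
by apply: eq_bigr => j _; rewrite !mxE mulrC.
Qed.

Lemma dot_grad (f : 'cV[R]_n -> R) x v : differentiable f x -> dot (grad f x) v = 'D_v f x.
Proof.
move=> df; rewrite derive_coord // dotE.
by apply: eq_bigr => j _; rewrite mxE mulrC.
Qed.

Lemma jac_tr_mulmx m l (b : 'cV[R]_n -> 'M[R]_(l, m)) (eta : 'cV[R]_l) x v :
  differentiable b x ->
  jac (fun y => (b y)^T *m eta) x *m v = ('D_v b x)^T *m eta.
Proof.
move=> db; have E w : 'D_w (fun y => (b y)^T *m eta) x = ('D_w b x)^T *m eta.
  apply/cvg_lim => //=.
  have -> : (fun h => h^-1 *:
        (((fun y => (b y)^T *m eta) \o shift x) (h *: w) - (b x)^T *m eta)) =
      fun h : R => (h^-1 *: ((b \o shift x) (h *: w) - b x))^T *m eta.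
    apply/funext => h; set X := (b \o _) _.
    have -> : (h^-1 *: (X - b x))^T = h^-1 *: (X^T - (b x)^T) by rewrite linearZ /= linearB.
    by rewrite -scalemxAl mulmxBl.
  apply: cvg_mulmx; last exact: cvg_cst.
  apply: cvg_trmx; exact: (diff_derivable db).
apply/colP => i; rewrite derive_coord // linear_sum mulmx_suml summxE mxE.
by apply: eq_bigr => j _; rewrite mxE E linearZ /= -scalemxAl [RHS]mxE mulrC.
Qed.

Lemma mulmx_norm p q (A : 'M[R]_(p, q)) (v : 'cV[R]_q) :
  enorm (A *m v) <= p%:R * (q%:R * (`|A| * enorm v)).
Proof.
apply: (le_trans (enorm_le_norm _)); rewrite ler_wpM2l //.
apply: mx_norm_le => [|i j]; first by rewrite !mulr_ge0 ?enorm_ge0.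
rewrite (ord1 j) mxE (le_trans (ler_norm_sum _ _ _)) //.
apply: (@le_trans _ _ (\sum_(j < q) `|A| * enorm v)).
  by apply: ler_sum => j' _; rewrite normrM ler_pM ?mx_norm_coord ?enorm_coord.
by rewrite sumr_const card_ord mulr_natl.
Qed.

Lemma derive_bound p q (H : 'cV[R]_n -> 'M[R]_(p, q)) u : differentiable H u ->
  exists2 C : R, 0 <= C & forall v, `|'D_v H u| <= C * enorm v.
Proof.
move=> dH; exists (\sum_j `|'D_(delta_mx j 0) H u|); first exact: sumr_ge0.
move=> v; rewrite derive_coord // (le_trans (ler_norm_sum _ _ _)) // mulr_suml.
by apply: ler_sum => j _; rewrite normrZ mulrC ler_wpM2l // enorm_coord.
Qed.

End MatrixCalculus.

(** * Norms and limits of stacked vectors *)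

Section BlockColumns.
Context {R : realType}.

Lemma enorm_col_mx p q (a : 'cV[R]_p) (b : 'cV[R]_q) :
  enorm (col_mx a b) <= enorm a + enorm b.
Proof.
rewrite -(@ler_pXn2r _ 2) ?nnegrE ?addr_ge0 ?enorm_ge0 //.
rewrite enorm_sqr dot_col_mx sqrrD !enorm_sqr.
have : 0 <= enorm a * enorm b by rewrite mulr_ge0 ?enorm_ge0.
lra.
Qed.

Lemma enorm_usubmx p q (u : 'cV[R]_(p + q)) : enorm (usubmx u) <= enorm u.
Proof.
rewrite -(@ler_pXn2r _ 2) ?nnegrE ?enorm_ge0 // !enorm_sqr.
by rewrite -{3 4}[u]vsubmxK dot_col_mx lerDl dot_ge0.
Qed.

Lemma enorm_dsubmx p q (u : 'cV[R]_(p + q)) : enorm (dsubmx u) <= enorm u.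
Proof.
rewrite -(@ler_pXn2r _ 2) ?nnegrE ?enorm_ge0 // !enorm_sqr.
by rewrite -{3 4}[u]vsubmxK dot_col_mx lerDr dot_ge0.
Qed.

Lemma cvg_usubmx (T : Type) (F : set_system T) {FF : Filter F} p q
    (f : T -> 'cV[R]_(p + q)) (u : 'cV[R]_(p + q)) :
  f x @[x --> F] --> u -> usubmx (f x) @[x --> F] --> usubmx u.
Proof.
move=> fu; apply: cvg_mx => i j; rewrite mxE.
by under eq_cvg do rewrite mxE; exact: cvg_mx_coord.
Qed.

Lemma cvg_dsubmx (T : Type) (F : set_system T) {FF : Filter F} p q
    (f : T -> 'cV[R]_(p + q)) (u : 'cV[R]_(p + q)) :
  f x @[x --> F] --> u -> dsubmx (f x) @[x --> F] --> dsubmx u.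
Proof.
move=> fu; apply: cvg_mx => i j; rewrite mxE.
by under eq_cvg do rewrite mxE; exact: cvg_mx_coord.
Qed.

End BlockColumns.

(** * Derivatives of the constraint map G(x, eta) *)

Section ConstraintMap.
Context {R : realType} {n m l : nat}.
Variables (f : 'cV[R]_n -> R) (F : 'cV[R]_n -> 'cV[R]_m).
Variables (g : 'cV[R]_n -> 'cV[R]_l) (b : 'cV[R]_n -> 'M[R]_(l, m)).
Hypotheses (hf : C2 f) (hF : C2 F) (hg : C2 g) (hb : C2 b).
Variables (x : 'cV[R]_n) (eta : 'cV[R]_l).

(* (x, eta) solves the generalized equation iff
   gep_map (x, eta) belongs to {0} x gph N_P. *)
Definition gep_map (u : 'cV[R]_(n + l)) : 'cV[R]_(m + (l + l)) :=
  col_mx (F (usubmx u) + (b (usubmx u))^T *m dsubmx u)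
         (col_mx (g (usubmx u)) (dsubmx u)).

Definition gep_map_jac : 'M[R]_(m + (l + l), n + l) :=
  col_mx (row_mx (jac F x + jac (fun y => (b y)^T *m eta) x) (b x)^T)
         (col_mx (row_mx (jac g x) 0) (row_mx 0 1%:M)).

(** The factor 2 is the usual one for the cross derivative of a bilinear expression, here b(x)^T
    eta. *)
Definition gep_map_hess (h : 'cV[R]_(n + l)) : 'cV[R]_(m + (l + l)) :=
  col_mx (hessq_mx F x (usubmx h) + (hessq_mx b x (usubmx h))^T *m eta
          + 2 *: (('D_(usubmx h) b x)^T *m dsubmx h))
         (col_mx (hessq_mx g x (usubmx h)) 0).

Let dF : differentiable F x := proj1 hF x.
Let dg : differentiable g x := proj1 hg x.
Let db : differentiable b x := proj1 hb x.

Lemma gep_map_jacE d e : gep_map_jac *m col_mx d e =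
  col_mx (jac F x *m d + ('D_d b x)^T *m eta + (b x)^T *m e) (col_mx (jac g x *m d) e).
Proof.
rewrite /gep_map_jac !mul_col_mx !mul_row_col !mul0mx addr0 add0r mul1mx.
by rewrite mulmxDl jac_tr_mulmx.
Qed.

(** Fixes the sign convention (-lam, tau, sigma): the second block vanishes exactly when sigma = b
    lam, and the first is the Lagrangian gradient without [f]. *)
Lemma gep_map_jac_tr (lam : 'cV[R]_m) (tau sigma : 'cV[R]_l) :
  gep_map_jac^T *m col_mx (- lam) (col_mx tau sigma) =
  col_mx (- ((jac F x)^T *m lam) - (jac (fun y => (b y)^T *m eta) x)^T *m lam
          + (jac g x)^T *m tau)
         (sigma - b x *m lam).
Proof.
rewrite /gep_map_jac !tr_col_mx !tr_row_mx !mul_row_col !mul_col_mx !add_col_mx.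
rewrite trmx1 mul1mx !trmx0 !mul0mx addr0 add0r trmxK !mulmxN.
by rewrite linearD /= mulmxDl opprD (addrC sigma).
Qed.

Lemma gep_map_continuous : continuous gep_map.
Proof.
have cont (V : normedModType R) (f' : 'cV[R]_n -> V) : C2 f' -> continuous f'.
  by move=> [df _] y; exact: differentiable_continuous.
move=> u; have cu : usubmx v @[v --> u] --> usubmx u.
  by apply: (@cvg_usubmx _ _ (nbhs u)); exact: cvg_id.
have cd : dsubmx v @[v --> u] --> dsubmx u.
  by apply: (@cvg_dsubmx _ _ (nbhs u)); exact: cvg_id.
have cc (V : normedModType R) (f' : 'cV[R]_n -> V) : C2 f' ->
    f' (usubmx v) @[v --> u] --> f' (usubmx u).
  by move=> C2f'; apply: (@cvg_comp _ _ _ usubmx f' _ (nbhs (usubmx u))) cu _; exact: cont.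
apply: (@cvg_col_mx _ _ (nbhs u)).
  apply: (@cvgD _ _ _ (nbhs u)); first exact: cc.
  apply: (@cvg_mulmx _ _ (nbhs u)); last exact: cd.
  by apply: (@cvg_trmx _ _ (nbhs u)); exact: cc.
by apply: (@cvg_col_mx _ _ (nbhs u)); [exact: cc|exact: cd].
Qed.

Lemma gep_map_strict : strictly_differentiable gep_map (col_mx x eta) gep_map_jac.
Proof.
move=> e e0.
pose C := (l%:R + 1) * (m%:R + 1) : R.
have lm1 (k : nat) : 0 < k%:R + 1 :> R by rewrite ltr_wpDl.
have C0 : 0 < C by rewrite mulr_gt0.
have [B B0 HB] := derive_bound db.
(* A generous sum of the constants in the block estimates [b1] to [b5]. *)
pose K := n%:R + m%:R + l%:R + C * (2 * (enorm eta + B) + 5) : R.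
have K0 : 0 < K.
  have := ler0n R n; have := ler0n R m; have := ler0n R l.
  have : 0 < C * (2 * (enorm eta + B) + 5).
    by rewrite mulr_gt0 // ltr_wpDl // mulr_ge0 // addr_ge0 ?enorm_ge0.
  rewrite /K; lra.
pose ep := Num.min 1 (e / K).
have ep0 : 0 < ep by rewrite lt_min ltr01 divr_gt0.
have ep1 : ep <= 1 by rewrite ge_min lexx.
have epK : K * ep <= e.
  have : ep <= e / K by rewrite ge_min lexx orbT.
  by rewrite ler_pdivlMr // mulrC.
clearbody ep.
have [d1 d10 H1] := mx_strict x hF ep0.
have [d2 d20 H2] := mx_strict x hg ep0.
have [d3 d30 H3] := mx_strict x hb ep0.
pose d := Num.min (Num.min d1 d2) (Num.min d3 ep).
have d0 : 0 < d by rewrite /d !lt_min d10 d20 d30 ep0.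
exists d => // u u'; set y := usubmx u; set y' := usubmx u'.
set z := dsubmx u; set z' := dsubmx u' => ud ud'.
have subE (v : 'cV[R]_(n + l)) : v - col_mx x eta = col_mx (usubmx v - x) (dsubmx v - eta).
  by rewrite -{1}[v]vsubmxK opp_col_mx add_col_mx.
have dle (v : 'cV[R]_(n + l)) : enorm (v - col_mx x eta) <= d ->
    enorm (usubmx v - x) <= d /\ enorm (dsubmx v - eta) <= d.
  move=> vd; split; apply: le_trans vd; rewrite subE.
    by have := enorm_usubmx (col_mx (usubmx v - x) (dsubmx v - eta)); rewrite col_mxKu.
  by have := enorm_dsubmx (col_mx (usubmx v - x) (dsubmx v - eta)); rewrite col_mxKd.
have [yd zd] := dle _ ud; have [yd' zd'] := dle _ ud'.
rewrite -/y -/z -/y' -/z' in yd zd yd' zd'.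
set w := u - u'; set N := enorm w; have N0 : 0 <= N by exact: enorm_ge0.
have wE : w = col_mx (y - y') (z - z').
  by rewrite /w -[u]vsubmxK -[u']vsubmxK opp_col_mx add_col_mx.
have yN : enorm (y - y') <= N.
  by have := enorm_usubmx w; rewrite {1}wE col_mxKu.
have zN : enorm (z - z') <= N.
  by have := enorm_dsubmx w; rewrite {1}wE col_mxKd.
have dd1 : d <= d1 by rewrite /d !ge_min lexx.
have dd2 : d <= d2 by rewrite /d !ge_min lexx orbT.
have dd3 : d <= d3 by rewrite /d !ge_min lexx !orbT.
have dd4 : d <= ep by rewrite /d !ge_min lexx !orbT.
have E1 := H1 _ _ (le_trans yd dd1) (le_trans yd' dd1).
have E2 := H2 _ _ (le_trans yd dd2) (le_trans yd' dd2).
have E3 := H3 _ _ (le_trans yd dd3) (le_trans yd' dd3).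
have x0 : enorm (x - x) <= d3 by rewrite subrr enorm0 ltW.
have E4 := H3 _ _ (le_trans yd' dd3) x0.
set rF := F y - F y' - _ in E1; set rg := g y - g y' - _ in E2.
set rb := b y - b y' - _ in E3; set rb' := b y' - b x - _ in E4.
(* The bilinear term leaves the linearization error of b applied to eta, plus two products of small
   differences; each is O(ep) times |u - u'|. *)
have -> : gep_map u - gep_map u' - gep_map_jac *m w =
  col_mx (rF + rb^T *m eta + (b y' - b x)^T *m (z - z') + (b y - b y')^T *m (z - eta))
    (col_mx rg 0).
  rewrite wE gep_map_jacE /gep_map -/y -/y' -/z -/z' !opp_col_mx !add_col_mx.
  congr col_mx; last first.
    by rewrite jac_mulmx // opprB subrKA subrr.
  rewrite /rF /rb jac_mulmx //.
  have trB (A A' : 'M[R]_(l, m)) : (A - A')^T = A^T - A'^T by rewrite linearB.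
  rewrite !trB !(mulmxBl, mulmxBr, mulmxDl, mulmxDr).
  set t1 := _^T *m eta; set t2 := (b y')^T *m eta; set t3 := (b y)^T *m z.
  set t4 := (b y')^T *m z; set t5 := (b y')^T *m z'; set t6 := (b x)^T *m z.
  set t7 := (b x)^T *m z'; set t8 := (_ ^T *m eta).
  by apply/matrixP => i j; rewrite !mxE; ring.
have bd (A : 'M[R]_(l, m)) (v : 'cV[R]_l) a c : `|A| <= a -> enorm v <= c ->
    enorm (A^T *m v) <= C * (a * c).
  move=> Aa vc; apply: (le_trans (mulmx_norm _ _)).
  have a0 : 0 <= a by exact: le_trans Aa.
  have c0 : 0 <= c by apply: le_trans vc; exact: enorm_ge0.
  have At : `|A^T| <= a.
    by apply: mx_norm_le => // i j; rewrite mxE (le_trans (mx_norm_coord _ _ _)).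
  rewrite mulrA /C (mulrC (l%:R + 1)).
  apply: ler_pM; rewrite ?mulr_ge0 ?enorm_ge0 //.
    by apply: ler_pM => //; rewrite lerDl.
  by apply: ler_pM; rewrite ?enorm_ge0.
have epN : 0 <= ep * N by rewrite mulr_ge0 // ltW.
have yepN : ep * enorm (y - y') <= ep * N by rewrite ler_pM2l.
have b1 : enorm rF <= m%:R * (ep * N).
  apply: (le_trans (enorm_le_norm _)); rewrite ler_wpM2l //; exact: le_trans yepN.
have b2 : enorm rg <= l%:R * (ep * N).
  apply: (le_trans (enorm_le_norm _)); rewrite ler_wpM2l //; exact: le_trans yepN.
have b3 : enorm (rb^T *m eta) <= C * (ep * N * enorm eta).
  by apply: bd => //; exact: le_trans yepN.
have b4 : enorm ((b y' - b x)^T *m (z - z')) <= C * ((1 + B) * ep * N).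
  apply: bd => //; rewrite -[b y' - b x](subrK ('D_(y' - x) b x)).
  apply: (le_trans (ler_normD _ _)); apply: (le_trans (lerD E4 (HB _))).
  rewrite -mulrDl; apply: ler_pM; rewrite ?enorm_ge0 //; last exact: le_trans dd4.
    by rewrite addr_ge0 // ltW.
  by rewrite lerD2r.
have b5 : enorm ((b y - b y')^T *m (z - eta)) <= C * ((1 + B) * N * ep).
  apply: bd; last exact: le_trans dd4.
  rewrite -[b y - b y'](subrK ('D_(y - y') b x)).
  apply: (le_trans (ler_normD _ _)); apply: (le_trans (lerD E3 (HB _))).
  rewrite -mulrDl; apply: ler_pM; rewrite ?enorm_ge0 //.
    by rewrite addr_ge0 // ltW.
  by rewrite lerD2r.
apply: (@le_trans _ _ (K * ep * N)); last by rewrite ler_wpM2r.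
apply: (le_trans (enorm_col_mx _ _)).
have := enorm_col_mx rg (0 : 'cV[R]_l); rewrite enorm0 addr0 => c1.
have c2 := enormD (rF + rb^T *m eta + (b y' - b x)^T *m (z - z'))
  ((b y - b y')^T *m (z - eta)).
have c3 := enormD (rF + rb^T *m eta) ((b y' - b x)^T *m (z - z')).
have c4 := enormD rF (rb^T *m eta).
have n0 : 0 <= n%:R * (ep * N) by rewrite mulr_ge0.
have c5 : 0 <= C * (ep * N * (enorm eta + 3)).
  by rewrite mulr_ge0 ?(ltW C0) // mulr_ge0 // addr_ge0 ?enorm_ge0.
rewrite /K; clear -b1 b2 b3 b4 b5 c1 c2 c3 c4 c5 n0; lra.
Qed.

Lemma gep_map_expands2 :
  expands2 gep_map (col_mx x eta) (mulmx gep_map_jac) gep_map_hess.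
Proof.
move=> t_ h_ h t0 t_0 hh.
have dh : usubmx (h_ i) @[i --> \oo] --> usubmx h by exact: cvg_usubmx.
have eh : dsubmx (h_ i) @[i --> \oo] --> dsubmx h by exact: cvg_dsubmx.
have XF := mx_expands2 hF t0 t_0 dh; have Xg := mx_expands2 hg t0 t_0 dh.
have Xb := mx_expands2 hb t0 t_0 dh; have Xb1 := mx_expands1 hb t0 t_0 dh.
have -> : 2^-1 *: gep_map_hess h = col_mx
   (2^-1 *: hessq_mx F x (usubmx h) + ((2^-1 *: hessq_mx b x (usubmx h))^T *m eta
      + ('D_(usubmx h) b x)^T *m dsubmx h)) (col_mx (2^-1 *: hessq_mx g x (usubmx h)) 0).
  rewrite /gep_map_hess !scale_col_mx scaler0; congr col_mx.
  rewrite !scalerDr scalerA mulVf ?pnatr_eq0 // scale1r -addrA; congr (_ + (_ + _)).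
  by rewrite linearZ /= scalemxAl.
(* In b^T eta the second-order remainder of b meets the fixed eta, and the first-order quotient of b
   meets the moving part e; the latter produces the cross term. *)
pose Y i := col_mx
  ((t_ i ^+ 2)^-1 *: (F (x + t_ i *: usubmx (h_ i)) - F x - t_ i *: 'D_(usubmx (h_ i)) F x)
   + (((t_ i ^+ 2)^-1 *: (b (x + t_ i *: usubmx (h_ i)) - b x
                          - t_ i *: 'D_(usubmx (h_ i)) b x))^T *m eta
     + ((t_ i)^-1 *: (b (x + t_ i *: usubmx (h_ i)) - b x))^T *m dsubmx (h_ i)))
  (col_mx ((t_ i ^+ 2)^-1 *: (g (x + t_ i *: usubmx (h_ i)) - g x
                              - t_ i *: 'D_(usubmx (h_ i)) g x)) (0 : 'cV[R]_l)).
suff -> : (fun i => (t_ i ^+ 2)^-1 *: (gep_map (col_mx x eta + t_ i *: h_ i)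
    - gep_map (col_mx x eta) - t_ i *: (gep_map_jac *m h_ i))) = Y.
  apply: cvg_col_mx; [apply: cvgD => //; apply: cvgD|apply: cvg_col_mx => //; exact: cvg_cst].
    by apply: cvg_mulmx; [exact: cvg_trmx|exact: cvg_cst].
  by apply: cvg_mulmx => //; exact: cvg_trmx.
apply/funext => i; rewrite /Y -{1 2}[h_ i]vsubmxK; set d := usubmx _; set e := dsubmx _.
have ti : t_ i != 0 by rewrite gt_eqF.
have trB (A A' : 'M[R]_(l, m)) : (A - A')^T = A^T - A'^T by rewrite linearB.
have trZ a (A : 'M[R]_(l, m)) : (a *: A)^T = a *: A^T by rewrite linearZ.
rewrite gep_map_jacE /gep_map scale_col_mx add_col_mx !col_mxKu !col_mxKd.
rewrite !scale_col_mx !opp_col_mx !add_col_mx !scale_col_mx.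
rewrite !jac_mulmx //; congr col_mx; last first.
  by congr col_mx; rewrite (addrAC eta) subrr add0r subrr scaler0.
have -> : ((t_ i)^-1 *: (b (x + t_ i *: d) - b x))^T *m e =
    (t_ i ^+ 2)^-1 *: ((b (x + t_ i *: d) - b x)^T *m (t_ i *: e)).
  by rewrite trZ -scalemxAl -scalemxAr scalerA expr2 invfM -mulrA mulVf // mulr1.
rewrite (_ : ((t_ i ^+ 2)^-1 *: _)^T = (t_ i ^+ 2)^-1 *:
   ((b (x + t_ i *: d))^T - (b x)^T - t_ i *: ('D_d b x)^T)); last first.
  by rewrite trZ !trB trZ.
rewrite -scalemxAl -!scalerDr; congr (_ *: _).
rewrite !trB !(mulmxBl, mulmxBr, mulmxDl, mulmxDr) -!scalemxAr -!scalemxAl.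
set u1 := _ *m eta; set u2 := _ *m e; set u3 := _ *m eta; set u4 := _ *m e.
by apply/matrixP => i' j'; rewrite !mxE; ring.
Qed.

Lemma gep_objective_expands2 :
  expands2 (fun u => f (usubmx u)) (col_mx x eta)
    (dot (col_mx (grad f x) (0 : 'cV[R]_l))) (fun h => hessq f x (usubmx h)).
Proof.
move=> t_ h_ h t0 t_0 hh.
have dh : usubmx (h_ i) @[i --> \oo] --> usubmx h by exact: cvg_usubmx.
have X := C2_expands2 hf t0 t_0 dh.
rewrite [X in X @ _ --> _](_ : _ = fun i => (t_ i ^+ 2)^-1 *:
  (f (x + t_ i *: usubmx (h_ i)) - f x - t_ i *: 'D_(usubmx (h_ i)) f x)) //.
apply/funext => i; rewrite -[h_ i]vsubmxK dot_col_mx dot0l addr0.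
rewrite dot_grad; last exact: (proj1 hf).
by rewrite scale_col_mx add_col_mx !col_mxKu.
Qed.

End ConstraintMap.

(** * Tangent and normal cones of the product with zero *)

Section ZeroTimes.
Context {R : realType} {p q : nat}.
Implicit Type C : set 'cV[R]_q.

Definition zero_times C : set 'cV[R]_(p + q) :=
  [set z | usubmx z = 0 /\ C (dsubmx z)].

Lemma zero_times_col C a z : zero_times C (col_mx a z) <-> a = 0 /\ C z.
Proof. by rewrite /zero_times /= col_mxKu col_mxKd. Qed.

Lemma zero_times_shift C z (v : 'cV[R]_(p + q)) :
  zero_times C (col_mx 0 z + v) <-> usubmx v = 0 /\ C (z + dsubmx v).
Proof. by rewrite -{1}[v]vsubmxK add_col_mx add0r zero_times_col. Qed.

Lemma tcone_zero_times C z :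
  tcone (zero_times C) (col_mx 0 z) = zero_times (tcone C z).
Proof.
apply/seteqP; split => u.
  move=> [t_ [u_ [t0 t_0 uu CC]]].
  have u0 i : usubmx (u_ i) = 0.
    have [+ _] := (zero_times_shift _ _ _).1 (CC i).
    by rewrite linearZ /= => /eqP; rewrite scaler_eq0 gt_eqF //= => /eqP.
  split.
    apply: (@norm_cvg_unique _ _ ((fun i => usubmx (u_ i)) @ \oo)).
      exact: cvg_usubmx.
    by rewrite (_ : (fun i => _) = cst 0) ?u0; [exact: cvg_cst|apply/funext].
  exists t_, (fun i => dsubmx (u_ i)); split => //; first exact: cvg_dsubmx.
  move=> i; have [_] := (zero_times_shift _ _ _).1 (CC i).
  by rewrite linearZ.
move=> [u0 [t_ [u_ [t0 t_0 uu CC]]]]; exists t_, (fun i => col_mx 0 (u_ i)); split => //.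
  by rewrite -[u]vsubmxK u0; apply: cvg_col_mx => //; exact: cvg_cst.
move=> i; apply/zero_times_shift; rewrite scale_col_mx scaler0 col_mxKu col_mxKd.
by split.
Qed.

Lemma regular_ncone_zero_times C z y1 y2 :
  regular_ncone C z y2 -> regular_ncone (zero_times C) (col_mx 0 z) (col_mx y1 y2).
Proof.
move=> [Cz yz]; split; first exact/zero_times_col.
move=> e e0; have [d d0 zd] := near_enorm (yz e e0).
near=> z' => /=; rewrite -{1}[z']vsubmxK => /zero_times_col[z'0 Cz'].
have z'd : enorm (z' - col_mx 0 z) < d by near: z'; exact: near_enorm_lt.
have z'E : z' - col_mx 0 z = col_mx 0 (dsubmx z' - z).
  by rewrite -{1}[z']vsubmxK z'0 opp_col_mx add_col_mx subrr.
have nE : enorm (z' - col_mx 0 z) = enorm (dsubmx z' - z).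
  by rewrite z'E /enorm dot_col_mx dot0r add0r.
by rewrite nE {1}z'E dot_col_mx dot0r add0r; apply: zd => //; rewrite -nE.
Unshelve. all: by end_near. Qed.

Lemma zero_times_regular_ncone C z y :
  regular_ncone (zero_times C) z y -> regular_ncone C (dsubmx z) (dsubmx y).
Proof.
move=> [[z0 Cz] yz]; split => // e e0; have [d d0 zd] := near_enorm (yz e e0).
near=> z' => /= Cz'.
have zE : col_mx 0 z' - z = col_mx 0 (z' - dsubmx z).
  by rewrite -{1}[z]vsubmxK z0 opp_col_mx add_col_mx subrr.
have nE : enorm (col_mx 0 z' - z) = enorm (z' - dsubmx z).
  by rewrite zE /enorm dot_col_mx dot0r add0r.
have := zd (col_mx 0 z'); rewrite nE zE -{1}[y]vsubmxK dot_col_mx dot0r add0r; apply.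
  by near: z'; exact: near_enorm_lt.
exact/zero_times_col.
Unshelve. all: by end_near. Qed.

Lemma dir_ncone_zero_times C z w y :
  dir_ncone (zero_times C) (col_mx 0 z) w y -> dir_ncone C z (dsubmx w) (dsubmx y).
Proof.
move=> [t_ [u_ [v_ [t0 t_0 uw vy vN]]]].
exists t_, (fun i => dsubmx (u_ i)), (fun i => dsubmx (v_ i)); split => //.
- exact: cvg_dsubmx.
- exact: cvg_dsubmx.
move=> i; have := zero_times_regular_ncone (vN i).
by rewrite linearD /= col_mxKd linearZ.
Qed.

End ZeroTimes.

(** * Stability of normal cones and injectivity on their differences *)

Section NormalConeBounds.
Context {R : realType} {l m : nat}.

Lemma inU_Tloc_ray k (D : seq (seq ('cV[R]_k * R))) z v :
  (forall h : R, 0 < h -> inU D (z + h *: v)) -> inU (Tloc D z) v.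
Proof.
move=> zv; have [r r0 Dr] := inU_local D z.
have v1 : 0 < enorm v + 1 by rewrite ltr_wpDl // enorm_ge0.
have h0 : 0 < r / (enorm v + 1) by rewrite divr_gt0.
rewrite -(conic_inUZ _ (conic_Tloc _ _) h0) -Dr ?zv //.
by rewrite enormZ gtr0_norm // mulrAC ltr_pdivrMr // ltr_pM2l // ltrDl.
Qed.

(** Near [p], P is the translate of a convex cone. It contains p' - p and every tangent [v], hence
    also p' + s v - p for small s > 0, so a normal at p' is nonpositive on [v]. *)
Lemma ncone_near (P : set 'cV[R]_l) p : polyhedral P -> P p ->
  \forall p' \near p, forall x, ncone P p' x -> ncone P p x.
Proof.
move=> /polyhedral_inP[X ->] Xp; have [r r0 Xr] := inU_local [:: X] p.
have TE v : inU (Tloc [:: X] p) v = inP (active X p) v by rewrite /Tloc /= Xp inU1.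
near=> p' => x [Xp' xp']; apply/ncone_inP; split => // v vX.
have p'r : enorm (p' - p) < r by near: p'; exact: near_enorm_lt.
have vT : inP (active X p) v by move: vX; rewrite /inP /unzip1 /active !all_map.
have v1 : 0 < enorm v + 1 by rewrite ltr_wpDl // enorm_ge0.
pose s := (r - enorm (p' - p)) / (enorm v + 1).
have s0 : 0 < s by rewrite divr_gt0 // subr_gt0.
have := xp' (p' + s *: v); rewrite addrAC subrr add0r dotZr pmulr_rle0 //; apply.
have -> : p' + s *: v = p + ((p' - p) + s *: v) by rewrite addrA (addrC p) subrK.
rewrite /= -inU1 Xr.
  have := Xr _ p'r; rewrite (addrC p) subrK inU1 Xp' !TE => /esym /allP p'T.
  apply/allP => h hX; rewrite dotDr dotZr.
  have := p'T h hX; have /mapP[h' _ h'E] := hX; rewrite h'E /= => le1.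
  have : dot h'.1 v <= 0 by move/allP: vT => /(_ h hX); rewrite h'E.
  by move=> le2; rewrite -[leRHS](addr0 0) lerD // pmulr_rle0.
apply: (le_lt_trans (enormD _ _)); rewrite enormZ gtr0_norm //.
have : s * enorm v < s * (enorm v + 1) by rewrite ltr_pM2l // ltrDl.
rewrite {2}/s divfK ?gt_eqF //; lra.
Unshelve. all: by end_near. Qed.

(** The normals of a subspace form its orthogonal complement, so [normals_quantified] turns
    injectivity of b^T on the span into a uniform lower bound. *)
Lemma ncone_injective_bound (P : set 'cV[R]_l) p (b : 'M[R]_(l, m)) :
  polyhedral P -> P p ->
  (forall ds, b^T *m ds = 0 -> span_diff (ncone P p) ds -> ds = 0) ->
  exists2 kap : R, 0 < kap & forall x x', ncone P p x -> ncone P p x' ->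
    kap * enorm (x - x') <= enorm (b^T *m (x - x')).
Proof.
move=> /polyhedral_inP[X ->] Xp inj_b.
(* S is the orthogonal complement of span (N_P p) *)
pose S := [:: [seq (a, 0 : R) | a <- unzip1 (active X p)] ++
              [seq (- a, 0) | a <- unzip1 (active X p)]].
have SE v : inU S v <-> forall a, a \in unzip1 (active X p) -> dot a v = 0.
  rewrite inU1 /inP; move: (unzip1 _) => gens; rewrite all_cat !all_map.
  split=> [/andP[/allP p1 /allP p2] a aX|av].
    apply: le_anti; apply/andP; split; first exact: (p1 a aX).
    by rewrite -oppr_le0 -dotNl; exact: (p2 a aX).
  by apply/andP; split; apply/allP => a aX /=; rewrite ?dotNl av ?oppr0.
have cS : conic S.
  rewrite /S; move: (unzip1 _) => gens; rewrite /conic /= andbT all_cat !all_map.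
  by apply/andP; split; apply/allP => a _ /=.
have N0 : ncone [set y | inP X y] p 0.
  by apply/ncone_inP; split => // v _; rewrite dot0l.
have [y Sy by0|kap kap0 kapS] := @normals_quantified _ _ _ S b.
  apply: inj_b => //; exists (unzip1 (active X p)); split=> [a aX|].
    exists a; last by exists 0; rewrite ?subr0.
    by apply/ncone_inP; split => // v /allP/(_ a aX).
  have [s /SE sS yS] := Sy.
  have yle v : (forall a, a \in unzip1 (active X p) -> dot a v = 0) -> dot y v <= 0.
    move=> av; apply: yS; apply: inU_Tloc_ray => h h0; apply/SE => a aX.
    by rewrite dotDr dotZr av // sS // mulr0 addr0.
  apply: span_annihilator => v av; apply: le_anti; rewrite yle //=.
  by rewrite -oppr_le0 -dotNr yle // => a aX; rewrite dotNr av // oppr0.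
exists kap => // x x' /ncone_inP[_ xN] /ncone_inP[_ x'N]; apply: kapS.
have S0 : inU S 0 by apply/SE => a _; rewrite dot0r.
exists 0 => // v vT.
have /SE av : inU S v.
  have [r r0 Sr] := inU_local S 0.
  have v1 : 0 < enorm v + 1 by rewrite ltr_wpDl // enorm_ge0.
  have h0 : 0 < r / (enorm v + 1) by rewrite divr_gt0.
  rewrite -(conic_inUZ _ cS h0) -[_ *: _]add0r Sr ?conic_inUZ ?conic_Tloc //.
  by rewrite enormZ gtr0_norm // mulrAC ltr_pdivrMr // ltr_pM2l // ltrDl.
have xv : dot x v <= 0 by apply: xN; apply/allP => a /av ->.
have x'v : dot x' (- v) <= 0.
  by apply: x'N; apply/allP => a /av; rewrite dotNr => ->; rewrite oppr0.
by rewrite dotBl; rewrite dotNr in x'v; lra.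
Qed.

End NormalConeBounds.

(** * Local Lipschitz bounds and almost nearest points *)

Section Lipschitz.
Context {R : realType} {n : nat}.

Lemma mx_lipschitz p q (H : 'cV[R]_n -> 'M[R]_(p, q)) u : C2 H ->
  exists2 L : R, 0 <= L & exists2 d : R, 0 < d & forall x x',
    enorm (x - u) <= d -> enorm (x' - u) <= d -> `|H x - H x'| <= L * enorm (x - x').
Proof.
move=> C2H; have [B B0 HB] := derive_bound (proj1 C2H u).
have [d d0 Hd] := mx_strict u C2H ltr01.
exists (1 + B); first by rewrite addr_ge0.
exists d => // x x' xd x'd; rewrite -[H x - H x'](subrK ('D_(x - x') H u)).
by rewrite (le_trans (ler_normD _ _)) // mulrDl lerD // Hd.
Qed.

Lemma C2_lipschitz (f : 'cV[R]_n -> R) u : C2 f ->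
  exists2 L : R, 0 <= L & exists2 d : R, 0 < d & forall x x',
    enorm (x - u) <= d -> enorm (x' - u) <= d -> `|f x - f x'| <= L * enorm (x - x').
Proof.
move=> C2f; have [d d0 Hd] := C1_strict u (C2_C1 C2f) ltr01.
exists (1 + enorm (grad f u)); first by rewrite addr_ge0 ?enorm_ge0.
exists d => // x x' xd x'd; rewrite -[f x - f x'](subrK ('D_(x - x') f u)).
rewrite (le_trans (ler_normD _ _)) // mulrDl lerD // ?Hd //.
rewrite -dot_grad; last exact: (proj1 C2f).
by rewrite ler_norml dot_geN dot_le.
Qed.

Lemma enorm_dist_lt k (y : 'cV[R]_k) (C : set 'cV[R]_k) (r : R) :
  C !=set0 -> enorm_dist y C < r -> exists2 z, C z & enorm (y - z) < r.
Proof.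
move=> [z0 Cz0] yr.
have hinf : has_inf [set enorm (y - z) | z in C].
  by split; [exists (enorm (y - z0)); exists z0|exists 0 => _ [z _ <-]; exact: enorm_ge0].
have e0 : 0 < r - enorm_dist y C by rewrite subr_gt0.
have [_ [z Cz <-]] := inf_adherent e0 hinf.
by rewrite -/(enorm_dist y C) => h; exists z => //; lra.
Qed.

End Lipschitz.

(** * The two optimality conditions for the generalized equation *)

Section OptimalityConditions.
Context {R : realType} {n m l : nat}.
Variables (P : set 'cV[R]_l) (f : 'cV[R]_n -> R) (F : 'cV[R]_n -> 'cV[R]_m).
Variables (g : 'cV[R]_n -> 'cV[R]_l) (b : 'cV[R]_n -> 'M[R]_(l, m)).
Variables (x : 'cV[R]_n) (eta : 'cV[R]_l).
Hypotheses (hP : polyhedral P) (hf : C2 f) (hF : C2 F) (hg : C2 g) (hb : C2 b).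
Hypothesis hCQg : forall ds : 'cV[R]_l, (jac g x)^T *m ds = 0 ->
  span_diff (ncone P (g x)) ds -> ds = 0.
Hypothesis hCQb : forall ds : 'cV[R]_l, (b x)^T *m ds = 0 ->
  span_diff (ncone P (g x)) ds -> ds = 0.
Hypothesis heta : gep_multiplier P F g b x eta.

Variable Q : seq (seq ('cV[R]_(m + (l + l)) * R)).
Hypothesis QE : [set z | inU Q z] = zero_times (gph_ncone P).

Let G := gep_map F g b.
Let M := gep_map_jac F g b x eta.
Let u := col_mx x eta.
Let z0 := col_mx (g x) eta.

Lemma gep_map_base : G u = col_mx 0 z0.
Proof. by rewrite /G /gep_map /u col_mxKu col_mxKd; case: heta => _ <-. Qed.

Lemma inU_gep v : inU Q (G v) <-> gep_multiplier P F g b (usubmx v) (dsubmx v).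
Proof.
have -> : inU Q (G v) <-> zero_times (gph_ncone P) (G v) by rewrite -QE.
rewrite /G /gep_map zero_times_col /gph_ncone /= col_mxKu col_mxKd.
by split => [[v0 vN]|[vN v0]].
Qed.

Lemma inU_base : inU Q (G u).
Proof. by apply/inU_gep; rewrite /u col_mxKu col_mxKd. Qed.

Lemma tangent_base : [set v | inU (Tloc Q (G u)) v] = zero_times (tcone (gph_ncone P) z0).
Proof. by rewrite -(tconeE inU_base) QE gep_map_base tcone_zero_times. Qed.

Lemma critical_tangent d e :
  gep_critical P f F g b x eta d e <->
  dot (col_mx (grad f x) (0 : 'cV[R]_l)) (col_mx d e) <= 0 /\
  inU (Tloc Q (G u)) (M *m col_mx d e).
Proof.
have -> : inU (Tloc Q (G u)) (M *m col_mx d e) <->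
    zero_times (tcone (gph_ncone P) z0) (M *m col_mx d e) by rewrite -tangent_base.
rewrite /M gep_map_jacE // zero_times_col dot_col_mx dot0l addr0.
by split => [[c1 c2 c3]|[c1 [c2 c3]]].
Qed.

Lemma first_orderE alpha lam tau :
  alpha *: col_mx (grad f x) 0 + M^T *m col_mx (- lam) (col_mx tau (b x *m lam)) = 0 <->
  gep_first_order f F g b x eta alpha lam tau = 0.
Proof.
rewrite gep_map_jac_tr subrr scale_col_mx scaler0 add_col_mx addr0 /gep_first_order !addrA.
by split => [/(congr1 usubmx)|->]; rewrite ?col_mxKu ?linear0 ?col_mx0.
Qed.

Lemma second_orderE d e alpha lam tau sigma :
  alpha * hessq f x (usubmx (col_mx d e)) + dot (col_mx (- lam) (col_mx tau sigma))
    (gep_map_hess F g b x eta (col_mx d e)) =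
  gep_second_order f F g b x eta d e alpha lam tau.
Proof.
rewrite /gep_map_hess col_mxKu col_mxKd !dot_col_mx dot0r addr0 dotNl addrA.
by [].
Qed.

Lemma gep_necessary d e :
  gep_local_min P f F g b x -> gep_critical P f F g b x eta d e ->
  (forall (lam : 'cV[R]_m) (tau : 'cV[R]_l),
     (jac F x)^T *m lam + (jac (fun y => (b y)^T *m eta) x)^T *m lam
       - (jac g x)^T *m tau = 0 ->
     dir_ncone (gph_ncone P) z0 (col_mx (jac g x *m d) e) (col_mx tau (b x *m lam)) ->
     lam = 0) ->
  exists (lam : 'cV[R]_m) (tau : 'cV[R]_l),
    [/\ dir_ncone (gph_ncone P) z0 (col_mx (jac g x *m d) e) (col_mx tau (b x *m lam)),
        gep_first_order f F g b x eta 1 lam tau = 0 &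
        0 <= gep_second_order f F g b x eta d e 1 lam tau].
Proof.
move=> [_ xmin] /critical_tangent[cd dT] CQ.
have Mde : dsubmx (M *m col_mx d e) = col_mx (jac g x *m d) e.
  by rewrite /M gep_map_jacE // col_mxKd.
have ndir (y : 'cV[R]_(m + (l + l))) :
    normals (Tloc (Tloc Q (G u)) (M *m col_mx d e)) y ->
    dir_ncone (gph_ncone P) z0 (col_mx (jac g x *m d) e) (dsubmx y).
  move=> /(normals_dir_ncone inU_base dT).
  by rewrite QE gep_map_base => /dir_ncone_zero_times; rewrite Mde.
have yE (y : 'cV[R]_(m + (l + l))) :
    y = col_mx (- (- usubmx y)) (col_mx (usubmx (dsubmx y)) (dsubmx (dsubmx y))).
  by rewrite opprK !vsubmxK.
(* Here the qualification condition on lam alone becomes the full one: lam = 0 kills sigma = b lam,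
   and [hCQg] kills tau. *)
have CQ' y : normals (Tloc (Tloc Q (G u)) (M *m col_mx d e)) y -> M^T *m y = 0 -> y = 0.
  move=> /ndir; rewrite [y]yE; set lam := - usubmx y.
  set tau := usubmx _; set sigma := dsubmx (dsubmx y); rewrite col_mxKd => yN.
  rewrite gep_map_jac_tr => y0.
  have := congr1 usubmx y0; rewrite col_mxKu linear0 => st.
  have := congr1 dsubmx y0; rewrite col_mxKd linear0 => /subr0_eq sE.
  rewrite sE in yN; have lam0 : lam = 0.
    apply: (CQ lam tau) yN; apply/eqP; rewrite -oppr_eq0 -st.
    by rewrite opprB opprD addrC.
  have tau0 : tau = 0.
    have gP : P (g x) by case: heta => [[]].
    apply: hCQg; last exact: (dir_ncone_span hP gP yN).
    by rewrite -st lam0 !mulmx0 oppr0 addr0 add0r.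
  by rewrite sE lam0 tau0 mulmx0 oppr0 !col_mx0.
(* Local minimality in x passes to (x, eta), since feasibility of x accepts any multiplier. *)
have umin : \forall v \near u, inU Q (G v) -> f (usubmx u) <= f (usubmx v).
  have [r r0 xr] := near_enorm xmin.
  near=> v => /inU_gep vN; rewrite {1}/u col_mxKu; apply: xr; last by exists (dsubmx v).
  have vu : enorm (v - u) < r by near: v; exact: near_enorm_lt.
  apply: le_lt_trans vu; apply: (le_trans _ (enorm_usubmx _)).
  by rewrite linearB /= [usubmx u]col_mxKu.
have [y [yN st so]] := second_order_necessary (gep_map_continuous hF hg hb)
  (@gep_map_strict _ _ _ _ _ _ _ hF hg hb x eta)
  (@gep_map_expands2 _ _ _ _ _ _ _ hF hg hb x eta)
  (@gep_objective_expands2 _ _ _ _ hf x eta) dT cd umin CQ'.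
exists (- usubmx y), (usubmx (dsubmx y)).
have sE : dsubmx (dsubmx y) = b x *m - usubmx y.
  have := congr1 dsubmx st; rewrite [y]yE gep_map_jac_tr add_col_mx add0r col_mxKd linear0.
  by rewrite -yE => /subr0_eq.
split.
- by rewrite -sE vsubmxK; exact: ndir.
- by apply/first_orderE; rewrite -sE -yE scale1r.
- by rewrite -(second_orderE d e 1 _ _ (dsubmx (dsubmx y))) -yE mul1r.
Unshelve. all: by end_near. Qed.

(* A point violating second-order growth is close to a point whose rescaled
   difference h with (x, eta) is bounded: the multiplier eta' grows at most
   linearly because b^T is injective on differences of normals. *)
Lemma growth_violation : exists B dl : R, [/\ 0 <= B, 0 < dl & forall beta y,
  0 < beta -> beta <= 1 -> 0 < enorm (y - x) -> enorm (y - x) <= dl ->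
  f y - f x < beta * enorm (y - x) ^+ 2 ->
  enorm_dist (gep_phi F y) (gep_Omega P g b) < beta * enorm (y - x) ^+ 2 ->
  exists h z, [/\ enorm h <= B, `|enorm (usubmx h) - 1| <= beta, inU Q z,
    enorm (G (u + enorm (y - x) *: h) - z) <= B * beta * enorm (y - x) ^+ 2 &
    f (usubmx (u + enorm (y - x) *: h)) - f x <= B * beta * enorm (y - x) ^+ 2]].
Proof.
have gP : P (g x) by case: heta => [[]].
have [L1 L10 [d1 d10 HF]] := mx_lipschitz x hF.
have [L2 L20 [d2 d20 Hb]] := mx_lipschitz x hb.
have [L3 L30 [d3 d30 Hf]] := C2_lipschitz x hf.
have [kap kap0 Hkap] := ncone_injective_bound hP gP hCQb.
have [d4 d40 HN] : exists2 d : R, 0 < d & forall x', enorm (x' - x) < d ->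
    forall xi, ncone P (g x') xi -> ncone P (g x) xi.
  apply: (@near_enorm _ _ x (fun x' => forall xi, ncone P (g x') xi -> ncone P (g x) xi)).
  exact: (differentiable_continuous (proj1 hg x) (ncone_near hP gP)).
pose C : R := m%:R * l%:R; have C0 : 0 <= C by rewrite mulr_ge0.
(* Solves kap D <= s (1 + m L1 + 2 C L2 |eta|) + (kap / 2) D for D = |eta' - eta|. *)
pose Be := 2 * (1 + m%:R * L1 + C * (L2 * 2 * enorm eta)) / kap.
have mL0 : 0 <= m%:R * L1 by rewrite mulr_ge0.
have CL0 : 0 <= C * (L2 * 2 * enorm eta) by rewrite !mulr_ge0 ?enorm_ge0.
have Be0 : 0 <= Be.
  by rewrite divr_ge0 ?(ltW kap0) // mulr_ge0 // !addr_ge0.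
(* s K <= kap gives 2 C L2 s <= kap / 2, so the term that contains |eta' - eta| can be absorbed. *)
pose K := 4 * C * L2 + 1.
have K0 : 0 < K by rewrite ltr_wpDl // !mulr_ge0.
(* The feasible point x' satisfies |x' - x| <= 2 s; the 3 keeps it strictly inside every
   neighbourhood. *)
pose dl := Num.min (Num.min 1 (kap / K)) (Num.min (Num.min d1 d2) (Num.min d3 d4) / 3).
have dl0 : 0 < dl.
  by rewrite !lt_min ltr01 divr_gt0 //= divr_gt0 // !lt_min d10 d20 d30.
exists (3 + Be + m%:R * L1 + L3), dl; split => //; first by rewrite !addr_ge0.
move=> beta y beta0 beta1; set s := enorm (y - x) => s0 sdl fy dy.
have [s1 sK sd] : [/\ s <= 1, s * K <= kap & s * 3 <= Num.min (Num.min d1 d2) (Num.min d3 d4)].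
  move: sdl; rewrite !le_min => /andP[/andP[sa sb]].
  rewrite -!le_min => sc; split => //; first by rewrite -ler_pdivlMr.
  by rewrite -ler_pdivlMr.
have [s3d1 s3d2 s3d3 s3d4] : [/\ s * 3 <= d1, s * 3 <= d2, s * 3 <= d3 & s * 3 <= d4].
  by move: sd; rewrite !le_min => /andP[/andP[? ?] /andP[? ?]].
have bs2 : beta * s ^+ 2 <= s.
  rewrite expr2 mulrA ler_piMl ?(ltW s0) // mulr_ile1 // ltW //.
have om0 : gep_Omega P g b !=set0.
  exists (col_mx x ((b x)^T *m eta)), x, eta; split => //.
  by rewrite /gph_ncone /= col_mxKu col_mxKd; case: heta.
have [_ [x' [eta' [gN ->]]]] := enorm_dist_lt om0 dy.
rewrite /gep_phi opp_col_mx add_col_mx => om.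
move: gN; rewrite /gph_ncone /= col_mxKu col_mxKd => etaN'.
have a1 : enorm (x' - y) < beta * s ^+ 2.
  rewrite enormB; apply: le_lt_trans om.
  by have := enorm_usubmx (col_mx (y - x') (- F y - (b x')^T *m eta')); rewrite col_mxKu.
have a2 : enorm (F y + (b x')^T *m eta') < beta * s ^+ 2.
  rewrite -enormN opprD; apply: le_lt_trans om.
  by have := enorm_dsubmx (col_mx (y - x') (- F y - (b x')^T *m eta')); rewrite col_mxKd.
have x'x : enorm (x' - x) <= 2 * s.
  have := enormD (x' - y) (y - x); rewrite addrA subrK -/s; lra.
have etaN : ncone P (g x) eta by case: heta.
have etaN'' : ncone P (g x) eta' by apply: HN etaN'; lra.
have xx0 : enorm (x - x) = 0 by rewrite subrr enorm0.
have Fyx : enorm (F y - F x) <= m%:R * L1 * s.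
  apply: (le_trans (enorm_le_norm _)); rewrite -mulrA ler_wpM2l //.
  apply: HF; rewrite ?xx0 -?/s; lra.
have Fx'y : enorm (F x' - F y) <= m%:R * L1 * (beta * s ^+ 2).
  apply: (le_trans (enorm_le_norm _)); rewrite -mulrA ler_wpM2l //.
  apply: (@le_trans _ _ (L1 * enorm (x' - y))); last by rewrite ler_wpM2l // ltW.
  apply: HF; rewrite -?/s; lra.
have bd v : enorm ((b x - b x')^T *m v) <= C * (L2 * (2 * s) * enorm v).
  apply: (le_trans (mulmx_norm _ _)); rewrite mulrA ler_wpM2l // ler_wpM2r ?enorm_ge0 //.
  apply: (@le_trans _ _ (`|b x - b x'|)).
    by apply: mx_norm_le => // i j; rewrite mxE mx_norm_coord.
  apply: (@le_trans _ _ (L2 * enorm (x - x'))).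
    by apply: Hb; rewrite ?xx0; lra.
  by rewrite ler_wpM2l // enormB.
have De : enorm (eta' - eta) <= Be * s.
  have h1 := Hkap _ _ etaN'' etaN.
  have dE : (b x)^T *m (eta' - eta) = F y + (b x')^T *m eta' - (F y - F x)
      + (b x - b x')^T *m (eta' - eta) + (b x - b x')^T *m eta.
    have trB (A A' : 'M[R]_(l, m)) : (A - A')^T = A^T - A'^T by rewrite linearB.
    have -> : F x = - ((b x)^T *m eta).
      by case: heta => _ /esym/eqP; rewrite addr_eq0 => /eqP.
    rewrite !trB !(mulmxBl, mulmxBr).
    by apply/matrixP => i j; rewrite !mxE; ring.
  have h2 := enormD (F y + (b x')^T *m eta' - (F y - F x)
      + (b x - b x')^T *m (eta' - eta)) ((b x - b x')^T *m eta).
  have h3 := enormD (F y + (b x')^T *m eta' - (F y - F x)) ((b x - b x')^T *m (eta' - eta)).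
  have h4 := enorm_triB (F y + (b x')^T *m eta') (F y - F x).
  have h5 := bd (eta' - eta); have h6 := bd eta; rewrite -dE in h2.
  have De0 := enorm_ge0 (eta' - eta).
  have h7 : C * (L2 * (2 * s) * enorm (eta' - eta)) <= kap / 2 * enorm (eta' - eta).
    rewrite !mulrA ler_wpM2r //; move: sK; rewrite /K; lra.
  rewrite /Be mulrAC ler_pdivlMr //.
  move: h1 h2 h3 h4 h5 h6 h7 a2 bs2 Fyx; lra.
exists (col_mx (s^-1 *: (x' - x)) (s^-1 *: (eta' - eta))), (col_mx 0 (col_mx (g x') eta')).
have sn0 : s != 0 by rewrite gt_eqF.
have -> : u + s *: col_mx (s^-1 *: (x' - x)) (s^-1 *: (eta' - eta)) = col_mx x' eta'.
  rewrite scale_col_mx !scalerA divff // !scale1r add_col_mx.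
  by rewrite (addrC x) subrK (addrC eta) subrK.
have sV0 : 0 < s^-1 by rewrite invr_gt0.
have bs0 : 0 <= beta * s ^+ 2 by rewrite mulr_ge0 ?sqr_ge0 // ltW.
split.
- apply: (le_trans (enorm_col_mx _ _)); rewrite !enormZ gtr0_norm //.
  have : s^-1 * enorm (x' - x) <= 2 by rewrite mulrC ler_pdivrMr.
  have : s^-1 * enorm (eta' - eta) <= Be by rewrite mulrC ler_pdivrMr.
  lra.
(* | |x' - x| - s | <= |x' - y| < beta s^2, and s <= 1. *)
- rewrite col_mxKu enormZ (gtr0_norm sV0).
  rewrite -(mulVf sn0) -mulrBr normrM (gtr0_norm sV0) mulrC ler_pdivrMr //.
  apply: (@le_trans _ _ (beta * s ^+ 2)); last first.
    by rewrite ler_pM2l // expr2 ler_piMl // ltW.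
  have := enormD (x' - y) (y - x); rewrite addrA subrK -/s.
  have := enormD (y - x') (x' - x); rewrite addrA subrK -/s (enormB y x').
  rewrite ler_norml; lra.
- have : zero_times (gph_ncone P) (col_mx 0 (col_mx (g x') eta') : 'cV[R]_(m + (l + l))).
    by apply/zero_times_col; split => //; rewrite /gph_ncone /= col_mxKu col_mxKd.
  by rewrite -QE.
- rewrite /G /gep_map col_mxKu col_mxKd opp_col_mx add_col_mx subr0 subrr.
  apply: (le_trans (enorm_col_mx _ _)); rewrite enorm0 addr0.
  have := enormD (F x' - F y) (F y + (b x')^T *m eta'); rewrite addrA subrK => h1.
  have h2 : 0 <= (2 + Be + L3) * (beta * s ^+ 2) by rewrite mulr_ge0 // !addr_ge0.
  move: h1 h2 a2 Fx'y; lra.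
- rewrite col_mxKu.
  have h1 : f x' - f y <= L3 * (beta * s ^+ 2).
    apply: (le_trans (ler_norm _)).
    apply: (@le_trans _ _ (L3 * enorm (x' - y))); last by rewrite ler_wpM2l // ltW.
    apply: Hf; rewrite -?/s; lra.
  have h2 : 0 <= (2 + Be + m%:R * L1) * (beta * s ^+ 2) by rewrite mulr_ge0 // !addr_ge0.
  move: h1 h2 fy; lra.
Qed.

Lemma gep_sufficient :
  (forall (d : 'cV[R]_n) (e : 'cV[R]_l),
     d != 0 -> gep_critical P f F g b x eta d e ->
     exists (alpha : R) (lam : 'cV[R]_m) (tau : 'cV[R]_l),
       [/\ 0 <= alpha, gep_first_order f F g b x eta alpha lam tau = 0,
           regular_ncone (tcone (gph_ncone P) z0)
             (col_mx (jac g x *m d) e) (col_mx tau (b x *m lam)) &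
           0 < gep_second_order f F g b x eta d e alpha lam tau]) ->
  essential_local_min2 f (gep_phi F) (gep_Omega P g b) x.
Proof.
move=> suff; apply: contrapT => nmin.
have [B [dl [B0 dl0 viol]]] := growth_violation.
have h0 i : 0 < @harmonic R i by exact: harmonic_gt0.
have h1 i : @harmonic R i <= 1 by rewrite /harmonic /= invf_le1 // ler1n.
have /choice[y_ Hy] : forall i, exists y, enorm (y - x) <= Num.min dl (harmonic i) /\
    Num.max (f y - f x) (enorm_dist (gep_phi F y) (gep_Omega P g b))
      < harmonic i * enorm (y - x) ^+ 2.
  move=> i; apply: contrapT => ny; apply: nmin; exists (harmonic i), (Num.min dl (harmonic i)).
  split => //; first by rewrite lt_min dl0 h0.
  by move=> y yd; rewrite leNgt; apply/negP => lt; apply: ny; exists y.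
pose s i := enorm (y_ i - x).
have s0 i : 0 < s i.
  (* At y = x the maximum would be at least f x - f x = 0, yet strictly below 0. *)
  rewrite lt_neqAle enorm_ge0 andbT; apply/negP => /eqP/esym/enorm_eq0/subr0_eq yx.
  have [_] := Hy i; rewrite yx !subrr enorm0 expr0n mulr0 /=.
  by rewrite gt_max ltxx.
have /choice[hz_ Hhz] : forall i, exists hz : 'cV[R]_(n + l) * 'cV[R]_(m + (l + l)),
    [/\ enorm hz.1 <= B, `|enorm (usubmx hz.1) - 1| <= harmonic i, inU Q hz.2,
    enorm (G (u + s i *: hz.1) - hz.2) <= B * harmonic i * s i ^+ 2 &
    f (usubmx (u + s i *: hz.1)) - f x <= B * harmonic i * s i ^+ 2].
  move=> i; have [+ +] := Hy i; rewrite le_min gt_max => /andP[yd _] /andP[fy dy].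
  have [h [z Hhz]] := viol (harmonic i) (y_ i) (h0 i) (h1 i) (s0 i) yd fy dy.
  by exists (h, z).
have hzB i : enorm (hz_ i).1 <= B by case: (Hhz i).
have [h Hh] := bounded_cluster hzB.
(* [sg] need not be increasing: j <= sg j already makes all error terms at most those of index j. *)
have /choice[sg Hsg] : forall j, exists i, (j <= i)%N /\ enorm ((hz_ i).1 - h) < harmonic j.
  by move=> j; have [i ji hi] := Hh (harmonic j) j (h0 j); exists i.
have hsg j : @harmonic R (sg j) <= harmonic j.
  rewrite /harmonic /= lef_pV2 ?posrE ?ltr0n // ler_nat ltnS; by case: (Hsg j).
have hcvg (c : R) : c * @harmonic R i @[i --> \oo] --> (0 : R).
  by rewrite -[X in _ --> X](mulr0 c); apply: cvgMl_tmp; exact: cvg_harmonic.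
have sq0 (a : nat -> R) (c : R) : (forall j, 0 <= a j <= c * harmonic j) ->
    a @ \oo --> (0 : R).
  move=> ac; apply: (@squeeze_cvgr _ _ _ _ (fun=> 0) (fun j => c * harmonic j)).
  - exact: nearW.
  - exact: cvg_cst.
  - exact: hcvg.
have ts0 : s (sg j) @[j --> \oo] --> (0 : R).
  apply: (sq0 _ 1) => j; rewrite enorm_ge0 mul1r (le_trans _ (hsg j)) //.
  by have [+ _] := Hy (sg j); rewrite le_min => /andP[].
have hh : (hz_ (sg j)).1 @[j --> \oo] --> h.
  apply: cvg_enorm0; apply: (sq0 _ 1) => j; rewrite enorm_ge0 mul1r ltW //.
  by case: (Hsg j).
have Gz : (s (sg j) ^+ 2)^-1 *: (G (u + s (sg j) *: (hz_ (sg j)).1) - (hz_ (sg j)).2)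
    @[j --> \oo] --> (0 : 'cV[R]_(m + (l + l))).
  apply: cvg_enorm0; apply: (sq0 _ B) => j; rewrite subr0 enorm_ge0 /=.
  have s2 : 0 < s (sg j) ^+ 2 by rewrite exprn_gt0.
  rewrite enormZ gtr0_norm ?invr_gt0 // mulrC ler_pdivrMr //.
  have [_ _ _ + _] := Hhz (sg j) => /le_trans; apply.
  by rewrite ler_pM2r // ler_wpM2l.
have zQ j : inU Q (hz_ (sg j)).2 by case: (Hhz (sg j)).
have fr j : f (usubmx (u + s (sg j) *: (hz_ (sg j)).1)) - f (usubmx u)
    <= s (sg j) ^+ 2 * (B * harmonic j).
  have [_ _ _ _] := Hhz (sg j); rewrite [usubmx u]col_mxKu => /le_trans; apply.
  by rewrite [leRHS]mulrC ler_pM2r ?exprn_gt0 // ler_wpM2l.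
have [hT ch so] := second_order_limit
  (@gep_map_expands2 _ _ _ _ _ _ _ hF hg hb x eta)
  (@gep_objective_expands2 _ _ _ _ hf x eta) (fun j => s0 (sg j)) ts0 hh
  zQ Gz fr (hcvg B).
have hE : h = col_mx (usubmx h) (dsubmx h) by rewrite vsubmxK.
(* The x-parts of the rescaled differences have norms tending to 1, so the limit direction is
   nonzero. *)
have d0 : usubmx h != 0.
  have c1 : enorm (usubmx (hz_ (sg j)).1) - 1 @[j --> \oo] --> (0 : R).
    apply/norm_cvg0P; apply: (sq0 _ 1) => j; rewrite normr_ge0 mul1r /=.
    by apply: le_trans (hsg j); case: (Hhz (sg j)).
  have c2 : enorm (usubmx (hz_ (sg j)).1) - 1 @[j --> \oo] --> enorm (usubmx h) - 1.
    by apply: cvgB; [apply: cvg_enorm; exact: cvg_usubmx|exact: cvg_cst].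
  have h10 : (0 : R) = enorm (usubmx h) - 1 by exact: (norm_cvg_unique c1 c2).
  by apply: contra_eq_neq h10 => ->; rewrite enorm0 sub0r eq_sym oppr_eq0 oner_eq0.
rewrite hE in hT ch so.
have crit : gep_critical P f F g b x eta (usubmx h) (dsubmx h) by apply/critical_tangent.
have [alpha [lam [tau [alpha0 fo yN]]]] := suff _ _ d0 crit.
rewrite -(second_orderE _ _ _ _ _ (b x *m lam)); apply/negP; rewrite -leNgt.
apply: so => //; first exact/first_orderE.
have Mh : M *m col_mx (usubmx h) (dsubmx h) =
    col_mx 0 (col_mx (jac g x *m usubmx h) (dsubmx h)).
  by rewrite /M gep_map_jacE //; case: crit => _ <-.
have := regular_ncone_zero_times (- lam) yN.
by rewrite -tangent_base -Mh => /regular_nconeE[].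
Qed.

End OptimalityConditions.

Unset Implicit Arguments.

Theorem theorem5p1 (R : realType) (n m l : nat) (P : set 'cV[R]_l)
    (f : 'cV[R]_n -> R) (F : 'cV[R]_n -> 'cV[R]_m)
    (g : 'cV[R]_n -> 'cV[R]_l) (b : 'cV[R]_n -> 'M[R]_(l, m))
    (xbar : 'cV[R]_n)
    (hP : polyhedral P) (hf : C2 f) (hF : C2 F) (hg : C2 g) (hb : C2 b)
    (hxbar : gep_feasible P F g b xbar)
    (hCQg : forall ds : 'cV[R]_l, (jac g xbar)^T *m ds = 0 ->
       span_diff (ncone P (g xbar)) ds -> ds = 0)
    (hCQb : forall ds : 'cV[R]_l, (b xbar)^T *m ds = 0 ->
       span_diff (ncone P (g xbar)) ds -> ds = 0) :
  exists eta : 'cV[R]_l,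
    [/\ unique (gep_multiplier P F g b xbar) eta,
        gep_local_min P f F g b xbar ->
        forall (d : 'cV[R]_n) (e : 'cV[R]_l),
          gep_critical P f F g b xbar eta d e ->
          (forall (lam : 'cV[R]_m) (tau : 'cV[R]_l),
             (jac F xbar)^T *m lam + (jac (fun x => (b x)^T *m eta) xbar)^T *m lam
               - (jac g xbar)^T *m tau = 0 ->
             dir_ncone (gph_ncone P) (col_mx (g xbar) eta)
               (col_mx (jac g xbar *m d) e) (col_mx tau (b xbar *m lam)) ->
             lam = 0) ->
          exists (lam : 'cV[R]_m) (tau : 'cV[R]_l),
            [/\ dir_ncone (gph_ncone P) (col_mx (g xbar) eta)
                  (col_mx (jac g xbar *m d) e) (col_mx tau (b xbar *m lam)),
                gep_first_order f F g b xbar eta 1 lam tau = 0 &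
                0 <= gep_second_order f F g b xbar eta d e 1 lam tau]
      & (forall (d : 'cV[R]_n) (e : 'cV[R]_l),
           d != 0 -> gep_critical P f F g b xbar eta d e ->
           exists (alpha : R) (lam : 'cV[R]_m) (tau : 'cV[R]_l),
             [/\ ~ [/\ alpha = 0, lam = 0 & tau = 0],
                 0 <= alpha,
                 gep_first_order f F g b xbar eta alpha lam tau = 0,
                 regular_ncone (tcone (gph_ncone P) (col_mx (g xbar) eta))
                   (col_mx (jac g xbar *m d) e) (col_mx tau (b xbar *m lam)) &
                 0 < gep_second_order f F g b xbar eta d e alpha lam tau]) ->
        essential_local_min2 f (gep_phi F) (gep_Omega P g b) xbar].
Proof.
have [eta heta] := hxbar; exists eta.
have [X PX] := polyhedral_inP hP; have [Q0 Q0E] := gph_ncone_polyhedral X.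
have [Q HQ] := zero_times_polyhedral m Q0.
have QE : [set z | inU Q z] = zero_times (gph_ncone P).
  have zE z : inU Q z = (usubmx z == 0) && inU Q0 (dsubmx z) by rewrite -HQ vsubmxK.
  apply/seteqP; split => z; rewrite /zero_times PX Q0E /= zE.
    by move=> /andP[/eqP].
  by move=> [-> ->]; rewrite eqxx.
split.
- split => // eta' [eta'N eta'0]; case: heta => etaN eta0.
  apply/subr0_eq; apply: hCQb.
    apply/eqP; rewrite mulmxBr subr_eq0; apply/eqP; apply: (addrI (F xbar)).
    by rewrite -eta0 -eta'0.
  (* The difference of two multipliers spans itself, so [hCQb] applies to it. *)
  exists [:: eta - eta']; split.
    by move=> w; rewrite inE => /eqP ->; exists eta => //; exists eta'.
  by apply: memv_span; rewrite inE.
- move=> xmin d e crit CQ.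
  exact: (gep_necessary hP hf hF hg hb hCQg heta QE xmin crit CQ).
- move=> suff; apply: (gep_sufficient hP hf hF hg hb hCQb heta QE) => d e d0 crit.
  by have [alpha [lam [tau [_ ? ? ? ?]]]] := suff d e d0 crit; exists alpha, lam, tau.
Qed.
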